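(* Let $$U=\{(n,\lambda,\mu,b)\in\mathbb C^4 \mid \mu\neq0,\ b\notin\mathbb Z,\ b+n\notin\mathbb Z\}.$$ For every $(n,\lambda,\mu,b)\in U$ there exist not identically zero holomorphic functions $f_+(z)$, $f_-(z)$ on a neighborhood of $0$ in $\mathbb C$, with $f_+(0)=0$, such that the functions $f_+(z)$ and $f_-(z^{-1})$ satisfy the equations $$z^{-b}\mathcal L\big(z^b f_{\pm}(z^{\pm1})\big)=d_{0\pm}+d_{1\pm}z$$ for appropriate constants $d_{0\pm}=d_{0\pm}(n,\lambda,\mu,b)\in\mathbb C$, $d_{1\pm}=d_{1\pm}(n,\lambda,\mu,b)\in\mathbb C$. Each of the functions $f_+$, $f_-$ is unique up to a constant factor (depending on the parameters), and both are entire, i.e. holomorphic on $\mathbb C$. For each sign the vector $(d_{0\pm},d_{1\pm})$ is uniquely defined up to a scalar factor depending on the parameters. The constant factors (depending on the parameters) up to which the functions $f_+$, $f_-$ and the corresponding vectors $(d_{0\pm},d_{1\pm})$ are unique can be chosen so that both $f_{\pm}$ and $d_{j\pm}$, $j=0,1$, depend holomorphically on $(n,\lambda,\mu,b)\in U$ and, for real parameter values, $f_{\pm}(z)$ is real-valued for $z\in\mathbb R$.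
   Context: For $n,\lambda,\mu\in\mathbb C$ the second order differential operator $\mathcal L=\mathcal L_{\lambda,\mu,n}$ is $$\mathcal L E=z^2E''+(nz+\mu(1-z^2))E'+(\lambda-\mu nz)E .$$ The expression $z^{-b}\mathcal L(z^b g(z))$ is computed with any local branch of $z^b$; it does not depend on the branch. The equation with sign $+$ is for the function $f_+(z)$ near $z=0$, and the equation with sign $-$ is for the function $f_-(z^{-1})$ near $z=\infty$. *)

(* Defs.v *)
From Stdlib Require Import Reals ZArith.
From Coquelicot Require Import Coquelicot.
Open Scope C_scope.

Definition Cexp (z : C) : C := (exp (Re z) * cos (Im z), exp (Re z) * sin (Im z))%R.

Definition is_Cderive (f : C -> C) (z l : C) : Prop :=
  is_derive (K := C_AbsRing) (V := C_NormedModule) f z l.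

Definition ex_Cderive (f : C -> C) (z : C) : Prop :=
  ex_derive (K := C_AbsRing) (V := C_NormedModule) f z.

(* For D open this is joint holomorphy: the scalars are C_AbsRing, so the
   Frechet differential of f at each point of D is complex-linear. *)
Definition holomorphic_on {V : NormedModule C_AbsRing}
    (D : V -> Prop) (f : V -> C) : Prop :=
  forall x : V, D x ->
    ex_filterdiff (K := C_AbsRing) (U := V) (V := C_NormedModule) f (locally x).

(* (n, lambda, mu, b) *)
Definition params : Type := (C * C * C * C)%type.

Definition not_integer (c : C) : Prop := forall k : Z, c <> RtoC (IZR k).

Definition in_U (p : params) : Prop :=
  let '(n, lambda, mu, b) := p in
  mu <> 0 /\ not_integer b /\ not_integer (b + n).

(* E is twice complex differentiable at z and (L E)(z) = v. *)
Definition is_L (lambda mu n : C) (E : C -> C) (z v : C) : Prop :=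
  exists (E' : C -> C) (E'' : C),
    locally z (fun w => is_Cderive E w (E' w)) /\
    is_Cderive E' z E'' /\
    v = z ^ 2 * E'' + (n * z + mu * (1 - z ^ 2)) * E' z
        + (lambda - mu * n * z) * E z.

(* ell is a holomorphic branch of the logarithm near z0; the local branches of
   z^b are then the functions exp (b * ell z). *)
Definition log_branch (z0 : C) (ell : C -> C) : Prop :=
  locally z0 (fun w => ex_Cderive ell w /\ Cexp (ell w) = w).

(* z^(-b) L(z^b g(z)) = v at the point z, for any local branch of z^b at z
   (meaningful for z <> 0; there are no branches at 0). *)
Definition is_conj_L (p : params) (g : C -> C) (z v : C) : Prop :=
  let '(n, lambda, mu, b) := p in
  forall ell : C -> C, log_branch z ell ->
    exists u : C,
      is_L lambda mu n (fun w => Cexp (b * ell w) * g w) z u /\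
      Cexp (- (b * ell z)) * u = v.

Inductive pm_sign : Set := Plus | Minus.

Definition pow_pm (s : pm_sign) (z : C) : C :=
  match s with Plus => z | Minus => / z end.

(* The equation is required at z = x^(+-1) for x <> 0 near 0, that is, for z
   near 0 (sign +) or near infinity (sign -).  "Not identically zero" is read
   for the germ of f at 0: by the identity theorem it amounts to f not
   vanishing identically on a connected neighborhood of 0. *)
Definition is_solution (s : pm_sign) (p : params) (f : C -> C) (d0 d1 : C) : Prop :=
  locally (RtoC 0) (fun z => ex_Cderive f z) /\
  ~ locally (RtoC 0) (fun z => f z = 0) /\
  (s = Plus -> f 0 = 0) /\
  locally' (RtoC 0) (fun x =>
    let z := pow_pm s x in
    is_conj_L p (fun w => f (pow_pm s w)) z (d0 + d1 * z)).

(* Main.v *)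
(** Writing [f_+ (x) = sum a_k x^k] or [f_- (x) = sum a_k x^k] turns the equation into a
    three-term recurrence [alpha_i a_i = q_i a_(i+1) + beta_i a_(i+2)], whose coefficients
    [alpha_i], [beta_i] do not vanish because [mu <> 0] and [b], [b + n] are not integers;
    [d0], [d1] are read off the two exceptional coefficients.  A suitable rescaling
    [a_j = w_j x_j], with [w_j] decaying like [1/j!], transforms it into
    [x_j = (1 + u_j) x_(j+1) + v_j x_(j+2)] with [u_j], [v_j] of order [1/j^2], which has a
    unique solution tending to [1], obtained by backward recursion.  This gives an entire
    solution.  Conversely a solution is analytic at [0] by Cauchy's formula, so that its
    coefficients grow at most geometrically, and the Casoratian with the entire solution
    must vanish.  Holomorphy in the parameters follows by running the same estimates in
    a Banach algebra of functions with Lipschitz complex differential. *)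

Require Import Defs.
From Stdlib Require Import Reals ZArith Lra Lia FunctionalExtensionality ClassicalEpsilon.
From Coquelicot Require Import Coquelicot.
Open Scope C_scope.

(** * Complex derivatives *)

(** A generic solution of the recurrence grows factorially, its ratio being governed by
    [beta_i a_(i+2) ~ - q_i a_(i+1)], and gives a divergent series. The entire solution is therefore
    singled out by its behaviour at infinity and not by initial data, which forces the backward
    recursion. The ratio of the weights is [alpha_i / (q_i - lambda)]: it imitates the other balance
    [alpha_i a_i ~ q_i a_(i+1)], with [lambda] left out so that the denominators are products of
    factors [i] plus a constant, which the conditions on [b] and [b + n] keep away from 0; [lambda]
    reappears in [u_i]. The limit of the backward recursion is written as a sum of differences, so
    that one absolutely convergent series yields existence, growth bounds and holomorphy. Uniqueness
    is claimed among germs that are merely complex differentiable, with the equation imposed off 0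
    only. The equation itself provides two derivatives off 0, hence a continuous first derivative
    there; this suffices for Cauchy's formula by varying the radius of circle integrals, without a
    Goursat argument. *)

Definition near (z : C) (P : C -> Prop) : Prop :=
  exists d : R, (0 < d)%R /\ forall w, (Cmod (w - z) < d)%R -> P w.

Lemma locally_near (z : C) (P : C -> Prop) :
  locally (T := C_UniformSpace) z P <-> near z P.
Proof.
split.
- intros H. apply locally_C in H. destruct H as [d H].
  exists d; split; [apply cond_pos|]. intros w Hw. apply H. exact Hw.
- intros [d [Hd H]]. apply locally_C. exists (mkposreal d Hd).
  intros w Hw. apply H. exact Hw.
Qed.

Lemma near_and z (P Q : C -> Prop) :
  near z P -> near z Q -> near z (fun w => P w /\ Q w).
Proof.
intros [d [Hd HP]] [e [He HQ]]. exists (Rmin d e). split.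
- now apply Rmin_pos.
- intros w Hw. split; [apply HP|apply HQ]; eapply Rlt_le_trans; eauto;
  [apply Rmin_l|apply Rmin_r].
Qed.

Lemma near_imp z (P Q : C -> Prop) :
  (forall w, P w -> Q w) -> near z P -> near z Q.
Proof. intros H [d [Hd HP]]. exists d; auto. Qed.

Lemma near_at z (P : C -> Prop) : near z P -> P z.
Proof.
intros [d [Hd HP]]. apply HP. replace (z - z) with (RtoC 0) by ring.
now rewrite Cmod_0.
Qed.

Lemma near_near z (P : C -> Prop) : near z P -> near z (fun w => near w P).
Proof.
intros [d [Hd HP]]. exists (d / 2)%R. split; [lra|]. intros w Hw.
exists (d / 2)%R. split; [lra|]. intros v Hv. apply HP.
replace (v - z) with ((v - w) + (w - z)) by ring.
eapply Rle_lt_trans; [apply Cmod_triangle|]. lra.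
Qed.

Lemma near_ball z (r : R) : (0 < r)%R -> near z (fun w => (Cmod (w - z) < r)%R).
Proof. intros H. exists r; auto. Qed.

Definition ccont (f : C -> C) (z : C) : Prop :=
  forall e : R, (0 < e)%R -> near z (fun w => (Cmod (f w - f z) < e)%R).

Lemma ccont_ext_loc f g z : near z (fun w => f w = g w) -> ccont f z -> ccont g z.
Proof.
intros H Hf e He. generalize (near_at _ _ H); intros Hz.
generalize (near_and _ _ _ H (Hf e He)). apply near_imp.
intros w [H1 H2]. now rewrite <- H1, <- Hz.
Qed.

Lemma ccont_const c z : ccont (fun _ => c) z.
Proof.
intros e He. exists 1%R. split; [lra|]. intros.
replace (c - c) with (RtoC 0) by ring. now rewrite Cmod_0.
Qed.

Lemma ccont_id z : ccont (fun w => w) z.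
Proof. intros e He. now apply near_ball. Qed.

Lemma ccont_plus f g z : ccont f z -> ccont g z -> ccont (fun w => f w + g w) z.
Proof.
intros Hf Hg e He.
generalize (near_and _ _ _ (Hf (e/2)%R ltac:(lra)) (Hg (e/2)%R ltac:(lra))).
apply near_imp. intros w [H1 H2].
replace (f w + g w - (f z + g z)) with ((f w - f z) + (g w - g z)) by ring.
eapply Rle_lt_trans; [apply Cmod_triangle|]. lra.
Qed.

Lemma ccont_mult f g z : ccont f z -> ccont g z -> ccont (fun w => f w * g w) z.
Proof.
intros Hf Hg e He.
set (A := (Cmod (f z) + 1)%R). set (B := (Cmod (g z) + 1)%R).
assert (HA : (0 < A)%R) by (generalize (Cmod_ge_0 (f z)); unfold A; lra).
assert (HB : (0 < B)%R) by (generalize (Cmod_ge_0 (g z)); unfold B; lra).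
assert (HeB : (0 < e / 2 / B)%R) by (apply Rdiv_lt_0_compat; lra).
assert (HeA : (0 < e / 2 / A)%R) by (apply Rdiv_lt_0_compat; lra).
generalize (near_and _ _ _ (Hf (e/2/B)%R HeB)
   (near_and _ _ _ (Hf 1%R ltac:(lra)) (Hg (e/2/A)%R HeA))).
apply near_imp. intros w [H1 [H2 H3]].
replace (f w * g w - f z * g z) with ((f w - f z) * g z + f w * (g w - g z)) by ring.
eapply Rle_lt_trans; [apply Cmod_triangle|]. rewrite !Cmod_mult.
assert (H4 : (Cmod (f w) <= A)%R).
{ replace (f w) with ((f w - f z) + f z) by ring.
  eapply Rle_trans; [apply Cmod_triangle|]. unfold A; lra. }
assert (H5 : (Cmod (f w - f z) * Cmod (g z) <= (e/2/B) * B)%R).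
{ apply Rmult_le_compat; try apply Cmod_ge_0; unfold B in *; lra. }
assert (H6 : (Cmod (f w) * Cmod (g w - g z) <= A * Cmod (g w - g z))%R).
{ apply Rmult_le_compat_r; [apply Cmod_ge_0|lra]. }
assert (H7 : (A * Cmod (g w - g z) < A * (e/2/A))%R).
{ now apply Rmult_lt_compat_l. }
replace (e/2/B*B)%R with (e/2)%R in H5 by (field; lra).
replace (A*(e/2/A))%R with (e/2)%R in H7 by (field; lra).
lra.
Qed.

Lemma ccont_opp f z : ccont f z -> ccont (fun w => - f w) z.
Proof.
intros H. apply ccont_ext_loc with (fun w => (-(1)) * f w).
- exists 1%R; split; [lra|]; intros; ring.
- apply ccont_mult; [apply ccont_const|exact H].
Qed.

Lemma ccont_minus f g z : ccont f z -> ccont g z -> ccont (fun w => f w - g w) z.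
Proof. intros Hf Hg. apply ccont_plus; [exact Hf|now apply ccont_opp]. Qed.

Lemma ccont_comp f g z : ccont g z -> ccont f (g z) -> ccont (fun w => f (g w)) z.
Proof.
intros Hg Hf e He. destruct (Hf e He) as [d [Hd H]].
generalize (Hg d Hd). apply near_imp. intros w Hw. now apply H.
Qed.

Lemma ccont_neq0 f z : ccont f z -> f z <> 0 -> near z (fun w => f w <> 0).
Proof.
intros Hf Hz. generalize (Hf _ (proj1 (Cmod_gt_0 _) Hz)). apply near_imp.
intros w Hw E. rewrite E in Hw. replace (0 - f z) with (- f z) in Hw by ring.
rewrite Cmod_opp in Hw. lra.
Qed.

Lemma Cmod_pos_neq (z : C) : (0 < Cmod z)%R -> z <> 0.
Proof. intros H. now apply Cmod_gt_0. Qed.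

Lemma Cmod_minus_sym (a b : C) : Cmod (a - b) = Cmod (b - a).
Proof. rewrite <- Cmod_opp. f_equal. ring. Qed.

Lemma Cmod_rtriangle (a b : C) : (Cmod a - Cmod b <= Cmod (a - b))%R.
Proof.
generalize (Cmod_triangle (a - b) b). replace (a - b + b) with a by ring. lra.
Qed.

Lemma ccont_inv f z : ccont f z -> f z <> 0 -> ccont (fun w => / f w) z.
Proof.
intros Hf Hz.
assert (H : ccont (fun u => / u) (f z)).
{ intros e He. set (m := Cmod (f z)).
  assert (Hm : (0 < m)%R) by (now apply Cmod_gt_0).
  assert (He2 : (0 < e * m * m / 2)%R).
  { repeat apply Rmult_lt_0_compat; lra. }
  generalize (near_and _ _ _ (near_ball (f z) (m/2)%R ltac:(lra))
    (near_ball (f z) _ He2)).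
  apply near_imp. intros u [H1 H2].
  assert (Hu : (m / 2 <= Cmod u)%R).
  { generalize (Cmod_rtriangle (f z) u). rewrite Cmod_minus_sym. fold m. lra. }
  assert (Hu0 : u <> 0) by (apply Cmod_pos_neq; lra).
  replace (/ u - / f z) with (- (u - f z) * / u * / f z) by (field; auto).
  rewrite !Cmod_mult, Cmod_opp, !Cmod_inv by auto. fold m.
  apply Rlt_le_trans with ((e * m * m / 2) * / Cmod u * / m)%R.
  { repeat (apply Rmult_lt_compat_r; [apply Rinv_0_lt_compat; lra|]). exact H2. }
  apply Rle_trans with ((e * m * m / 2) * / (m/2) * / m)%R.
  { apply Rmult_le_compat_r; [left; apply Rinv_0_lt_compat; lra|].
    apply Rmult_le_compat_l; [lra|]. apply Rinv_le_contravar; lra. }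
  right. field. lra. }
exact (ccont_comp (fun u => / u) f z Hf H).
Qed.

Definition der (f : C -> C) (z l : C) : Prop :=
  forall e : R, (0 < e)%R ->
  near z (fun w => (Cmod (f w - f z - l * (w - z)) <= e * Cmod (w - z))%R).

Lemma is_Cderive_der f z l : is_Cderive f z l <-> der f z l.
Proof.
unfold is_Cderive, is_derive, filterdiff, der. split.
- intros [_ H] e He. specialize (H z (fun P HP => HP) (mkposreal e He)).
  destruct H as [d H]. exists d. split; [apply cond_pos|]. intros w Hw.
  rewrite (Cmult_comm l). exact (H w Hw).
- intros H. split.
  + apply (is_linear_scal_l (K := C_AbsRing) (V := C_NormedModule)).
  + intros x Hx eps.
    assert (E : z = x).
    { exact (is_filter_lim_locally_unique (V := AbsRing_NormedModule C_AbsRing) z x Hx). }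
    subst x. destruct (H eps (cond_pos eps)) as [d [Hd H1]].
    exists (mkposreal d Hd). intros w Hw. specialize (H1 w Hw).
    rewrite (Cmult_comm l) in H1. exact H1.
Qed.

Lemma ex_Cderive_der f z : ex_Cderive f z <-> exists l, der f z l.
Proof.
split; intros [l H]; exists l; now apply is_Cderive_der.
Qed.

(** Caratheodory's form of the derivative: the difference quotient, completed by [l] at [z], is
    continuous at [z]. Sum, product and chain rules then reduce to identities between slope
    functions and closure properties of [ccont]. *)
Lemma der_slope f z l : der f z l <->
  exists phi, ccont phi z /\ phi z = l /\ forall w, f w = f z + phi w * (w - z).
Proof.
split.
- intros H. exists (fun w => if Ceq_dec w z then l else (f w - f z) / (w - z)).
  assert (Hz : (if Ceq_dec z z then l else (f z - f z) / (z - z)) = l).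
  { destruct (Ceq_dec z z) as [_|n]; [reflexivity|now elim n]. }
  split; [|split].
  + intros e He. rewrite Hz. generalize (H (e/2)%R ltac:(lra)).
    apply near_imp. intros w Hw. destruct (Ceq_dec w z) as [E|n].
    * replace (l - l) with (RtoC 0) by ring. now rewrite Cmod_0.
    * assert (Hn : w - z <> 0) by now apply Cminus_eq_contra.
      assert (Hp : (0 < Cmod (w - z))%R) by now apply Cmod_gt_0.
      replace ((f w - f z) / (w - z) - l) with ((f w - f z - l * (w - z)) / (w - z))
        by (field; exact Hn).
      rewrite Cmod_div by exact Hn.
      apply Rle_lt_trans with (e / 2 * Cmod (w - z) / Cmod (w - z))%R.
      { apply Rmult_le_compat_r; [left; now apply Rinv_0_lt_compat|exact Hw]. }
      replace (e / 2 * Cmod (w - z) / Cmod (w - z))%R with (e/2)%R by (field; lra). lra.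
  + exact Hz.
  + intros w. destruct (Ceq_dec w z) as [->|n]; [ring|].
    field. now apply Cminus_eq_contra.
- intros [phi [Hc [Hz Hf]]] e He. generalize (Hc e He). apply near_imp.
  intros w Hw. rewrite (Hf w).
  replace (f z + phi w * (w - z) - f z - l * (w - z)) with ((phi w - phi z) * (w - z))
    by (rewrite Hz; ring).
  rewrite Cmod_mult. apply Rmult_le_compat_r; [apply Cmod_ge_0|lra].
Qed.

Lemma der_ccont f z l : der f z l -> ccont f z.
Proof.
intros H. apply der_slope in H. destruct H as [phi [Hc [Hz Hf]]].
apply ccont_ext_loc with (fun w => f z + phi w * (w - z)).
- exists 1%R; split; [lra|]; intros w _. symmetry; apply Hf.
- apply ccont_plus; [apply ccont_const|]. apply ccont_mult; [exact Hc|].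
  apply ccont_minus; [apply ccont_id|apply ccont_const].
Qed.

Lemma der_ext_loc f g z l : near z (fun w => f w = g w) -> der f z l -> der g z l.
Proof.
intros H Hf e He. generalize (near_at _ _ H); intros Hz.
generalize (near_and _ _ _ H (Hf e He)). apply near_imp.
intros w [H1 H2]. now rewrite <- H1, <- Hz.
Qed.

Lemma der_ext f g z l : (forall w, f w = g w) -> der f z l -> der g z l.
Proof. intros H. apply der_ext_loc. exists 1%R. split; [lra|auto]. Qed.

Lemma der_unique f z l m : der f z l -> der f z m -> l = m.
Proof.
intros Hl Hm. apply Ceq_minus, Cmod_eq_0.
destruct (Rle_lt_or_eq_dec 0 _ (Cmod_ge_0 (l - m))) as [Hp|E]; [|now symmetry].
exfalso.
destruct (near_and _ _ _ (Hl (Cmod (l - m) / 4)%R ltac:(lra))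
  (Hm (Cmod (l - m) / 4)%R ltac:(lra))) as [d [Hd H]].
assert (Hw : Cmod (z + RtoC (d/2) - z) = (d/2)%R).
{ replace (z + RtoC (d/2) - z) with (RtoC (d/2)) by ring.
  rewrite Cmod_R, Rabs_right; lra. }
destruct (H (z + RtoC (d/2))) as [H1 H2]; [lra|].
set (w := z + RtoC (d/2)) in *.
assert (H3 : (Cmod ((l - m) * (w - z)) <= Cmod (l - m) / 2 * Cmod (w - z))%R).
{ replace ((l - m) * (w - z)) with
   ((f w - f z - m * (w - z)) + - (f w - f z - l * (w - z))) by ring.
  eapply Rle_trans; [apply Cmod_triangle|]. rewrite Cmod_opp. lra. }
rewrite Cmod_mult in H3. rewrite Hw in H3. nra.
Qed.

Lemma der_const c z : der (fun _ => c) z 0.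
Proof.
apply der_slope. exists (fun _ => 0). repeat split.
- apply ccont_const.
- intros. ring.
Qed.

Lemma der_id z : der (fun w => w) z 1.
Proof.
apply der_slope. exists (fun _ => 1). repeat split.
- apply ccont_const.
- intros. ring.
Qed.

Lemma der_plus f g z l m : der f z l -> der g z m -> der (fun w => f w + g w) z (l + m).
Proof.
intros Hf Hg. apply der_slope in Hf. apply der_slope in Hg. apply der_slope.
destruct Hf as [p [Hp [Ep Hf]]]. destruct Hg as [q [Hq [Eq Hg]]].
exists (fun w => p w + q w). repeat split.
- now apply ccont_plus.
- now rewrite Ep, Eq.
- intros w. rewrite (Hf w), (Hg w). ring.
Qed.

Lemma der_mult f g z l m : der f z l -> der g z m ->
  der (fun w => f w * g w) z (l * g z + f z * m).
Proof.
intros Hf Hg. generalize (der_ccont _ _ _ Hg); intros Cg.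
apply der_slope in Hf. apply der_slope in Hg. apply der_slope.
destruct Hf as [p [Hp [Ep Hf]]]. destruct Hg as [q [Hq [Eq Hg]]].
exists (fun w => p w * g w + f z * q w). repeat split.
- apply ccont_plus; apply ccont_mult; auto. apply ccont_const.
- now rewrite Ep, Eq.
- intros w. rewrite (Hf w), (Hg w). ring.
Qed.

Lemma der_scal c f z l : der f z l -> der (fun w => c * f w) z (c * l).
Proof.
intros H. replace (c * l) with (0 * f z + c * l) by ring.
exact (der_mult (fun _ => c) f z 0 l (der_const c z) H).
Qed.

Lemma der_comp f g z l m : der g z m -> der f (g z) l ->
  der (fun w => f (g w)) z (l * m).
Proof.
intros Hg Hf. generalize (der_ccont _ _ _ Hg); intros Cg.
apply der_slope in Hf. apply der_slope in Hg. apply der_slope.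
destruct Hf as [p [Hp [Ep Hf]]]. destruct Hg as [q [Hq [Eq Hg]]].
exists (fun w => p (g w) * q w). repeat split.
- apply ccont_mult; auto. now apply ccont_comp.
- now rewrite Ep, Eq.
- intros w. rewrite (Hf (g w)), (Hg w). ring.
Qed.

Lemma der_Cinv (z : C) : z <> 0 -> der (fun w => / w) z (- (/ z * / z)).
Proof.
intros Hz. set (phi := fun w => - (/ w * / z)).
assert (Hc : ccont phi z).
{ apply ccont_opp, ccont_mult; [|apply ccont_const].
  apply ccont_inv; [apply ccont_id|exact Hz]. }
intros e He.
generalize (near_and _ _ _ (Hc e He) (ccont_neq0 _ z (ccont_id z) Hz)).
apply near_imp. intros w [Hw Hw0].
replace (/ w - / z - - (/ z * / z) * (w - z)) with ((phi w - phi z) * (w - z))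
  by (unfold phi; field; auto).
rewrite Cmod_mult. apply Rmult_le_compat_r; [apply Cmod_ge_0|lra].
Qed.

Lemma der_inv f z l : der f z l -> f z <> 0 ->
  der (fun w => / f w) z (- (/ f z * / f z) * l).
Proof.
intros Hf Hz. exact (der_comp (fun w => / w) f z _ l Hf (der_Cinv _ Hz)).
Qed.

(** Only the values of both derivatives at [z] are exposed, the derivative function being hidden.
    They are unique, so that [is_L] becomes an algebraic condition on a pair of numbers. *)
Definition der2 (f : C -> C) (z f1 f2 : C) : Prop :=
  exists g : C -> C, near z (fun w => der f w (g w)) /\ g z = f1 /\ der g z f2.

Lemma der2_unique f z a b a' b' : der2 f z a b -> der2 f z a' b' -> a = a' /\ b = b'.
Proof.
intros [g [Hg [Ea Hb]]] [h [Hh [Ea' Hb']]].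
assert (H : near z (fun w => g w = h w)).
{ generalize (near_and _ _ _ Hg Hh). apply near_imp. intros w [H1 H2].
  eapply der_unique; eauto. }
split.
- rewrite <- Ea, <- Ea'. exact (near_at _ _ H).
- eapply der_unique; [|exact Hb']. now apply der_ext_loc with g.
Qed.

Lemma der2_ext_loc f h z a b :
  near z (fun w => f w = h w) -> der2 f z a b -> der2 h z a b.
Proof.
intros H [g [Hg [Ea Hb]]]. exists g. split; [|now split].
generalize (near_and _ _ _ (near_near _ _ H) Hg). apply near_imp.
intros w [H1 H2]. now apply der_ext_loc with f.
Qed.

Lemma der2_mult f h z a b c d : der2 f z a b -> der2 h z c d ->
  der2 (fun w => f w * h w) z (a * h z + f z * c) (b * h z + 2 * (a * c) + f z * d).
Proof.
intros [g [Hg [Ea Hb]]] [k [Hk [Ec Hd]]].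
exists (fun w => g w * h w + f w * k w). split; [|split].
- generalize (near_and _ _ _ Hg Hk). apply near_imp. intros w [H1 H2].
  now apply der_mult.
- now rewrite Ea, Ec.
- generalize (near_at _ _ Hg) (near_at _ _ Hk). cbv beta. intros Hf Hh.
  replace (b * h z + 2 * (a * c) + f z * d) with
    ((b * h z + g z * k z) + (g z * k z + f z * d)) by (rewrite Ea, Ec; ring).
  apply der_plus; now apply der_mult.
Qed.

Lemma der2_inv_arg f (x a b : C) : x <> 0 -> der2 f (/ x) a b ->
  der2 (fun w => f (/ w)) x (- a * / x ^ 2) (b * / x ^ 4 + 2 * a * / x ^ 3).
Proof.
intros Hx [g [Hg [Ea Hb]]].
exists (fun w => g (/ w) * - (/ w * / w)). split; [|split].
- destruct Hg as [d [Hd Hg]].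
  generalize (near_and _ _ _ (ccont_neq0 _ x (ccont_id x) Hx)
    (ccont_inv _ x (ccont_id x) Hx d Hd)).
  apply near_imp. intros w [H1 H2]. apply der_comp.
  + now apply der_Cinv.
  + now apply Hg.
- rewrite Ea. field. auto.
- generalize (der_Cinv x Hx); intros Hi.
  generalize (der_mult _ _ _ _ _ (der_comp _ _ _ _ _ Hi Hb)
    (der_scal (-(1)) _ _ _ (der_mult _ _ _ _ _ Hi Hi))).
  intros H. eapply der_ext in H;
    [|intros w; replace (- (1) * (/ w * / w)) with (- (/ w * / w)) by ring; reflexivity].
  match type of H with der _ _ ?v => replace (b * / x ^ 4 + 2 * a * / x ^ 3) with v end;
    [exact H|].
  rewrite <- Ea. field. auto.
Qed.

(** * Exponential, logarithm and the conjugated operator *)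

Lemma C_ext (a b : C) : Re a = Re b -> Im a = Im b -> a = b.
Proof. destruct a, b; simpl; intros; subst; reflexivity. Qed.

Lemma im_le_Cmod (c : C) : (Rabs (Im c) <= Cmod c)%R.
Proof. eapply Rle_trans; [apply Rmax_r|apply (Rmax_Cmod c)]. Qed.

Lemma Cmod_le_re_im (c : C) : (Cmod c <= Rabs (Re c) + Rabs (Im c))%R.
Proof.
replace c with (RtoC (Re c) + Ci * RtoC (Im c)) at 1.
- eapply Rle_trans; [apply Cmod_triangle|].
  rewrite Cmod_mult, Cmod_Ci, !Cmod_R. lra.
- apply C_ext; destruct c; simpl; ring.
Qed.

Lemma Cexp_plus a b : Cexp (a + b) = Cexp a * Cexp b.
Proof.
unfold Cexp. destruct a as [x y], b as [u v]. simpl.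
rewrite exp_plus, cos_plus, sin_plus. unfold Cmult; simpl. f_equal; ring.
Qed.

Lemma Cexp_0 : Cexp 0 = 1.
Proof. unfold Cexp; simpl. rewrite exp_0, cos_0, sin_0. apply C_ext; simpl; ring. Qed.

Lemma Cexp_opp_l a : Cexp (- a) * Cexp a = 1.
Proof. rewrite <- Cexp_plus. replace (- a + a) with (RtoC 0) by ring. exact Cexp_0. Qed.

Lemma Cexp_neq_0 a : Cexp a <> 0.
Proof.
intros H. generalize (Cexp_opp_l a). rewrite H, Cmult_0_r.
intros E. apply C1_nz. now symmetry.
Qed.

Lemma slope_0 (f : R -> R) (l : R) : derivable_pt_lim f 0 l ->
  forall e, (0 < e)%R -> exists d, (0 < d)%R /\
  forall x, (Rabs x < d)%R -> (Rabs (f x - f 0 - l * x) <= e * Rabs x)%R.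
Proof.
intros H e He. destruct (H e He) as [d Hd]. exists d. split; [apply cond_pos|].
intros x Hx. destruct (Req_dec x 0) as [->|n].
- rewrite Rmult_0_r, Rabs_R0. replace (f 0 - f 0 - 0)%R with 0%R by ring.
  rewrite Rabs_R0. lra.
- specialize (Hd x n Hx). rewrite Rplus_0_l in Hd.
  replace (f x - f 0 - l * x)%R with (((f x - f 0) / x - l) * x)%R by (field; exact n).
  rewrite Rabs_mult. apply Rmult_le_compat_r; [apply Rabs_pos|lra].
Qed.

Lemma der_Cexp_0 : der Cexp 0 1.
Proof.
(* Real and imaginary parts of the remainder will each be at most [4 * q] times the modulus of the
   increment, whence [e / 8]; [q <= 1] keeps [exp x] below 3. *)
intros e He. set (q := Rmin (e / 8) 1).
assert (Hq : (0 < q)%R) by (apply Rmin_pos; lra).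
assert (Hq1 : (q <= e / 8)%R) by apply Rmin_l.
assert (Hq2 : (q <= 1)%R) by apply Rmin_r.
assert (D0 : derivable_pt_lim cos 0 0).
{ generalize (derivable_pt_lim_cos 0). now rewrite sin_0, Ropp_0. }
assert (D1 : derivable_pt_lim sin 0 1).
{ generalize (derivable_pt_lim_sin 0). now rewrite cos_0. }
assert (D2 : derivable_pt_lim exp 0 1).
{ generalize (derivable_pt_lim_exp 0). now rewrite exp_0. }
destruct (slope_0 _ _ D0 q Hq) as [d0 [Hd0 H0]].
destruct (slope_0 _ _ D1 q Hq) as [d1 [Hd1 H1]].
destruct (slope_0 _ _ D2 q Hq) as [d2 [Hd2 H2]].
exists (Rmin (Rmin d0 d1) (Rmin d2 (q / 2))). split.
{ repeat apply Rmin_pos; lra. }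
intros h Hh. replace (h - 0) with h in * by ring.
assert (Hh0 : (Cmod h < d0)%R).
{ eapply Rlt_le_trans; [exact Hh|]. eapply Rle_trans; [apply Rmin_l|apply Rmin_l]. }
assert (Hh1 : (Cmod h < d1)%R).
{ eapply Rlt_le_trans; [exact Hh|]. eapply Rle_trans; [apply Rmin_l|apply Rmin_r]. }
assert (Hh2 : (Cmod h < d2)%R).
{ eapply Rlt_le_trans; [exact Hh|]. eapply Rle_trans; [apply Rmin_r|apply Rmin_l]. }
assert (Hh3 : (Cmod h < q/2)%R).
{ eapply Rlt_le_trans; [exact Hh|]. eapply Rle_trans; [apply Rmin_r|apply Rmin_r]. }
generalize (re_le_Cmod h) (im_le_Cmod h). intros Hr Hi.
rewrite Cexp_0. destruct h as [x y]. simpl Re in *; simpl Im in *.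
set (m := Cmod (x, y)) in *.
specialize (H0 y ltac:(lra)). specialize (H1 y ltac:(lra)). specialize (H2 x ltac:(lra)).
rewrite cos_0 in H0. rewrite sin_0 in H1. rewrite exp_0 in H2.
rewrite Rmult_0_l, Rminus_0_r in H0. rewrite Rminus_0_r, Rmult_1_l in H1.
rewrite Rmult_1_l in H2.
assert (Hx : (Rabs (exp x - 1) <= q)%R).
{ replace (exp x - 1)%R with ((exp x - 1 - x) + x)%R by ring.
  eapply Rle_trans; [apply Rabs_triang|]. nra. }
assert (Hx3 : (Rabs (exp x) <= 3)%R).
{ replace (exp x) with ((exp x - 1) + 1)%R by ring.
  eapply Rle_trans; [apply Rabs_triang|]. rewrite Rabs_R1. lra. }
eapply Rle_trans; [apply Cmod_le_re_im|]. simpl.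
assert (E1 : (Rabs (exp x * cos y + - (1) + - (1 * x - 0 * y)) <= 4 * q * m)%R).
{ replace (exp x * cos y + - (1) + - (1 * x - 0 * y))%R with
    ((exp x - 1 - x) + exp x * (cos y - 1))%R by ring.
  eapply Rle_trans; [apply Rabs_triang|]. rewrite Rabs_mult.
  assert (Rabs (exp x) * Rabs (cos y - 1) <= 3 * (q * Rabs y))%R.
  { apply Rmult_le_compat; try apply Rabs_pos; lra. }
  nra. }
assert (E2 : (Rabs (exp x * sin y + - 0 + - (1 * y + 0 * x)) <= 4 * q * m)%R).
{ replace (exp x * sin y + - 0 + - (1 * y + 0 * x))%R with
    (exp x * (sin y - y) + (exp x - 1) * y)%R by ring.
  eapply Rle_trans; [apply Rabs_triang|]. rewrite !Rabs_mult.
  assert (Rabs (exp x) * Rabs (sin y - y) <= 3 * (q * Rabs y))%R.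
  { apply Rmult_le_compat; try apply Rabs_pos; lra. }
  assert (Rabs (exp x - 1) * Rabs y <= q * Rabs y)%R.
  { apply Rmult_le_compat_r; try apply Rabs_pos; lra. }
  nra. }
assert (0 <= m)%R by apply Cmod_ge_0.
nra.
Qed.

Lemma der_Cexp z : der Cexp z (Cexp z).
Proof.
apply der_ext with (fun w => Cexp z * Cexp (w + - z)).
- intros w. rewrite <- Cexp_plus. f_equal. ring.
- assert (E : Cexp z = Cexp z * (1 * (1 + 0))) by ring.
  cut (der (fun w => Cexp z * Cexp (w + - z)) z (Cexp z * (1 * (1 + 0))));
    [now rewrite <- E|].
  apply der_scal. apply (der_comp Cexp (fun w => w + - z)).
  + apply der_plus; [apply der_id|apply der_const].
  + replace (z + - z) with (RtoC 0) by ring. exact der_Cexp_0.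
Qed.

(** * Branches of the logarithm *)

Lemma der_right_inverse (E E' ell : C -> C) (w : C) :
  der E (ell w) (E' w) -> E' w <> 0 -> ccont ell w ->
  near w (fun v => E (ell v) = v) -> der ell w (/ E' w).
Proof.
intros H H0 Hc Hn. apply der_slope in H. destruct H as [p [Hp [Ep Hf]]].
assert (Hq : ccont (fun v => / p (ell v)) w).
{ apply ccont_inv; [now apply ccont_comp|]. now rewrite Ep. }
assert (Hz : near w (fun v => p (ell v) <> 0)).
{ apply (ccont_neq0 (fun v => p (ell v))); [now apply ccont_comp|]. now rewrite Ep. }
generalize (near_at _ _ Hn). intros Ew. cbv beta in Ew.
intros e He. generalize (near_and _ _ _ Hz (near_and _ _ _ Hn (Hq e He))).
apply near_imp. intros v [H1 [H2 H3]].
(* The slope identity of [E] read along [ell]: [v = w + p (ell v) * (ell v - ell w)]. Continuity of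
   [ell] keeps [p (ell v)] away from 0, so it can be solved for the increment of [ell]. *)
generalize (Hf (ell v)). rewrite H2, Ew. intros H4.
rewrite Ep in H3.
assert (H5 : ell v - ell w = / p (ell v) * (v - w)).
{ apply (f_equal (fun t => t - w)) in H4.
  transitivity (/ p (ell v) * (w + p (ell v) * (ell v - ell w) - w)); [field; exact H1|].
  f_equal. now symmetry. }
rewrite H5.
replace (/ p (ell v) * (v - w) - / E' w * (v - w)) with
  ((/ p (ell v) - / E' w) * (v - w)) by ring.
rewrite Cmod_mult. apply Rmult_le_compat_r; [apply Cmod_ge_0|lra].
Qed.

Lemma ccont_Re z : ccont (fun w => RtoC (Re w)) z.
Proof.
intros e He. exists e. split; [exact He|]. intros w Hw.
rewrite <- RtoC_minus, Cmod_R. eapply Rle_lt_trans; [|exact Hw].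
replace (Re w - Re z)%R with (Re (w - z)) by (unfold Cminus; rewrite re_plus, re_opp; ring).
apply re_le_Cmod.
Qed.

Lemma ccont_Im z : ccont (fun w => RtoC (Im w)) z.
Proof.
intros e He. exists e. split; [exact He|]. intros w Hw.
rewrite <- RtoC_minus, Cmod_R. eapply Rle_lt_trans; [|exact Hw].
replace (Im w - Im z)%R with (Im (w - z)) by (unfold Cminus; rewrite im_plus, im_opp; ring).
apply im_le_Cmod.
Qed.

Lemma ccont_Cmod z : ccont (fun w => RtoC (Cmod w)) z.
Proof.
intros e He. exists e. split; [exact He|]. intros w Hw.
rewrite <- RtoC_minus, Cmod_R. eapply Rle_lt_trans; [|exact Hw].
apply Rabs_le. generalize (Cmod_rtriangle w z) (Cmod_rtriangle z w).
rewrite (Cmod_minus_sym z w). lra.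
Qed.

Lemma ccont_real_comp (g : R -> R) (f : C -> R) (z : C) :
  continuity_pt g (f z) -> ccont (fun w => RtoC (f w)) z ->
  ccont (fun w => RtoC (g (f w))) z.
Proof.
intros Hg Hf e He. destruct (Hg e He) as [d [Hd H]].
generalize (Hf d Hd). apply near_imp. intros w Hw.
rewrite <- RtoC_minus, Cmod_R in *.
destruct (Req_dec (f z) (f w)) as [E|n].
- rewrite E. replace (g (f w) - g (f w))%R with 0%R by ring. rewrite Rabs_R0. exact He.
- apply H. repeat split; [exact n|exact Hw].
Qed.

(** The principal logarithm, correct as written on the right half-plane, where [atan] of the slope
    is the argument. *)
Definition Clog (u : C) : C := (ln (Cmod u), atan (Im u / Re u)).

Lemma Cexp_Clog (u : C) : (0 < Re u)%R -> Cexp (Clog u) = u.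
Proof.
intros H. unfold Cexp, Clog. simpl.
assert (Hu : (0 < Cmod u)%R).
{ apply Cmod_gt_0. intros E. rewrite E in H. simpl in H. lra. }
rewrite exp_ln by exact Hu.
rewrite cos_atan, sin_atan.
assert (E : Cmod u = (Re u * sqrt (1 + (Im u / Re u)²))%R).
{ rewrite <- (sqrt_Rsqr (Re u)) at 1 by lra. rewrite <- sqrt_mult_alt by apply Rle_0_sqr.
  unfold Cmod. f_equal. unfold Rsqr, Re, Im. field. unfold Re in H. lra. }
assert (Hs : (0 < sqrt (1 + (Im u / Re u)²))%R).
{ apply sqrt_lt_R0. generalize (Rle_0_sqr (Im u / Re u)). lra. }
apply C_ext; simpl; rewrite E; field; lra.
Qed.

Lemma ccont_Clog (u : C) : (0 < Re u)%R -> ccont Clog u.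
Proof.
intros H.
assert (Hu : (0 < Cmod u)%R).
{ apply Cmod_gt_0. intros E. rewrite E in H. simpl in H. lra. }
apply ccont_ext_loc with
  (fun w => RtoC (ln (Cmod w)) + Ci * RtoC (atan (Im w / Re w))).
- exists 1%R. split; [lra|]. intros. unfold Clog. apply C_ext; simpl; ring.
- apply ccont_plus; [|apply ccont_mult; [apply ccont_const|]].
  + apply (ccont_real_comp ln Cmod); [|apply ccont_Cmod].
    apply derivable_continuous_pt. exists (/ Cmod u)%R. now apply derivable_pt_lim_ln.
  + apply (ccont_real_comp atan (fun w => Im w / Re w)%R).
    * apply derivable_continuous_pt, derivable_pt_atan.
    * apply ccont_ext_loc with (fun w => RtoC (Im w) * / RtoC (Re w)).
      { generalize (ccont_neq0 _ u (ccont_Re u)). intros HH.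
        refine (near_imp _ _ _ _ (HH _)).
        - intros w Hw. rewrite RtoC_div; [reflexivity|]. intros E. apply Hw. now rewrite E.
        - intros E. apply RtoC_inj in E. lra. }
      apply ccont_mult; [apply ccont_Im|]. apply ccont_inv; [apply ccont_Re|].
      intros E. apply RtoC_inj in E. lra.
Qed.

(** One of the factors [-1], [i], [-i], [1] rotates [z] into the open right half-plane, where [Clog]
    applies; each factor is [Cexp c] for an explicit [c]. *)
Lemma Cexp_surj (z : C) : z <> 0 -> exists l, Cexp l = z.
Proof.
assert (A : forall u c, (0 < Re (u * Cexp c))%R -> exists l, Cexp l = u).
{ intros u c H. exists (Clog (u * Cexp c) + - c).
  rewrite Cexp_plus, Cexp_Clog by exact H.
  generalize (Cexp_opp_l c). intros E. rewrite <- Cmult_assoc, (Cmult_comm (Cexp c)), E. ring. }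
intros Hz. destruct (Rtotal_order (Re z) 0) as [H|[H|H]].
- apply (A z (0, PI)). unfold Cexp. simpl. rewrite exp_0, cos_PI, sin_PI. simpl.
  unfold Re in H. lra.
- assert (Hi : Im z <> 0%R).
  { intros E. apply Hz. now apply C_ext. }
  destruct (Rtotal_order (Im z) 0) as [H'|[H'|H']].
  + apply (A z (0, PI/2)%R). unfold Cexp. simpl.
    rewrite exp_0, cos_PI2, sin_PI2. simpl. unfold Im in H'. lra.
  + now elim Hi.
  + apply (A z (0, -(PI/2))%R). unfold Cexp. simpl.
    rewrite exp_0, cos_neg, sin_neg, cos_PI2, sin_PI2. simpl. unfold Im in H'. lra.
- apply (A z 0). rewrite Cexp_0, Cmult_1_r. exact H.
Qed.

Lemma log_branch_iff z0 ell : log_branch z0 ell <->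
  near z0 (fun w => (exists l, der ell w l) /\ Cexp (ell w) = w).
Proof.
unfold log_branch. rewrite locally_near. split; apply near_imp; intros w [H1 H2];
  (split; [now apply ex_Cderive_der|exact H2]).
Qed.

(** [is_conj_L] quantifies over all branches at the point, so nothing can be drawn from it without
    exhibiting one. Near [z0] the quotient [w / z0] is close to 1 and stays in the half-plane where
    [Clog] inverts [Cexp]. *)
Lemma log_branch_exists (z0 : C) : z0 <> 0 -> exists ell, log_branch z0 ell.
Proof.
intros Hz. destruct (Cexp_surj z0 Hz) as [l0 Hl0].
exists (fun w => l0 + Clog (w * / z0)). apply log_branch_iff.
assert (Hc : ccont (fun w => RtoC (Re (w * / z0))) z0).
{ apply (ccont_comp (fun v => RtoC (Re v)) (fun w => w * / z0)); [|apply ccont_Re].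
  apply ccont_mult; [apply ccont_id|apply ccont_const]. }
assert (H : near z0 (fun w => (0 < Re (w * / z0))%R)).
{ generalize (Hc 1%R ltac:(lra)). apply near_imp. intros w Hw.
  rewrite <- RtoC_minus, Cmod_R, Cinv_r in Hw by exact Hz. simpl in *.
  apply Rabs_def2 in Hw. lra. }
assert (HE : near z0 (fun w => Cexp (l0 + Clog (w * / z0)) = w)).
{ revert H. apply near_imp. intros w Hw. rewrite Cexp_plus, Cexp_Clog, Hl0 by exact Hw.
  field. exact Hz. }
generalize (near_and _ _ _ (ccont_neq0 _ _ (ccont_id z0) Hz)
  (near_and _ _ _ H (near_and _ _ _ HE (near_near _ _ HE)))).
apply near_imp. intros w [H0 [H1 [H2 H3]]]. split; [|exact H2].
exists (/ w). refine (der_right_inverse Cexp (fun v => v) _ w _ H0 _ H3).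
- rewrite <- H2 at 2. apply der_Cexp.
- apply ccont_plus; [apply ccont_const|].
  apply (ccont_comp Clog (fun w => w * / z0)); [|now apply ccont_Clog].
  apply ccont_mult; [apply ccont_id|apply ccont_const].
Qed.

Lemma log_branch_neq_0 z0 ell : log_branch z0 ell -> z0 <> 0.
Proof.
intros H. apply log_branch_iff in H. apply near_at in H. destruct H as [_ <-].
apply Cexp_neq_0.
Qed.

(** Inverting [Cexp] gives every branch the same derivative; this is what makes the conjugated
    operator independent of the branch. *)
Lemma der_log_branch z0 ell : log_branch z0 ell -> near z0 (fun w => der ell w (/ w)).
Proof.
intros H. apply log_branch_iff in H.
generalize (near_and _ _ _ H (near_near _ _ H)). apply near_imp.
intros w [[[l Hl] Hw] Hn].
assert (Hw0 : w <> 0) by (rewrite <- Hw; apply Cexp_neq_0).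
refine (der_right_inverse Cexp (fun v => v) _ w _ Hw0 (der_ccont _ _ _ Hl) _).
- rewrite <- Hw at 2. apply der_Cexp.
- revert Hn. apply near_imp. now intros v [_ ?].
Qed.

Lemma der2_Cexp_branch (b z0 : C) ell : log_branch z0 ell ->
  der2 (fun w => Cexp (b * ell w)) z0 (Cexp (b * ell z0) * (b * / z0))
   (Cexp (b * ell z0) * (b * (b - 1) * / z0 ^ 2)).
Proof.
intros H. generalize (der_log_branch _ _ H) (log_branch_neq_0 _ _ H). intros Hd Hz.
assert (H1 : near z0 (fun w => der (fun w => Cexp (b * ell w)) w
   (Cexp (b * ell w) * (b * / w)))).
{ revert Hd. apply near_imp. intros w Hw.
  apply (der_comp Cexp (fun w => b * ell w)); [now apply der_scal|apply der_Cexp]. }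
exists (fun w => Cexp (b * ell w) * (b * / w)). split; [exact H1|split; [reflexivity|]].
generalize (der_mult _ _ _ _ _ (near_at _ _ H1) (der_scal b _ _ _ (der_Cinv _ Hz))).
cbv beta. intros HH.
match type of HH with der _ _ ?v =>
  replace (Cexp (b * ell z0) * (b * (b - 1) * / z0 ^ 2)) with v; [exact HH|] end.
field. exact Hz.
Qed.

(** * The conjugated operator near 0 and near infinity *)

Lemma is_L_iff lambda mu n E z v : is_L lambda mu n E z v <->
  exists e1 e2, der2 E z e1 e2 /\
    v = z ^ 2 * e2 + (n * z + mu * (1 - z ^ 2)) * e1 + (lambda - mu * n * z) * E z.
Proof.
unfold is_L. split.
- intros [E' [E'' [H1 [H2 ->]]]]. exists (E' z), E''. split; [|reflexivity].
  exists E'. split; [|split; [reflexivity|now apply is_Cderive_der]].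
  apply locally_near in H1. revert H1. apply near_imp. intros w. apply is_Cderive_der.
- intros [e1 [e2 [[E' [H1 [H2 H3]]] ->]]]. exists E', e2. split; [|split].
  + apply locally_near. revert H1. apply near_imp. intros w. apply is_Cderive_der.
  + now apply is_Cderive_der.
  + now rewrite H2.
Qed.

(** The hypothesis provides two derivatives of [z^b g] only; multiplying by a branch of [z^(-b)]
    passes them to [g]. The second derivative of a solution, nowhere assumed directly, comes from
    here. *)
Lemma is_conj_L_der2 p g (z v : C) : z <> 0 -> is_conj_L p g z v ->
  exists g1 g2, der2 g z g1 g2.
Proof.
destruct p as [[[n lambda] mu] b]. intros Hz H.
destruct (log_branch_exists z Hz) as [ell Hl].
destruct (H ell Hl) as [u [Hu _]]. apply is_L_iff in Hu.
destruct Hu as [e1 [e2 [Hd _]]].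
generalize (der2_mult _ _ _ _ _ _ _ (der2_Cexp_branch (- b) z ell Hl) Hd). intros HH.
eexists. eexists. eapply der2_ext_loc; [|exact HH].
exists 1%R. split; [lra|]. intros w _. cbv beta.
rewrite Cmult_assoc. replace (- b * ell w) with (- (b * ell w)) by ring.
rewrite Cexp_opp_l. ring.
Qed.

Lemma is_conj_L_iff n lambda mu b g (z v g1 g2 : C) : z <> 0 -> der2 g z g1 g2 ->
  (is_conj_L (n, lambda, mu, b) g z v <->
   v = z ^ 2 * g2 + (2 * b * z + n * z + mu * (1 - z ^ 2)) * g1
       + (b * (b - 1) + n * b + mu * b * (/ z - z) + lambda - mu * n * z) * g z).
Proof.
intros Hz Hg.
assert (A : forall ell, log_branch z ell -> forall u,
  is_L lambda mu n (fun w => Cexp (b * ell w) * g w) z u <->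
  u = Cexp (b * ell z) * (z ^ 2 * g2 + (2 * b * z + n * z + mu * (1 - z ^ 2)) * g1
       + (b * (b - 1) + n * b + mu * b * (/ z - z) + lambda - mu * n * z) * g z)).
{ intros ell Hl u.
  generalize (der2_mult _ _ _ _ _ _ _ (der2_Cexp_branch b z ell Hl) Hg). intros HH.
  rewrite is_L_iff. split.
  - intros [e1 [e2 [He ->]]]. destruct (der2_unique _ _ _ _ _ _ He HH) as [-> ->].
    field. exact Hz.
  - intros ->. eexists. eexists. split; [exact HH|]. field. exact Hz. }
split.
- intros H. destruct (log_branch_exists z Hz) as [ell Hl].
  destruct (H ell Hl) as [u [Hu <-]]. apply (A ell Hl) in Hu. rewrite Hu.
  rewrite Cmult_assoc, Cexp_opp_l. ring.
- intros -> ell Hl. eexists. split; [now apply (A ell Hl)|].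
  rewrite Cmult_assoc, Cexp_opp_l. ring.
Qed.

(** In the variable [x = z^(+-1)] the conjugated operator reads [x^2 f'' + (A x + mu (1 - x^2)) f' +
    (B + mu C / x - mu D x) f] for both signs. The inversion [z -> 1/z] keeps this shape and
    replaces [(C, D) = (b, b + n)] by [(-(b + n), -b)], so that one treatment serves both
    functions. *)
Definition pA (s : pm_sign) (p : params) : C :=
  let '(n, lambda, mu, b) := p in
  match s with Plus => 2 * b + n | Minus => 2 - 2 * b - n end.
Definition pB (p : params) : C :=
  let '(n, lambda, mu, b) := p in b * (b - 1 + n) + lambda.
Definition pC (s : pm_sign) (p : params) : C :=
  let '(n, lambda, mu, b) := p in match s with Plus => b | Minus => - (b + n) end.
Definition pD (s : pm_sign) (p : params) : C :=
  let '(n, lambda, mu, b) := p in match s with Plus => b + n | Minus => - b end.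
Definition pmu (p : params) : C := let '(n, lambda, mu, b) := p in mu.

Lemma pow_pm_neq_0 s (x : C) : x <> 0 -> pow_pm s x <> 0.
Proof.
destruct s; simpl; auto. intros Hx E.
apply C1_nz. rewrite <- (Cinv_r x Hx), E. ring.
Qed.

Lemma pow_pm_invol s (x : C) : x <> 0 -> pow_pm s (pow_pm s x) = x.
Proof. destruct s; simpl; auto. intros Hx. field. auto. Qed.

Lemma der2_pow_pm s f (x a b : C) : x <> 0 -> der2 f (pow_pm s x) a b ->
  exists c d, der2 (fun w => f (pow_pm s w)) x c d.
Proof.
intros Hx H. destruct s; simpl in *.
- now exists a, b.
- eexists. eexists. apply der2_inv_arg; eassumption.
Qed.

Lemma is_conj_L_pow_pm s p f (x v f1 f2 : C) : x <> 0 -> der2 f x f1 f2 ->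
  (is_conj_L p (fun w => f (pow_pm s w)) (pow_pm s x) v <->
   v = x ^ 2 * f2 + (pA s p * x + pmu p * (1 - x ^ 2)) * f1
       + (pB p + pmu p * pC s p * / x - pmu p * pD s p * x) * f x).
Proof.
intros Hx H. destruct p as [[[n lambda] mu] b]. destruct s; cbn [pow_pm pA pB pC pD pmu].
- rewrite (is_conj_L_iff _ _ _ _ _ _ _ f1 f2 Hx H).
  match goal with |- (_ = ?a) <-> (_ = ?c) => replace a with c; [tauto|] end.
  field. exact Hx.
- assert (Hi : / x <> 0) by (apply (pow_pm_neq_0 Minus); exact Hx).
  assert (Hii : / / x = x) by (apply (pow_pm_invol Minus); exact Hx).
  assert (H' : der2 f (/ / x) f1 f2) by (rewrite Hii; exact H).
  generalize (der2_inv_arg f (/ x) f1 f2 Hi H'). intros HH.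
  rewrite (is_conj_L_iff _ _ _ _ _ _ _ _ _ Hi HH). rewrite !Hii.
  match goal with |- (_ = ?a) <-> (_ = ?c) => replace a with c; [tauto|] end.
  field. exact Hx.
Qed.

(** * Series and a Banach algebra of differentiable functions *)

Definition Cconv (a : nat -> C) (l : C) : Prop :=
  is_series (K := C_AbsRing) (V := C_NormedModule) a l.

Definition CSeries (a : nat -> C) : C :=
  (Series (fun n => Re (a n)), Series (fun n => Im (a n))).

Lemma Cconv_re a l : Cconv a l -> is_series (fun n => Re (a n)) (Re l).
Proof.
intros H.
apply (filterlim_ext (fun n => Re (sum_n (G := C_NormedModule) a n))).
- induction x as [|n IH].
  + now rewrite !sum_O.
  + rewrite !sum_Sn, <- IH. reflexivity.
- eapply filterlim_comp; [exact H|].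
  intros P [e He]. apply locally_near. exists e. split; [apply cond_pos|].
  intros w Hw. apply He. eapply Rle_lt_trans; [|exact Hw].
  apply (re_le_Cmod (w - l)).
Qed.

Lemma Cconv_im a l : Cconv a l -> is_series (fun n => Im (a n)) (Im l).
Proof.
intros H.
apply (filterlim_ext (fun n => Im (sum_n (G := C_NormedModule) a n))).
- induction x as [|n IH].
  + now rewrite !sum_O.
  + rewrite !sum_Sn, <- IH. reflexivity.
- eapply filterlim_comp; [exact H|].
  intros P [e He]. apply locally_near. exists e. split; [apply cond_pos|].
  intros w Hw. apply He. eapply Rle_lt_trans; [|exact Hw].
  apply (im_le_Cmod (w - l)).
Qed.

Lemma CSeries_unique a l : Cconv a l -> CSeries a = l.
Proof.
intros H. apply C_ext; simpl; apply is_series_unique; [now apply Cconv_re|now apply Cconv_im].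
Qed.

Lemma Cconv_unique a l m : Cconv a l -> Cconv a m -> l = m.
Proof. intros H1 H2. now rewrite <- (CSeries_unique _ _ H1), <- (CSeries_unique _ _ H2). Qed.

Lemma Cconv_CSeries (a : nat -> C) (b : nat -> R) :
  (forall n, (Cmod (a n) <= b n)%R) -> ex_series b -> Cconv a (CSeries a).
Proof.
intros H Hb.
destruct (ex_series_le (V := C_CompleteNormedModule) a b H Hb) as [l Hl].
rewrite (CSeries_unique a l Hl). exact Hl.
Qed.

Lemma Cconv_bound (a : nat -> C) (b : nat -> R) l :
  Cconv a l -> (forall n, (Cmod (a n) <= b n)%R) -> ex_series b -> (Cmod l <= Series b)%R.
Proof.
intros Hl H Hb.
assert (H1 : is_lim_seq (fun n => Cmod (sum_n (G := C_NormedModule) a n)) (Cmod l)).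
{ eapply filterlim_comp; [exact Hl|].
  exact (filterlim_norm (V := C_NormedModule) l). }
assert (H2 : is_lim_seq (sum_n b) (Series b)).
{ apply (Series_correct b Hb). }
refine (is_lim_seq_le _ _ (Cmod l) (Series b) _ H1 H2).
intros n. eapply Rle_trans.
- exact (norm_sum_n_m (V := C_NormedModule) a 0 n).
- apply (sum_n_m_le _ b). exact H.
Qed.

Lemma Cconv_ext a b l : (forall n, a n = b n) -> Cconv a l -> Cconv b l.
Proof. intros H. now apply is_series_ext. Qed.

Lemma Cconv_plus a b l m : Cconv a l -> Cconv b m -> Cconv (fun n => a n + b n) (l + m).
Proof. exact (is_series_plus (V := C_NormedModule) a b l m). Qed.

Lemma Cconv_scal c a l : Cconv a l -> Cconv (fun n => c * a n) (c * l).
Proof. exact (is_series_scal (V := C_NormedModule) c a l). Qed.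

Lemma Cconv_minus a b l m : Cconv a l -> Cconv b m -> Cconv (fun n => a n - b n) (l - m).
Proof. exact (is_series_minus (V := C_NormedModule) a b l m). Qed.

Lemma Cconv_decr_1 a l : Cconv (fun n => a (S n)) (l - a 0%nat) -> Cconv a l.
Proof. exact (is_series_decr_1 (V := C_NormedModule) a l). Qed.

Lemma Cconv_incr_1 a l : Cconv a l -> Cconv (fun n => a (S n)) (l - a 0%nat).
Proof.
intros H. apply (is_series_incr_1 (V := C_NormedModule) a).
match goal with |- is_series _ ?v => replace v with l; [exact H|] end.
change (l = l - a 0%nat + a 0%nat). ring.
Qed.

Lemma Cconv_0 : Cconv (fun _ => 0) 0.
Proof.
apply (filterlim_ext (fun _ => RtoC 0)).
- intros n. unfold sum_n. now rewrite (sum_n_m_const_zero (G := C_NormedModule)).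
- apply filterlim_const.
Qed.

(** * Functions with a quadratic bound on the Taylor remainder *)

Section Jets.

Context {V : NormedModule C_AbsRing}.

(** [L] bounds both the differential and the Lipschitz quotient, [K] the second-order remainder. [B]
    is an arbitrary set, in general neither open nor convex, so these are separate requirements and
    not consequences of one another. *)
Definition jet_bounds (B : V -> Prop) (f : V -> C) (D : V -> V -> C) (M L K : R) : Prop :=
  (0 <= M /\ 0 <= L /\ 0 <= K)%R /\
  forall x, B x ->
    is_linear (K := C_AbsRing) (U := V) (V := C_NormedModule) (D x) /\
    (Cmod (f x) <= M)%R /\
    (forall h, (Cmod (D x h) <= L * norm h)%R) /\
    (forall y, B y -> (Cmod (f y - f x) <= L * norm (minus y x))%R /\
       (Cmod (f y - f x - D x (minus y x)) <= K * norm (minus y x) ^ 2)%R).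

(** The weights are those of a polynomial [M + L e + K e^2]: the bounds of a product are the
    coefficients up to degree 2 of the product polynomial, and dropping the non-negative higher ones
    gives submultiplicativity. *)
Definition jet (e : R) (B : V -> Prop) (f : V -> C) (D : V -> V -> C) (A : R) : Prop :=
  exists M L K, jet_bounds B f D M L K /\ (M + e * L + e ^ 2 * K <= A)%R.

(* For fixed [e] and [B] the least such [A] is a submultiplicative norm, complete for
   absolutely convergent series: differentiability passes to limits without
   recourse to Cauchy's formula in several variables. *)
Definition c11 (e : R) (B : V -> Prop) (f : V -> C) (A : R) : Prop :=
  exists D, jet e B f D A.

Lemma jet_le e B f D A A' : (A <= A')%R -> jet e B f D A -> jet e B f D A'.
Proof. intros H [M [L [K [H1 H2]]]]. exists M, L, K. split; [exact H1|lra]. Qed.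

Lemma jet_subset e (B B' : V -> Prop) f D A :
  (forall x, B' x -> B x) -> jet e B f D A -> jet e B' f D A.
Proof.
intros H [M [L [K [[H0 H1] H2]]]]. exists M, L, K. split; [split; [exact H0|]|exact H2].
intros x Hx. destruct (H1 x (H x Hx)) as [Q1 [Q2 [Q3 Q4]]].
split; [exact Q1|split; [exact Q2|split; [exact Q3|]]].
intros y Hy. apply Q4. now apply H.
Qed.

Lemma jet_ext e (B : V -> Prop) f g D E A : (forall x, B x -> f x = g x) ->
  (forall x h, B x -> D x h = E x h) -> jet e B f D A -> jet e B g E A.
Proof.
intros Hf HD [M [L [K [[H0 H1] H2]]]]. exists M, L, K. split; [split; [exact H0|]|exact H2].
intros x Hx. destruct (H1 x Hx) as [Q1 [Q2 [Q3 Q4]]]. split; [|split; [|split]].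
- apply (is_linear_ext (D x)); auto.
- rewrite <- Hf; auto.
- intros h. rewrite <- HD; auto.
- intros y Hy. rewrite <- HD, <- !Hf; auto.
Qed.

Lemma jet_sup e B f D A x : (0 <= e)%R -> jet e B f D A -> B x -> (Cmod (f x) <= A)%R.
Proof.
intros He [M [L [K [[H0 H1] H2]]]] Hx. destruct (H1 x Hx) as [_ [Q _]].
assert (0 <= e * L)%R by (apply Rmult_le_pos; lra).
assert (0 <= e ^ 2 * K)%R by (apply Rmult_le_pos; nra). lra.
Qed.

Lemma jet_const e B (c : C) A : (Cmod c <= A)%R -> jet e B (fun _ => c) (fun _ _ => 0) A.
Proof.
intros H. exists (Cmod c), 0%R, 0%R. split; [|lra]. split.
{ generalize (Cmod_ge_0 c). lra. }
intros x Hx. split; [|split; [|split]].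
- apply (is_linear_zero (K := C_AbsRing) (V := C_NormedModule)).
- lra.
- intros h. rewrite Cmod_0. lra.
- intros y _. replace (c - c) with (RtoC 0) by ring.
  replace (0 - 0) with (RtoC 0) by ring. rewrite Cmod_0. lra.
Qed.

Lemma jet_linear e B (l : V -> C) : (0 <= e)%R ->
  is_linear (K := C_AbsRing) (U := V) (V := C_NormedModule) l ->
  (exists r, forall x, B x -> (norm x <= r)%R) ->
  exists A, jet e B l (fun _ h => l h) A.
Proof.
intros He Hl [r Hr]. destruct (linear_norm l Hl) as [L [HL H]].
set (M := (L * Rmax 0 r)%R).
assert (HM : (0 <= M)%R) by (apply Rmult_le_pos; [lra|apply Rmax_l]).
exists (M + e * L)%R. exists M, L, 0%R. split; [|lra]. split; [lra|].
intros x Hx. split; [exact Hl|split; [|split]].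
- eapply Rle_trans; [apply (H x)|]. apply Rmult_le_compat_l; [lra|].
  eapply Rle_trans; [apply Hr; exact Hx|apply Rmax_r].
- exact H.
- intros y Hy.
  assert (E : l y - l x = l (minus y x)) by (symmetry; apply (linear_minus l y x Hl)).
  rewrite E. split; [apply H|]. replace (l (minus y x) - l (minus y x)) with (RtoC 0) by ring.
  rewrite Cmod_0. lra.
Qed.

Lemma is_linear_intro (l : V -> C) (L : R) :
  (forall x y, l (plus x y) = l x + l y) -> (forall k x, l (scal k x) = k * l x) ->
  (forall x, (Cmod (l x) <= L * norm x)%R) ->
  is_linear (K := C_AbsRing) (U := V) (V := C_NormedModule) l.
Proof.
intros H1 H2 H3. split; [exact H1|exact H2|]. exists (Rmax 1 L). split.
- eapply Rlt_le_trans; [|apply Rmax_l]. lra.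
- intros x. eapply Rle_trans; [apply (H3 x)|].
  apply Rmult_le_compat_r; [apply norm_ge_0|apply Rmax_r].
Qed.

Lemma jet_plus e B f g D E A A' : jet e B f D A -> jet e B g E A' ->
  jet e B (fun x => f x + g x) (fun x h => D x h + E x h) (A + A').
Proof.
intros [M [L [K [[H0 H1] H2]]]] [M' [L' [K' [[H0' H1'] H2']]]].
exists (M + M')%R, (L + L')%R, (K + K')%R. split; [|lra]. split; [lra|].
intros x Hx. destruct (H1 x Hx) as [Q1 [Q2 [Q3 Q4]]].
destruct (H1' x Hx) as [P1 [P2 [P3 P4]]].
assert (HL : forall h, (Cmod (D x h + E x h) <= (L + L') * norm h)%R).
{ intros h. eapply Rle_trans; [apply Cmod_triangle|].
  generalize (Q3 h) (P3 h). lra. }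
split; [|split; [|split; [exact HL|]]].
- apply (is_linear_intro _ (L + L')%R); [| |exact HL].
  + intros u v. rewrite (linear_plus _ Q1), (linear_plus _ P1).
    unfold plus; simpl. ring.
  + intros k v. rewrite (linear_scal _ Q1), (linear_scal _ P1).
    unfold scal; simpl. unfold mult; simpl. ring.
- eapply Rle_trans; [apply Cmod_triangle|]. lra.
- intros y Hy. destruct (Q4 y Hy) as [Q5 Q6]. destruct (P4 y Hy) as [P5 P6]. split.
  + replace (f y + g y - (f x + g x)) with ((f y - f x) + (g y - g x)) by ring.
    eapply Rle_trans; [apply Cmod_triangle|]. lra.
  + match goal with |- (Cmod ?a <= _)%R => replace a with
      ((f y - f x - D x (minus y x)) + (g y - g x - E x (minus y x))) by ring end.
    eapply Rle_trans; [apply Cmod_triangle|]. lra.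
Qed.

Lemma jet_mult e B f g D E A A' : (0 <= e)%R -> jet e B f D A -> jet e B g E A' ->
  jet e B (fun x => f x * g x) (fun x h => D x h * g x + f x * E x h) (A * A').
Proof.
intros He [M [L [K [[H0 H1] H2]]]] [M' [L' [K' [[H0' H1'] H2']]]].
exists (M * M')%R, (L * M' + M * L')%R, (K * M' + M * K' + L * L')%R.
assert (Hp : (0 <= M * M' /\ 0 <= L * M' /\ 0 <= M * L' /\ 0 <= K * M' /\ 0 <= M * K'
  /\ 0 <= L * L' /\ 0 <= L * K' /\ 0 <= K * L' /\ 0 <= K * K')%R).
{ repeat split; apply Rmult_le_pos; lra. }
split.
2:{ eapply Rle_trans with ((M + e * L + e ^ 2 * K) * (M' + e * L' + e ^ 2 * K'))%R.
  - assert (0 <= e ^ 3 * (L * K') /\ 0 <= e ^ 3 * (K * L') /\ 0 <= e ^ 4 * (K * K'))%R.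
    { repeat split; (apply Rmult_le_pos; [apply pow_le; exact He|lra]). }
    nra.
  - assert (0 <= e * L /\ 0 <= e ^ 2 * K /\ 0 <= e * L' /\ 0 <= e ^ 2 * K')%R.
    { repeat split; apply Rmult_le_pos; try lra; apply pow_le; exact He. }
    apply Rmult_le_compat; lra. }
split; [lra|].
intros x Hx. destruct (H1 x Hx) as [Q1 [Q2 [Q3 Q4]]].
destruct (H1' x Hx) as [P1 [P2 [P3 P4]]].
assert (HL : forall h, (Cmod (D x h * g x + f x * E x h) <= (L * M' + M * L') * norm h)%R).
{ intros h. eapply Rle_trans; [apply Cmod_triangle|]. rewrite !Cmod_mult.
  assert (Cmod (D x h) * Cmod (g x) <= (L * norm h) * M')%R.
  { apply Rmult_le_compat; auto using Cmod_ge_0. }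
  assert (Cmod (f x) * Cmod (E x h) <= M * (L' * norm h))%R.
  { apply Rmult_le_compat; auto using Cmod_ge_0. }
  lra. }
split; [|split; [|split; [exact HL|]]].
- apply (is_linear_intro _ (L * M' + M * L')%R); [| |exact HL].
  + intros u v. rewrite (linear_plus _ Q1), (linear_plus _ P1).
    unfold plus; simpl. ring.
  + intros k v. rewrite (linear_scal _ Q1), (linear_scal _ P1).
    unfold scal; simpl. unfold mult; simpl. ring.
- rewrite Cmod_mult. apply Rmult_le_compat; auto using Cmod_ge_0.
- intros y Hy. destruct (Q4 y Hy) as [Q5 Q6]. destruct (P4 y Hy) as [P5 P6].
  destruct (H1 y Hy) as [_ [Q7 _]].
  set (d := minus y x) in *. generalize (norm_ge_0 d); intros Hd. split.
  + replace (f y * g y - f x * g x) with ((f y - f x) * g x + f y * (g y - g x)) by ring.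
    eapply Rle_trans; [apply Cmod_triangle|]. rewrite !Cmod_mult.
    assert (Cmod (f y - f x) * Cmod (g x) <= (L * norm d) * M')%R.
    { apply Rmult_le_compat; auto using Cmod_ge_0. }
    assert (Cmod (f y) * Cmod (g y - g x) <= M * (L' * norm d))%R.
    { apply Rmult_le_compat; auto using Cmod_ge_0. }
    lra.
  (* The remainder of a product consists of two remainders and the product of the increments; the
     last term is why a Lipschitz bound is carried along. *)
  + match goal with |- (Cmod ?a <= _)%R => replace a with
      ((f y - f x - D x d) * g x + f x * (g y - g x - E x d)
       + (f y - f x) * (g y - g x)) by ring end.
    eapply Rle_trans; [apply Cmod_triangle|].
    eapply Rle_trans; [apply Rplus_le_compat_r, Cmod_triangle|]. rewrite !Cmod_mult.
    assert (Cmod (f y - f x - D x d) * Cmod (g x) <= (K * norm d ^ 2) * M')%R.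
    { apply Rmult_le_compat; auto using Cmod_ge_0. }
    assert (Cmod (f x) * Cmod (g y - g x - E x d) <= M * (K' * norm d ^ 2))%R.
    { apply Rmult_le_compat; auto using Cmod_ge_0. }
    assert (Cmod (f y - f x) * Cmod (g y - g x) <= (L * norm d) * (L' * norm d))%R.
    { apply Rmult_le_compat; auto using Cmod_ge_0. }
    nra.
Qed.

(* The weights come from 1/f(y) - 1/f(x) + Df/f(x)^2
   = (f(y)-f(x))^2/(f(x)^2 f(y)) - (f(y)-f(x)-Df)/f(x)^2. *)
Lemma jet_bounds_inv B f D M L K m : (0 < m)%R -> jet_bounds B f D M L K ->
  (forall x, B x -> (m <= Cmod (f x))%R) ->
  jet_bounds B (fun x => / f x) (fun x h => - (/ f x * / f x) * D x h)
   (/ m) (L / m ^ 2) (K / m ^ 2 + L ^ 2 / m ^ 3).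
Proof.
intros Hm [H0 H1] Hf.
assert (Hi : (0 < / m)%R) by now apply Rinv_0_lt_compat.
assert (I2 : (/ m ^ 2 = / m * / m)%R) by (field; lra).
assert (I3 : (/ m ^ 3 = / m * / m * / m)%R) by (field; lra).
unfold Rdiv. rewrite I2, I3.
assert (Hfi : forall x, B x -> f x <> 0 /\ (Cmod (/ f x) <= / m)%R).
{ intros x Hx. specialize (Hf x Hx). assert (f x <> 0) by (apply Cmod_pos_neq; lra).
  split; [assumption|]. rewrite Cmod_inv by assumption. now apply Rinv_le_contravar. }
assert (HLm : (0 <= L * (/ m * / m))%R).
{ apply Rmult_le_pos; [lra|]. apply Rmult_le_pos; lra. }
split.
{ split; [lra|]. split; [exact HLm|]. apply Rplus_le_le_0_compat.
  - apply Rmult_le_pos; [lra|]. apply Rmult_le_pos; lra.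
  - apply Rmult_le_pos; [apply pow_le; lra|]. repeat apply Rmult_le_pos; lra. }
intros x Hx. destruct (H1 x Hx) as [Q1 [Q2 [Q3 Q4]]]. destruct (Hfi x Hx) as [F1 F2].
assert (HL : forall h, (Cmod (- (/ f x * / f x) * D x h) <= L * (/ m * / m) * norm h)%R).
{ intros h. rewrite Cmod_mult, Cmod_opp, Cmod_mult.
  replace (L * (/ m * / m) * norm h)%R with ((/ m * / m) * (L * norm h))%R by ring.
  apply Rmult_le_compat; auto using Cmod_ge_0.
  - apply Rmult_le_pos; apply Cmod_ge_0.
  - apply Rmult_le_compat; auto using Cmod_ge_0. }
split; [|split; [exact F2|split; [exact HL|]]].
- apply (is_linear_intro _ (L * (/ m * / m))%R); [| |exact HL].
  + intros u v. rewrite (linear_plus _ Q1). unfold plus; simpl. ring.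
  + intros k v. rewrite (linear_scal _ Q1). unfold scal; simpl. unfold mult; simpl. ring.
- intros y Hy. destruct (Q4 y Hy) as [Q5 Q6]. destruct (Hfi y Hy) as [G1 G2].
  set (d := minus y x) in *. generalize (norm_ge_0 d); intros Hd. split.
  + replace (/ f y - / f x) with (- ((f y - f x) * (/ f x * / f y))) by (field; auto).
    rewrite Cmod_opp, !Cmod_mult.
    replace (L * (/ m * / m) * norm d)%R with ((L * norm d) * (/ m * / m))%R by ring.
    apply Rmult_le_compat; auto using Cmod_ge_0.
    * apply Rmult_le_pos; apply Cmod_ge_0.
    * apply Rmult_le_compat; auto using Cmod_ge_0.
  + match goal with |- (Cmod ?a <= _)%R => replace a with
      (- ((f y - f x - D x d) * (/ f x * / f x))
       + ((f y - f x) * (f y - f x)) * ((/ f x * / f x) * / f y)) by (field; auto) end.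
    eapply Rle_trans; [apply Cmod_triangle|]. rewrite Cmod_opp, !Cmod_mult.
    rewrite Rmult_plus_distr_r. apply Rplus_le_compat.
    * replace (K * (/ m * / m) * norm d ^ 2)%R with ((K * norm d ^ 2) * (/ m * / m))%R by ring.
      apply Rmult_le_compat; auto using Cmod_ge_0.
      -- apply Rmult_le_pos; apply Cmod_ge_0.
      -- apply Rmult_le_compat; auto using Cmod_ge_0.
    * replace (L ^ 2 * (/ m * / m * / m) * norm d ^ 2)%R with
       (((L * norm d) * (L * norm d)) * ((/ m * / m) * / m))%R by ring.
      apply Rmult_le_compat; repeat (apply Rmult_le_pos); auto using Cmod_ge_0.
      -- apply Rmult_le_compat; auto using Cmod_ge_0.
      -- apply Rmult_le_compat; repeat (apply Rmult_le_pos); auto using Cmod_ge_0.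
         apply Rmult_le_compat; auto using Cmod_ge_0.
Qed.

Lemma jet_nonneg e B f D A : (0 <= e)%R -> jet e B f D A -> (0 <= A)%R.
Proof.
intros He [M [L [K [[H0 _] H2]]]].
assert (0 <= e * L)%R by (apply Rmult_le_pos; lra).
assert (0 <= e ^ 2 * K)%R by (apply Rmult_le_pos; [apply pow_le|]; lra). lra.
Qed.

(** At fixed points each clause of [jet_bounds] is an identity or inequality on expressions linear
    in the function and its differential, so it passes to absolutely convergent sums; no separate
    exchange of limit and derivative has to be justified. *)
Lemma jet_series e B (f : nat -> V -> C) (D : nat -> V -> V -> C) (A : nat -> R) :
  (0 < e)%R -> (forall n, jet e B (f n) (D n) (A n)) -> ex_series A ->
  jet e B (fun x => CSeries (fun n => f n x)) (fun x h => CSeries (fun n => D n x h))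
    (Series A).
Proof.
intros He H HA.
(* Countable choice of one triple of constants per term, since [jet] hides them under an
   existential. *)
assert (Hc : forall n, {q : R * R * R | jet_bounds B (f n) (D n) (fst (fst q)) (snd (fst q)) (snd q)
   /\ (fst (fst q) + e * snd (fst q) + e ^ 2 * snd q <= A n)%R}).
{ intros n. apply constructive_indefinite_description.
  destruct (H n) as [M [L [K Q]]]. now exists (M, L, K). }
set (M := fun n => fst (fst (proj1_sig (Hc n)))).
set (L := fun n => snd (fst (proj1_sig (Hc n)))).
set (K := fun n => snd (proj1_sig (Hc n))).
assert (H1 : forall n, jet_bounds B (f n) (D n) (M n) (L n) (K n)).
{ intros n. apply (proj2_sig (Hc n)). }
assert (H2 : forall n, (M n + e * L n + e ^ 2 * K n <= A n)%R).
{ intros n. apply (proj2_sig (Hc n)). }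
clearbody M L K. clear Hc H.
assert (He2 : (0 < e ^ 2)%R) by now apply pow_lt.
assert (P : forall n, (0 <= M n /\ 0 <= L n /\ 0 <= K n /\ 0 <= e * L n /\ 0 <= e ^ 2 * K n)%R).
{ intros n. destruct (H1 n) as [Q _]. repeat split; try apply Q;
  apply Rmult_le_pos; try apply Q; lra. }
assert (XA : forall b : nat -> R, (forall n, (0 <= b n <= A n)%R) -> ex_series b).
{ intros b Hb. apply (ex_series_le b A); [|exact HA]. intros n. simpl.
  unfold norm; simpl. unfold abs; simpl. rewrite Rabs_right; [apply Hb|apply Rle_ge, Hb]. }
assert (XM : ex_series M) by (apply XA; intros n; generalize (P n) (H2 n); lra).
(* Positivity of [e] enters here: dividing by the weight recovers the summability of [L] from that
   of [e * L]. *)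
assert (XL : ex_series L).
{ apply (ex_series_ext (fun n => / e * (e * L n))%R).
  - intros n. change (/ e * (e * L n) = L n)%R. field. lra.
  - apply (ex_series_scal (V := R_NormedModule) (/ e)%R (fun n => e * L n)%R). apply XA.
    intros n; generalize (P n) (H2 n); lra. }
assert (XK : ex_series K).
{ apply (ex_series_ext (fun n => / (e ^ 2) * (e ^ 2 * K n))%R).
  - intros n. change (/ e ^ 2 * (e ^ 2 * K n) = K n)%R. field. lra.
  - apply (ex_series_scal (V := R_NormedModule) (/ e ^ 2)%R (fun n => e ^ 2 * K n)%R). apply XA.
    intros n; generalize (P n) (H2 n); lra. }
assert (SN : forall b : nat -> R, (forall n, (0 <= b n)%R) -> ex_series b -> (0 <= Series b)%R).
{ intros b Hb Xb. rewrite <- (Rmult_0_l (Series b)), <- Series_scal_l.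
  apply Series_le; [|exact Xb]. intros n. rewrite Rmult_0_l. split; [lra|apply Hb]. }
exists (Series M), (Series L), (Series K). split.
2:{ assert (XeL : ex_series (fun n => e * L n)%R)
    by exact (ex_series_scal (V := R_NormedModule) e L XL).
  assert (XeK : ex_series (fun n => e ^ 2 * K n)%R)
    by exact (ex_series_scal (V := R_NormedModule) (e ^ 2)%R K XK).
  assert (XML : ex_series (fun n => M n + e * L n)%R)
    by exact (ex_series_plus (V := R_NormedModule) M _ XM XeL).
  rewrite <- !Series_scal_l. rewrite <- (Series_plus M _ XM XeL).
  rewrite <- (Series_plus _ _ XML XeK).
  apply Series_le; [|exact HA]. intros n. generalize (P n) (H2 n). lra. }
split.
{ repeat split; apply SN; auto; intros n; apply P. }
intros x Hx.
assert (Cf : forall y, B y -> Cconv (fun n => f n y) (CSeries (fun n => f n y))).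
{ intros y Hy. apply Cconv_CSeries with M; [|exact XM]. intros n.
  apply (proj2 (H1 n) y Hy). }
assert (XS : forall (b : nat -> R) c, ex_series b -> ex_series (fun n => b n * c)%R).
{ intros b c Hb. now apply ex_series_scal_r. }
assert (BD : forall n h, (Cmod (D n x h) <= L n * norm h)%R).
{ intros n h. apply (proj2 (H1 n) x Hx). }
assert (CD : forall h, Cconv (fun n => D n x h) (CSeries (fun n => D n x h))).
{ intros h. apply Cconv_CSeries with (fun n => L n * norm h)%R; auto. }
assert (HL : forall h, (Cmod (CSeries (fun n => D n x h)) <= Series L * norm h)%R).
{ intros h. rewrite <- Series_scal_r. apply (Cconv_bound (fun n => D n x h)); auto. }
split; [|split; [|split; [exact HL|]]].
- apply (is_linear_intro _ (Series L)); [| |exact HL].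
  + intros u v. apply CSeries_unique.
    eapply Cconv_ext; [|apply Cconv_plus; apply CD]. intros n. simpl.
    symmetry. apply (linear_plus _ (proj1 (proj2 (H1 n) x Hx))).
  + intros k v. apply CSeries_unique.
    eapply Cconv_ext; [|apply Cconv_scal; apply CD]. intros n. simpl.
    symmetry. apply (linear_scal _ (proj1 (proj2 (H1 n) x Hx))).
- apply (Cconv_bound (fun n => f n x)); auto. intros n. apply (proj2 (H1 n) x Hx).
- intros y Hy. set (d := minus y x). split.
  + rewrite <- Series_scal_r.
    refine (Cconv_bound _ _ _ (Cconv_minus _ _ _ _ (Cf y Hy) (Cf x Hx)) _ (XS _ _ XL)).
    intros n. apply (proj2 (H1 n) x Hx). exact Hy.
  + rewrite <- Series_scal_r.
    refine (Cconv_bound _ _ _ (Cconv_minus _ _ _ _ (Cconv_minus _ _ _ _ (Cf y Hy) (Cf x Hx))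
      (CD d)) _ (XS _ _ XK)).
    intros n. apply (proj2 (H1 n) x Hx). exact Hy.
Qed.

Lemma jet_filterdiff e B f D A x : jet e B f D A -> locally x B ->
  ex_filterdiff (K := C_AbsRing) (U := V) (V := C_NormedModule) f (locally x).
Proof.
intros [M [L [K [[H0 H1] _]]]] HB. exists (D x).
assert (Bx : B x) by exact (locally_singleton x B HB).
destruct (H1 x Bx) as [Q1 [Q2 [Q3 Q4]]]. split; [exact Q1|].
intros x' Hx'. assert (E : x = x') by exact (is_filter_lim_locally_unique x x' Hx').
subst x'. intros eps.
assert (Hd : (0 < eps / (K + 1))%R) by (apply Rdiv_lt_0_compat; [apply cond_pos|lra]).
assert (Hn : locally x (fun y => norm (minus y x) < eps / (K + 1))%R).
{ apply locally_le_locally_norm. exists (mkposreal _ Hd). intros y Hy. exact Hy. }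
generalize (filter_and _ _ HB Hn). apply filter_imp. intros y [Hy Hy2].
destruct (Q4 y Hy) as [_ Q5]. eapply Rle_trans; [exact Q5|].
generalize (norm_ge_0 (minus y x)). intros Hp. simpl in *.
assert (K * norm (minus y x) <= eps)%R.
{ apply Rle_trans with ((K + 1) * (eps / (K + 1)))%R.
  - apply Rmult_le_compat; lra.
  - right. field. lra. }
nra.
Qed.

Lemma c11_le e B f A A' : (A <= A')%R -> c11 e B f A -> c11 e B f A'.
Proof. intros H [D HD]. exists D. now apply jet_le with A. Qed.

Lemma c11_subset e (B B' : V -> Prop) f A :
  (forall x, B' x -> B x) -> c11 e B f A -> c11 e B' f A.
Proof. intros H [D HD]. exists D. now apply jet_subset with B. Qed.

Lemma c11_ext e (B : V -> Prop) f g A : (forall x, B x -> f x = g x) ->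
  c11 e B f A -> c11 e B g A.
Proof. intros H [D HD]. exists D. now apply jet_ext with f D. Qed.

Lemma c11_sup e B f A x : (0 <= e)%R -> c11 e B f A -> B x -> (Cmod (f x) <= A)%R.
Proof. intros He [D HD]. eapply jet_sup; eassumption. Qed.

Lemma c11_const e B (c : C) : c11 e B (fun _ => c) (Cmod c).
Proof. exists (fun _ _ => 0). apply jet_const. lra. Qed.

Lemma c11_plus e B f g A A' : c11 e B f A -> c11 e B g A' ->
  c11 e B (fun x => f x + g x) (A + A').
Proof. intros [D HD] [E HE]. eexists. apply jet_plus; eassumption. Qed.

Lemma c11_mult e B f g A A' : (0 <= e)%R -> c11 e B f A -> c11 e B g A' ->
  c11 e B (fun x => f x * g x) (A * A').
Proof. intros He [D HD] [E HE]. eexists. apply jet_mult; eassumption. Qed.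

Lemma c11_nonneg e B f A : (0 <= e)%R -> c11 e B f A -> (0 <= A)%R.
Proof. intros He [D HD]. eapply jet_nonneg; eassumption. Qed.

Lemma c11_series e B (f : nat -> V -> C) (A : nat -> R) :
  (0 < e)%R -> (forall n, c11 e B (f n) (A n)) -> ex_series A ->
  c11 e B (fun x => CSeries (fun n => f n x)) (Series A).
Proof.
intros He H HA.
assert (Hc : forall n, {D | jet e B (f n) D (A n)}).
{ intros n. apply constructive_indefinite_description, H. }
eexists. apply (jet_series e B f (fun n => proj1_sig (Hc n))); [exact He| |exact HA].
intros n. apply (proj2_sig (Hc n)).
Qed.

End Jets.

(** * Complex power series *)

Definition CPSeries (a : nat -> C) (z : C) : C := CSeries (fun k => a k * z ^ k).

(** Stands in for a radius of convergence at least [r]. Shifts, sums and multiples preserve it, and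
    derivation costs only a fixed shrinking of [r]. *)
Definition geom_bounded (a : nat -> C) (r : R) : Prop :=
  exists M, forall k, (Cmod (a k) * r ^ k <= M)%R.

Definition CPS_derive (a : nat -> C) (k : nat) : C := RtoC (INR (S k)) * a (S k).

Lemma geom_bounded_le a r r' : (0 <= r' <= r)%R -> geom_bounded a r -> geom_bounded a r'.
Proof.
intros H [M HM]. exists M. intros k. eapply Rle_trans; [|apply HM].
apply Rmult_le_compat_l; [apply Cmod_ge_0|]. apply pow_incr. lra.
Qed.

Lemma CPSeries_conv a r z : geom_bounded a r -> (Cmod z < r)%R ->
  Cconv (fun k => a k * z ^ k) (CPSeries a z).
Proof.
intros [M HM] Hz. generalize (Cmod_ge_0 z). intros H0.
apply Cconv_CSeries with (fun k => M * (Cmod z / r) ^ k)%R.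
- intros k. rewrite Cmod_mult, Cmod_pow.
  replace ((Cmod z / r) ^ k)%R with (Cmod z ^ k * / r ^ k)%R.
  + assert (Hr : (0 < r ^ k)%R) by (apply pow_lt; lra).
    apply Rle_trans with ((Cmod (a k) * r ^ k) * (Cmod z ^ k * / r ^ k))%R.
    * right. field. lra.
    * apply Rmult_le_compat_r; [|apply HM]. apply Rmult_le_pos; [now apply pow_le|].
      left. now apply Rinv_0_lt_compat.
  + unfold Rdiv. rewrite Rpow_mult_distr, pow_inv. reflexivity.
- apply (ex_series_scal (V := R_NormedModule) M). apply ex_series_geom.
  rewrite Rabs_right.
  + apply Rmult_lt_reg_r with r; [lra|]. field_simplify; lra.
  + apply Rle_ge. apply Rmult_le_pos; [lra|]. left. apply Rinv_0_lt_compat. lra.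
Qed.

Lemma INR_S_le_pow2 k : (INR (S k) <= 2 ^ k)%R.
Proof.
induction k as [|k IH]; [simpl; lra|].
rewrite S_INR. simpl pow. assert (1 <= 2 ^ k)%R by (apply pow_R1_Rle; lra). lra.
Qed.

(** Halving the radius absorbs the factor [k + 1 <= 2^k]. *)
Lemma geom_bounded_derive a r : (0 < r)%R -> geom_bounded a r ->
  geom_bounded (CPS_derive a) (r / 2).
Proof.
intros Hr [M HM]. exists (M / r)%R. intros k. unfold CPS_derive.
rewrite Cmod_mult, Cmod_R, Rabs_right by (apply Rle_ge, pos_INR).
assert (H2 : (0 < 2 ^ k)%R) by (apply pow_lt; lra).
assert (Hrk : (0 < r ^ k)%R) by (apply pow_lt; lra).
unfold Rdiv at 1. rewrite Rpow_mult_distr, pow_inv.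
apply Rle_trans with (2 ^ k * Cmod (a (S k)) * (r ^ k * / 2 ^ k))%R.
- apply Rmult_le_compat_r.
  + apply Rmult_le_pos; [lra|]. left. now apply Rinv_0_lt_compat.
  + apply Rmult_le_compat_r; [apply Cmod_ge_0|apply INR_S_le_pow2].
- apply Rmult_le_reg_r with r; [exact Hr|].
  replace (M / r * r)%R with M by (field; lra).
  eapply Rle_trans; [|apply (HM (S k))]. right. simpl. field. lra.
Qed.

Lemma jet_id (s : R) : (0 <= s)%R ->
  jet (V := C_NormedModule) s (fun z => (Cmod z <= s)%R) (fun z => z) (fun _ h => h) (2 * s).
Proof.
intros Hs. exists s, 1%R, 0%R. split; [|lra]. split; [lra|].
intros x Hx. split; [|split; [exact Hx|split]].
- apply (is_linear_id (K := C_AbsRing) (V := C_NormedModule)).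
- intros h. rewrite Rmult_1_l. right. reflexivity.
- intros y _. change (@norm C_AbsRing C_NormedModule (minus y x)) with (Cmod (y - x)).
  change (@minus C_NormedModule y x) with (y - x).
  split; [lra|]. replace (y - x - (y - x)) with (RtoC 0) by ring. rewrite Cmod_0. lra.
Qed.

(** With the weight [e] equal to the radius [s], the identity has norm [s + s * 1 = 2 * s], and
    submultiplicativity does the rest. *)
Lemma jet_pow (s : R) k : (0 <= s)%R ->
  jet (V := C_NormedModule) s (fun z => (Cmod z <= s)%R) (fun z => z ^ k)
    (fun z h => RtoC (INR k) * z ^ (pred k) * h) ((2 * s) ^ k).
Proof.
intros Hs. induction k as [|k IH].
- apply (jet_ext s _ (fun _ => 1) _ (fun _ _ => 0)).
  + reflexivity.
  + intros x h _. simpl. ring.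
  + apply jet_const. rewrite Cmod_1. simpl. lra.
- apply (jet_ext s _ (fun z => z * z ^ k) _
    (fun z h => h * z ^ k + z * (RtoC (INR k) * z ^ (pred k) * h))).
  + reflexivity.
  + intros x h _. rewrite S_INR, RtoC_plus. destruct k as [|k]; simpl; ring.
  + simpl pow. apply (jet_mult s _ (fun z : C_NormedModule => z) (fun z => z ^ k)
      (fun _ h => h)); auto. now apply jet_id.
Qed.

Lemma jet_der e (B : C -> Prop) f (D : C -> C -> C) A z :
  jet (V := C_NormedModule) e B f D A -> near z B -> der f z (D z 1).
Proof.
intros [M [L [K [[H0 H1] _]]]] HB.
assert (Bx : B z) by exact (near_at _ _ HB).
destruct (H1 z Bx) as [Q1 [Q2 [Q3 Q4]]]. intros eps Heps.
assert (Hd : (0 < eps / (K + 1))%R) by (apply Rdiv_lt_0_compat; lra).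
generalize (near_and _ _ _ HB (near_ball z _ Hd)). apply near_imp. intros w [Hw Hw2].
destruct (Q4 w Hw) as [_ Q5]. change (@norm C_AbsRing C_NormedModule (minus w z)) with (Cmod (w - z)) in Q5.
change (@minus C_NormedModule w z) with (w - z) in Q5.
assert (E : D z 1 * (w - z) = D z (w - z)).
{ generalize (linear_scal _ Q1 (w - z) (RtoC 1)). intros HS.
  change (D z ((w - z) * 1) = (w - z) * D z 1) in HS.
  rewrite Cmult_1_r in HS. rewrite HS. apply Cmult_comm. }
rewrite E. eapply Rle_trans; [exact Q5|].
generalize (Cmod_ge_0 (w - z)). intros Hp.
assert (K * Cmod (w - z) <= eps)%R.
{ apply Rle_trans with ((K + 1) * (eps / (K + 1)))%R.
  - apply Rmult_le_compat; lra.
  - right. field. lra. }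
nra.
Qed.

(** On the disc of radius [s = r / 4] the power [z^k] has norm at most [(2 * s)^k = (r / 2)^k], so
    the terms are dominated by [M * (/ 2)^k] and [jet_series] differentiates termwise. *)
Lemma der_CPSeries a r z : geom_bounded a r -> (Cmod z < r / 4)%R ->
  der (CPSeries a) z (CPSeries (CPS_derive a) z).
Proof.
intros Ha Hz. generalize (Cmod_ge_0 z). intros H0. set (s := (r / 4)%R).
destruct Ha as [M HM].
assert (HJ : jet (V := C_NormedModule) s (fun z => (Cmod z <= s)%R) (CPSeries a)
   (fun z h => CSeries (fun k => 0 * z ^ k + a k * (RtoC (INR k) * z ^ (pred k) * h)))
   (Series (fun k => M * (/ 2) ^ k)%R)).
{ apply (jet_series s _ (fun k z => a k * z ^ k)).
  - unfold s. lra.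
  - intros k. apply jet_le with (Cmod (a k) * (2 * s) ^ k)%R.
    + replace (2 * s)%R with (r * / 2)%R by (unfold s; field).
      rewrite Rpow_mult_distr, <- Rmult_assoc.
      apply Rmult_le_compat_r; [apply pow_le; lra|apply HM].
    + apply (jet_mult s _ (fun _ => a k) (fun z => z ^ k) (fun _ _ => 0)).
      * unfold s; lra.
      * apply jet_const. lra.
      * apply jet_pow. unfold s; lra.
  - apply (ex_series_scal (V := R_NormedModule) M). apply ex_series_geom.
    rewrite Rabs_right; lra. }
assert (HB : near z (fun z => (Cmod z <= s)%R)).
{ exists (s - Cmod z)%R. split; [unfold s; lra|]. intros w Hw.
  generalize (Cmod_rtriangle w z). lra. }
generalize (jet_der _ _ _ _ _ _ HJ HB). cbv beta. intros HD.
match type of HD with der _ _ ?v => replace (CPSeries (CPS_derive a) z) with v; [exact HD|] end.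
(* The differentiated series begins with a zero term; dropping it shifts the index to that of
   [CPS_derive a]. *)
apply CSeries_unique. apply Cconv_decr_1.
eapply Cconv_ext.
2:{ match goal with |- Cconv _ ?v => replace v with (CPSeries (CPS_derive a) z) end.
  - apply CPSeries_conv with (r / 2)%R; [|lra].
    apply geom_bounded_derive; [lra|now exists M].
  - simpl. ring. }
intros k. unfold CPS_derive. simpl pred. ring.
Qed.

Lemma der2_CPSeries a r z : geom_bounded a r -> (Cmod z < r / 8)%R ->
  der2 (CPSeries a) z (CPSeries (CPS_derive a) z) (CPSeries (CPS_derive (CPS_derive a)) z).
Proof.
intros Ha Hz. generalize (Cmod_ge_0 z). intros H0.
exists (CPSeries (CPS_derive a)). split; [|split; [reflexivity|]].
- exists (r / 4 - Cmod z)%R. split; [lra|]. intros w Hw.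
  apply der_CPSeries with r; [exact Ha|]. generalize (Cmod_rtriangle w z). lra.
- apply der_CPSeries with (r / 2)%R; [|lra]. apply geom_bounded_derive; [lra|exact Ha].
Qed.

Lemma geom_bounded_tail a r : (0 < r)%R -> geom_bounded a r ->
  geom_bounded (fun k => a (S k)) r.
Proof.
intros Hr [M HM]. exists (M / r)%R. intros k.
apply Rmult_le_reg_r with r; [exact Hr|].
replace (M / r * r)%R with M by (field; lra).
eapply Rle_trans; [|apply (HM (S k))]. right. simpl. ring.
Qed.

Lemma CPSeries_tail a r z : geom_bounded a r -> (Cmod z < r)%R ->
  CPSeries a z = a 0%nat + z * CPSeries (fun k => a (S k)) z.
Proof.
intros Ha Hz. generalize (Cmod_ge_0 z). intros H0.
assert (Hr : (0 < r)%R) by lra.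
apply CSeries_unique, Cconv_decr_1.
generalize (Cconv_scal z _ _ (CPSeries_conv _ r z (geom_bounded_tail a r Hr Ha) Hz)).
intros H.
match goal with |- Cconv _ ?v => replace v with (z * CPSeries (fun k => a (S k)) z)
  by (simpl; ring) end.
eapply Cconv_ext; [|exact H]. intros k. simpl. ring.
Qed.

Lemma CPSeries_0 a : CPSeries a 0 = a 0%nat.
Proof.
apply CSeries_unique, Cconv_decr_1.
match goal with |- Cconv _ ?v => replace v with (RtoC 0) by (simpl; ring) end.
eapply Cconv_ext; [|apply Cconv_0]. intros k. simpl. ring.
Qed.

(** Identity theorem at 0: continuity yields the constant term, and division by [z] passes to the
    tail. The point 0 is left out because the differential equation is only available off it. *)
Lemma CPSeries_eq_0 a r : (0 < r)%R -> geom_bounded a r ->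
  near 0 (fun z => z <> 0 -> CPSeries a z = 0) -> forall k, a k = 0.
Proof.
intros Hr Ha H k. revert a Ha H.
assert (A0 : forall a, geom_bounded a r ->
  near 0 (fun z => z <> 0 -> CPSeries a z = 0) -> a 0%nat = 0).
{ intros a Ha H.
  assert (Hc : ccont (CPSeries a) 0).
  { eapply der_ccont, der_CPSeries; [exact Ha|]. rewrite Cmod_0. lra. }
  apply Cmod_eq_0. destruct (Rle_lt_or_eq_dec 0 _ (Cmod_ge_0 (a 0%nat))) as [Hp|E];
    [|now symmetry].
  exfalso. destruct (near_and _ _ _ H (Hc _ Hp)) as [d [Hd HH]].
  destruct (HH (RtoC (d / 2))) as [H1 H2].
  { replace (RtoC (d/2) - 0) with (RtoC (d/2)) by ring. rewrite Cmod_R, Rabs_right; lra. }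
  rewrite H1, CPSeries_0 in H2.
  - replace (0 - a 0%nat) with (- a 0%nat) in H2 by ring. rewrite Cmod_opp in H2. lra.
  - intros E. apply RtoC_inj in E. lra. }
induction k as [|k IH]; intros a Ha H; [now apply A0|].
apply (IH (fun k => a (S k))); [now apply geom_bounded_tail|].
generalize (near_and _ _ _ H (near_ball 0 r Hr)). apply near_imp. intros z [H1 H2] Hz.
specialize (H1 Hz). replace (z - 0) with z in H2 by ring.
rewrite (CPSeries_tail a r z Ha H2), (A0 a Ha H), Cplus_0_l in H1.
replace (CPSeries (fun k => a (S k)) z) with (/ z * (z * CPSeries (fun k => a (S k)) z))
  by (field; exact Hz).
rewrite H1. ring.
Qed.

(** * Integrals over circles *)

Definition circ (r t : R) : C := (r * cos t, r * sin t)%R.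
Definition cis (t : R) : C := (cos t, sin t).

Lemma circ_cis r t : circ r t = RtoC r * cis t.
Proof. unfold circ, cis. apply C_ext; simpl; ring. Qed.

Lemma Cmod_circ r t : Cmod (circ r t) = Rabs r.
Proof.
rewrite circ_cis, Cmod_mult, Cmod_R. unfold cis, Cmod; simpl.
replace (cos t * (cos t * 1) + sin t * (sin t * 1))%R with 1%R.
- rewrite sqrt_1. ring.
- generalize (sin2_cos2 t). unfold Rsqr. lra.
Qed.

Lemma circ_2PI r : circ r (2 * PI) = circ r 0.
Proof. unfold circ. now rewrite cos_2PI, sin_2PI, cos_0, sin_0. Qed.

(** The chain rule is stated for real parts; imaginary parts are the real parts of [- Ci * F], and
    the same device is used for integrals below. *)
Lemma is_derive_path (F : C -> C) (g : R -> C) (t : R) (l : C) (a b : R) :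
  der F (g t) l -> is_derive (fun s => Re (g s)) t a -> is_derive (fun s => Im (g s)) t b ->
  is_derive (fun s => Re (F (g s))) t (Re (l * (a, b))).
Proof.
intros HF Ha Hb.
apply is_derive_Reals in Ha. apply is_derive_Reals in Hb. apply is_derive_Reals.
intros e He. set (K := (Rabs a + Rabs b + 2)%R).
assert (HK : (0 < K)%R).
{ unfold K. generalize (Rabs_pos a) (Rabs_pos b). lra. }
(* Error budget: [e / 4] for the remainder of [F], [e / 2] for the difference quotients of the
   path. *)
set (q := Rmin 1 (e / 2 / (Cmod l * 2 + 1))).
generalize (Cmod_ge_0 l). intros Hl.
assert (Hq : (0 < q)%R).
{ apply Rmin_pos; [lra|]. apply Rdiv_lt_0_compat; lra. }
destruct (Ha q Hq) as [d1 H1]. destruct (Hb q Hq) as [d2 H2].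
assert (HeK : (0 < e / 4 / K)%R) by (apply Rdiv_lt_0_compat; lra).
destruct (HF _ HeK) as [d3 [Hd3 H3]].
assert (Hd : (0 < Rmin (Rmin d1 d2) (d3 / K))%R).
{ repeat apply Rmin_pos; try apply cond_pos. now apply Rdiv_lt_0_compat. }
exists (mkposreal _ Hd). intros h Hh0 Hh. simpl in Hh.
assert (Hh1 : (Rabs h < d1)%R).
{ eapply Rlt_le_trans; [exact Hh|]. eapply Rle_trans; [apply Rmin_l|apply Rmin_l]. }
assert (Hh2 : (Rabs h < d2)%R).
{ eapply Rlt_le_trans; [exact Hh|]. eapply Rle_trans; [apply Rmin_l|apply Rmin_r]. }
assert (Hh3 : (Rabs h < d3 / K)%R).
{ eapply Rlt_le_trans; [exact Hh|]. apply Rmin_r. }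
specialize (H1 h Hh0 Hh1). specialize (H2 h Hh0 Hh2).
assert (Hhp : (0 < Rabs h)%R) by now apply Rabs_pos_lt.
set (D := g (t + h)%R - g t).
set (u := ((Re (g (t + h)%R) - Re (g t)) / h - a)%R) in *.
set (v := ((Im (g (t + h)%R) - Im (g t)) / h - b)%R) in *.
assert (ED : D = RtoC h * ((a, b) + (u, v))).
{ apply C_ext; unfold D, u, v; simpl; unfold Re, Im; field; exact Hh0. }
assert (Huv : (Cmod (u, v) <= 2 * q)%R).
{ eapply Rle_trans; [apply Cmod_le_re_im|]. simpl. lra. }
assert (Hab : (Cmod (a, b) <= Rabs a + Rabs b)%R) by apply (Cmod_le_re_im (a, b)).
assert (Hq1 : (q <= 1)%R) by apply Rmin_l.
assert (HD : (Cmod D <= Rabs h * K)%R).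
{ rewrite ED, Cmod_mult, Cmod_R. apply Rmult_le_compat_l; [lra|].
  eapply Rle_trans; [apply Cmod_triangle|]. unfold K. lra. }
assert (HD3 : (Cmod (g (t + h)%R - g t) < d3)%R).
{ fold D. eapply Rle_lt_trans; [exact HD|].
  apply Rmult_lt_reg_r with (/ K)%R; [now apply Rinv_0_lt_compat|].
  replace (Rabs h * K * / K)%R with (Rabs h) by (field; lra). exact Hh3. }
specialize (H3 _ HD3). fold D in H3.
set (E := F (g (t + h)%R) - F (g t) - l * D) in *.
assert (EE : ((Re (F (g (t + h)%R)) - Re (F (g t))) / h - Re (l * (a, b)))%R =
  (Re E / h + Re (l * (u, v)))%R).
{ assert (X : F (g (t + h)%R) = F (g t) + l * (RtoC h * ((a, b) + (u, v))) + E).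
  { unfold E. rewrite ED. ring. }
  rewrite X. destruct (F (g t)) as [f1 f2], l as [l1 l2], E as [E1 E2].
  simpl. unfold Re, Im; simpl. field. exact Hh0. }
rewrite EE. eapply Rle_lt_trans; [apply Rabs_triang|].
assert (B1 : (Rabs (Re E / h) <= e / 4)%R).
{ unfold Rdiv at 1. rewrite Rabs_mult, Rabs_inv.
  apply Rmult_le_reg_r with (Rabs h); [exact Hhp|].
  replace (Rabs (Re E) * / Rabs h * Rabs h)%R with (Rabs (Re E)) by (field; lra).
  eapply Rle_trans; [apply re_le_Cmod|]. eapply Rle_trans; [exact H3|].
  apply Rle_trans with (e / 4 / K * (Rabs h * K))%R.
  - apply Rmult_le_compat_l; lra.
  - right. field. lra. }
assert (B2 : (Rabs (Re (l * (u, v))) <= e / 2)%R).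
{ eapply Rle_trans; [apply re_le_Cmod|]. rewrite Cmod_mult.
  apply Rle_trans with ((Cmod l * 2 + 1) * q)%R.
  - nra.
  - apply Rle_trans with ((Cmod l * 2 + 1) * (e / 2 / (Cmod l * 2 + 1)))%R.
    + apply Rmult_le_compat_l; [lra|apply Rmin_r].
    + right. field. lra. }
lra.
Qed.

Lemma continuity_2d_pt_path (F : C -> C) (g : R -> R -> C) (x y : R) :
  ccont F (g x y) -> continuity_2d_pt (fun u v => Re (g u v)) x y ->
  continuity_2d_pt (fun u v => Im (g u v)) x y ->
  continuity_2d_pt (fun u v => Re (F (g u v))) x y.
Proof.
intros HF H1 H2 e. destruct (HF e (cond_pos e)) as [d [Hd HH]].
assert (Hd2 : (0 < d / 2)%R) by lra.
generalize (locally_2d_and _ _ _ _ (H1 (mkposreal _ Hd2)) (H2 (mkposreal _ Hd2))).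
apply locally_2d_impl, locally_2d_forall. intros u v [K1 K2]. simpl in K1, K2.
assert (E : (Re (F (g u v)) - Re (F (g x y)))%R = Re (F (g u v) - F (g x y))).
{ unfold Cminus. rewrite re_plus, re_opp. ring. }
rewrite E. eapply Rle_lt_trans; [apply re_le_Cmod|]. apply HH.
eapply Rle_lt_trans; [apply Cmod_le_re_im|].
unfold Cminus. rewrite re_plus, re_opp, im_plus, im_opp. unfold Rminus in *. lra.
Qed.

Lemma continuity_2d_pt_1d (f : R -> R) (x y : R) : continuity_pt f y ->
  continuity_2d_pt (fun _ v => f v) x y.
Proof. intros H. apply (continuity_1d_2d_pt_comp f (fun _ v => v)); [exact H|apply continuity_2d_pt_id2]. Qed.

Lemma continuity_pt_2d (f : R -> R -> R) (x y : R) : continuity_2d_pt f x y ->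
  continuity_pt (fun v => f x v) y.
Proof.
intros H. apply continuity_pt_locally. intros e.
destruct (H e) as [d Hd]. exists d. intros v Hv. apply Hd; [|exact Hv].
replace (x - x)%R with 0%R by ring. rewrite Rabs_R0. apply cond_pos.
Qed.

Lemma continuity_2d_circ_re x y : continuity_2d_pt (fun u v => Re (circ u v)) x y.
Proof.
apply continuity_2d_pt_mult; [apply continuity_2d_pt_id1|].
apply continuity_2d_pt_1d, continuity_cos.
Qed.

Lemma continuity_2d_circ_im x y : continuity_2d_pt (fun u v => Im (circ u v)) x y.
Proof.
apply continuity_2d_pt_mult; [apply continuity_2d_pt_id1|].
apply continuity_2d_pt_1d, continuity_sin.
Qed.

Lemma continuity_2d_circ (F : C -> C) x y : ccont F (circ x y) ->
  continuity_2d_pt (fun u v => Re (F (circ u v))) x y.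
Proof.
intros H. apply (continuity_2d_pt_path F circ); auto using continuity_2d_circ_re, continuity_2d_circ_im.
Qed.

Lemma continuity_2d_circ_cis (F : C -> C) x y : ccont F (circ x y) ->
  continuity_2d_pt (fun u v => Re (F (circ u v) * cis v)) x y.
Proof.
intros H. apply continuity_2d_pt_ext with
  (fun u v => Re (F (circ u v)) * cos v - Re (- Ci * F (circ u v)) * sin v)%R.
- intros u v. rewrite re_mult. unfold cis; simpl. unfold Re, Im. ring.
- apply continuity_2d_pt_minus; apply continuity_2d_pt_mult.
  + now apply continuity_2d_circ.
  + apply continuity_2d_pt_1d, continuity_cos.
  + apply (continuity_2d_circ (fun w => - Ci * F w)).
    apply ccont_mult; [apply ccont_const|exact H].
  + apply continuity_2d_pt_1d, continuity_sin.
Qed.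

Lemma ex_RInt_cont (f : R -> R) a b : (forall t, continuity_pt f t) -> ex_RInt f a b.
Proof.
intros H. apply (ex_RInt_continuous (V := R_CompleteNormedModule)). intros t _.
apply continuity_pt_filterlim, H.
Qed.

Lemma is_derive_circ_t r t : is_derive (fun s => Re (circ r s)) t (- r * sin t)%R /\
  is_derive (fun s => Im (circ r s)) t (r * cos t)%R.
Proof. unfold circ; simpl. split; auto_derive; auto; ring. Qed.

Lemma is_derive_circ_r r t : is_derive (fun s => Re (circ s t)) r (cos t) /\
  is_derive (fun s => Im (circ s t)) r (sin t).
Proof. unfold circ; simpl. split; auto_derive; auto; ring. Qed.

(** The circle has velocity [i * r * cis t], so the integrand is the derivative of the real part of
    [- Ci * / r * F (circ r t)], which takes the same value at both ends. *)
Lemma RInt_circ_der (F G : C -> C) (r : R) : r <> 0%R ->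
  (forall t, der F (circ r t) (G (circ r t)) /\ ccont G (circ r t)) ->
  is_RInt (fun t => Re (G (circ r t) * cis t)) 0 (2 * PI) 0.
Proof.
intros Hr H.
assert (HI : is_RInt (fun t => Re (G (circ r t) * cis t)) 0 (2 * PI)
  (minus (Re (- Ci * / RtoC r * F (circ r (2 * PI)))) (Re (- Ci * / RtoC r * F (circ r 0))))).
{ apply (is_RInt_derive (fun t => Re (- Ci * / RtoC r * F (circ r t)))).
  - intros t _. destruct (is_derive_circ_t r t) as [D1 D2].
    assert (HD := is_derive_path (fun w => - Ci * / RtoC r * F w) (circ r) t _ _ _
      (der_scal (- Ci * / RtoC r) _ _ _ (proj1 (H t))) D1 D2).
    match type of HD with is_derive _ _ ?v =>
      replace (Re (G (circ r t) * cis t)) with v; [exact HD|] end.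
    f_equal. rewrite <- RtoC_inv by exact Hr.
    unfold cis. apply C_ext; simpl; field; exact Hr.
  - intros t _. apply continuity_pt_filterlim.
    apply (continuity_pt_2d (fun u v => Re (G (circ u v) * cis v))).
    apply continuity_2d_circ_cis, H. }
rewrite circ_2PI in HI.
match type of HI with is_RInt _ _ _ ?v => replace v with (0%R) in HI; [exact HI|] end.
unfold minus, plus, opp; simpl. ring.
Qed.

Lemma RInt_circ_continuous (F : C -> C) (r : R) :
  (forall t, ccont F (circ r t)) ->
  (exists d, 0 < d /\ forall s, Rabs (s - r) < d -> forall t, ccont F (circ s t))%R ->
  continuity_pt (fun s => RInt (fun t => Re (F (circ s t))) 0 (2 * PI)) r.
Proof.
intros H [d0 [Hd0 H0]]. apply continuity_pt_locally. intros e.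
generalize PI_RGT_0; intros HPI.
assert (He : (0 < e / (4 * PI))%R) by (apply Rdiv_lt_0_compat; [apply cond_pos|lra]).
destruct (uniform_continuity_2d_1d' (fun u v => Re (F (circ u v))) 0 (2 * PI) r
  (fun x _ => continuity_2d_circ F r x (H x)) (mkposreal _ He)) as [d Hd].
assert (Hm : (0 < Rmin d d0)%R) by (apply Rmin_pos; [apply cond_pos|exact Hd0]).
exists (mkposreal _ Hm). intros s Hs.
change (Rabs (s - r) < Rmin d d0)%R in Hs.
assert (Hs1 : (Rabs (s - r) < d)%R) by (eapply Rlt_le_trans; [exact Hs|apply Rmin_l]).
assert (Hs2 : (Rabs (s - r) < d0)%R) by (eapply Rlt_le_trans; [exact Hs|apply Rmin_r]).
assert (EX : forall u, (forall t, ccont F (circ u t)) ->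
  ex_RInt (fun t => Re (F (circ u t))) 0 (2 * PI)).
{ intros u Hu. apply ex_RInt_cont. intros t.
  apply (continuity_pt_2d (fun u v => Re (F (circ u v)))). apply continuity_2d_circ, Hu. }
assert (X1 := EX r H). assert (X2 := EX s (H0 s Hs2)).
assert (EM := RInt_minus (V := R_CompleteNormedModule) _ _ _ _ X2 X1).
match type of EM with _ = minus ?u ?v => change (minus u v) with (u - v)%R in EM end.
rewrite <- EM.
eapply Rle_lt_trans.
- apply (abs_RInt_le_const _ 0 (2 * PI) (e / (4 * PI))%R).
  + lra.
  + apply (ex_RInt_minus (V := R_NormedModule)); assumption.
  + intros t Ht. left. apply Rabs_def2 in Hs1.
    generalize (cond_pos d); intros Hdp. apply (Hd t r t s); try lra.
    replace (t - t)%R with 0%R by ring. rewrite Rabs_R0. exact Hdp.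
- replace ((2 * PI - 0) * (e / (4 * PI)))%R with (e / 2)%R by (field; lra).
  generalize (cond_pos e). lra.
Qed.

(* The integral over the circle of radius [r] has zero [r]-derivative except at the
   two radii [0] and [|z|], where it is still continuous. *)
Lemma RInt_circ_zero (F G : C -> C) (z : C) (R0 : R) :
  F 0 = 0 -> (forall w, (Cmod w < R0)%R -> ccont F w) ->
  (forall w, (Cmod w < R0)%R -> w <> 0 -> w <> z -> der F w (G w) /\ ccont G w) ->
  forall r, (0 <= r < R0)%R -> RInt (fun t => Re (F (circ r t))) 0 (2 * PI) = 0%R.
Proof.
intros F0 HF HG.
set (J := fun r => RInt (fun t => Re (F (circ r t))) 0 (2 * PI)).
assert (J0 : J 0%R = 0%R).
{ unfold J. rewrite (RInt_ext _ (fun _ => 0%R)).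
  - rewrite RInt_const. apply Rmult_0_r.
  - intros t _. replace (circ 0 t) with (RtoC 0) by (unfold circ; apply C_ext; simpl; ring).
    now rewrite F0. }
assert (HC : forall r, (0 <= r < R0)%R -> continuity_pt J r).
{ intros r Hr. apply RInt_circ_continuous.
  - intros t. apply HF. rewrite Cmod_circ, Rabs_right; lra.
  - exists (R0 - r)%R. split; [lra|]. intros s Hs t. apply HF. rewrite Cmod_circ.
    apply Rabs_def2 in Hs. apply Rabs_def1; lra. }
assert (HD : forall r, (0 < r < R0)%R -> r <> Cmod z -> is_derive J r 0%R).
{ intros r Hr Hrz.
  assert (Hdd : exists d, (0 < d)%R /\ forall s, (Rabs (s - r) < d)%R ->
    (0 < s < R0)%R /\ s <> Cmod z).
  { exists (Rmin (Rmin r (R0 - r)) (Rabs (r - Cmod z))). split.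
    - repeat apply Rmin_pos; try lra. apply Rabs_pos_lt. lra.
    - intros s Hs. assert (Hs1 := Rlt_le_trans _ _ _ Hs (Rmin_l _ _)).
      assert (Hs2 := Rlt_le_trans _ _ _ Hs (Rmin_r _ _)).
      assert (Hs3 := Rlt_le_trans _ _ _ Hs1 (Rmin_l _ _)).
      assert (Hs4 := Rlt_le_trans _ _ _ Hs1 (Rmin_r _ _)).
      apply Rabs_def2 in Hs3. apply Rabs_def2 in Hs4. split; [lra|].
      intros E. rewrite E, Rabs_minus_sym in Hs2. lra. }
  destruct Hdd as [d [Hd Hdd]].
  assert (HG' : forall s t, (Rabs (s - r) < d)%R ->
    der F (circ s t) (G (circ s t)) /\ ccont G (circ s t)).
  { intros s t Hs. destruct (Hdd s Hs) as [H1 H2].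
    apply HG.
    - rewrite Cmod_circ, Rabs_right; lra.
    - apply Cmod_pos_neq. rewrite Cmod_circ, Rabs_right; lra.
    - intros E. apply H2. rewrite <- E, Cmod_circ, Rabs_right; lra. }
  assert (HDr : forall s t, (Rabs (s - r) < d)%R ->
    is_derive (fun u => Re (F (circ u t))) s (Re (G (circ s t) * cis t))).
  { intros s t Hs. destruct (is_derive_circ_r s t) as [D1 D2].
    exact (is_derive_path F (fun u => circ u t) s _ _ _ (proj1 (HG' s t Hs)) D1 D2). }
  assert (Hr0 : (Rabs (r - r) < d)%R).
  { replace (r - r)%R with 0%R by ring. now rewrite Rabs_R0. }
  (* The radial derivative of the integrand is the real part of [G * cis], whose integral over a
     full circle vanishes by [RInt_circ_der]. *)
  assert (HI : RInt (fun t => Derive (fun u => Re (F (circ u t))) r) 0 (2 * PI) = 0%R).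
  { rewrite (RInt_ext _ (fun t => Re (G (circ r t) * cis t))).
    - apply is_RInt_unique. apply (RInt_circ_der F G r); [lra|]. intros t. now apply HG'.
    - intros t _. apply is_derive_unique. now apply HDr. }
  rewrite <- HI. apply is_derive_RInt_param.
  - exists (mkposreal d Hd). intros s Hs t _. eexists. apply HDr. exact Hs.
  - intros t _.
    apply continuity_2d_pt_ext_loc with (fun u v => Re (G (circ u v) * cis v)).
    + exists (mkposreal d Hd). intros u v Hu _. symmetry. apply is_derive_unique.
      now apply HDr.
    + apply continuity_2d_circ_cis. now apply HG'.
  - exists (mkposreal d Hd). intros s Hs. apply ex_RInt_cont. intros t.
    apply (continuity_pt_2d (fun u v => Re (F (circ u v)))). apply continuity_2d_circ.
    eapply der_ccont. apply HG'. exact Hs. }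
(* [MVT_gen] asks for the derivative on the open interval and for continuity on the closed one, so
   the exceptional radii may occur as endpoints. *)
assert (HM : forall a b, (0 <= a <= b)%R -> (b < R0)%R ->
  (forall r, (a < r < b)%R -> r <> Cmod z) -> J b = J a).
{ intros a b Hab Hb Hz.
  destruct (MVT_gen J a b (fun _ => 0%R)) as [c [_ Hc]].
  - intros x Hx. rewrite Rmin_left, Rmax_right in Hx by lra. apply HD; [lra|].
    now apply Hz.
  - intros x Hx. rewrite Rmin_left, Rmax_right in Hx by lra. apply HC. lra.
  - lra. }
intros r Hr. change (J r = 0%R). rewrite <- J0. generalize (Cmod_ge_0 z); intros Hz.
destruct (Rle_or_lt r (Cmod z)) as [Hrz|Hrz].
- apply HM; try lra. intros s Hs. lra.
- transitivity (J (Cmod z)); apply HM; try lra; intros s Hs; lra.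
Qed.

(** * Cauchy's formula *)

Definition Cint (g : R -> C) : C :=
  (RInt (fun t => Re (g t)) 0 (2 * PI), RInt (fun t => Im (g t)) 0 (2 * PI)).

Definition pcont (g : R -> C) : Prop :=
  forall t, continuity_pt (fun s => Re (g s)) t /\ continuity_pt (fun s => Im (g s)) t.

Lemma Im_Re (c : C) : Im c = Re (- Ci * c).
Proof. destruct c; simpl; unfold Re, Im; simpl; ring. Qed.

Lemma pcont_circ (F : C -> C) r : (forall t, ccont F (circ r t)) ->
  pcont (fun t => F (circ r t)).
Proof.
intros H t. split.
- apply (continuity_pt_2d (fun u v => Re (F (circ u v)))). now apply continuity_2d_circ.
- apply continuity_pt_ext with (fun s => Re (- Ci * F (circ r s))).
  + intros s. now rewrite <- Im_Re.
  + apply (continuity_pt_2d (fun u v => Re (- Ci * F (circ u v)))).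
    apply (continuity_2d_circ (fun w => - Ci * F w)).
    apply ccont_mult; [apply ccont_const|apply H].
Qed.

Lemma Cint_plus g h : pcont g -> pcont h -> Cint (fun t => g t + h t) = Cint g + Cint h.
Proof.
intros Hg Hh. apply C_ext; simpl.
- rewrite (RInt_ext _ (fun t => Re (g t) + Re (h t))%R) by (intros; apply re_plus).
  apply (RInt_plus (V := R_CompleteNormedModule)); apply ex_RInt_cont; intros; apply Hg || apply Hh.
- rewrite (RInt_ext _ (fun t => Im (g t) + Im (h t))%R) by (intros; apply im_plus).
  apply (RInt_plus (V := R_CompleteNormedModule)); apply ex_RInt_cont; intros; apply Hg || apply Hh.
Qed.

Lemma Cint_scal c g : pcont g -> Cint (fun t => c * g t) = c * Cint g.
Proof.
intros Hg.
assert (X1 : ex_RInt (fun t => Re (g t)) 0 (2 * PI)) by (apply ex_RInt_cont, Hg).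
assert (X2 : ex_RInt (fun t => Im (g t)) 0 (2 * PI)) by (apply ex_RInt_cont, Hg).
assert (S : forall k f, ex_RInt f 0 (2 * PI) ->
  ex_RInt (fun t => k * f t)%R 0 (2 * PI) /\
  RInt (fun t => k * f t)%R 0 (2 * PI) = (k * RInt f 0 (2 * PI))%R).
{ intros k f Hf. split.
  - exact (ex_RInt_scal (V := R_NormedModule) f 0 (2 * PI) k Hf).
  - exact (RInt_scal (V := R_CompleteNormedModule) f 0 (2 * PI) k Hf). }
destruct (S (Re c) _ X1) as [Y1 Z1]. destruct (S (Im c) _ X2) as [Y2 Z2].
destruct (S (Re c) _ X2) as [Y3 Z3]. destruct (S (Im c) _ X1) as [Y4 Z4].
apply C_ext.
- rewrite re_mult. simpl. rewrite <- Z1, <- Z2.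
  rewrite (RInt_ext _ (fun t => Re c * Re (g t) - Im c * Im (g t))%R)
    by (intros; apply re_mult).
  exact (RInt_minus (V := R_CompleteNormedModule) _ _ _ _ Y1 Y2).
- rewrite im_mult. simpl. rewrite <- Z3, <- Z4.
  rewrite (RInt_ext _ (fun t => Re c * Im (g t) + Im c * Re (g t))%R)
    by (intros; apply im_mult).
  exact (RInt_plus (V := R_CompleteNormedModule) _ _ _ _ Y3 Y4).
Qed.

Lemma Cint_const (c : C) : Cint (fun _ => c) = RtoC (2 * PI) * c.
Proof.
apply C_ext; simpl; rewrite RInt_const; unfold scal; simpl; unfold mult; simpl; unfold Re, Im; ring.
Qed.

(** The constant is [4 * PI] because real and imaginary parts are bounded separately. *)
Lemma Cint_bound g M : pcont g -> (forall t, (Cmod (g t) <= M)%R) ->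
  (Cmod (Cint g) <= 4 * PI * M)%R.
Proof.
intros Hg HM. generalize PI_RGT_0; intros HPI.
eapply Rle_trans; [apply Cmod_le_re_im|]. simpl.
assert (A : (Rabs (RInt (fun t => Re (g t)) 0 (2 * PI)) <= (2 * PI - 0) * M)%R).
{ apply abs_RInt_le_const; [lra|apply ex_RInt_cont, Hg|].
  intros t _. eapply Rle_trans; [apply re_le_Cmod|apply HM]. }
assert (B : (Rabs (RInt (fun t => Im (g t)) 0 (2 * PI)) <= (2 * PI - 0) * M)%R).
{ apply abs_RInt_le_const; [lra|apply ex_RInt_cont, Hg|].
  intros t _. eapply Rle_trans; [apply im_le_Cmod|apply HM]. }
lra.
Qed.

Lemma Cint_circ_zero (F G : C -> C) (z : C) (R0 : R) :
  F 0 = 0 -> (forall w, (Cmod w < R0)%R -> ccont F w) ->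
  (forall w : C, (Cmod w < R0)%R -> w <> 0 -> w <> z -> der F w (G w) /\ ccont G w) ->
  forall r, (0 <= r < R0)%R -> Cint (fun t => F (circ r t)) = 0.
Proof.
intros F0 HF HG r Hr. apply C_ext; simpl.
- now apply (RInt_circ_zero F G z R0).
- rewrite (RInt_ext _ (fun t => Re (- Ci * F (circ r t)))) by (intros; apply Im_Re).
  apply (RInt_circ_zero (fun w => - Ci * F w) (fun w => - Ci * G w) z R0); [| | |exact Hr].
  + rewrite F0. ring.
  + intros w Hw. apply ccont_mult; [apply ccont_const|now apply HF].
  + intros w H1 H2 H3. destruct (HG w H1 H2 H3) as [D1 D2]. split.
    * now apply der_scal.
    * apply ccont_mult; [apply ccont_const|exact D2].
Qed.

Lemma der_pow k z : der (fun w => w ^ k) z (RtoC (INR k) * z ^ (pred k)).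
Proof.
induction k as [|k IH].
- simpl. replace (0 * 1) with (RtoC 0) by ring. apply der_const.
- replace (RtoC (INR (S k)) * z ^ (pred (S k))) with
    (1 * z ^ k + z * (RtoC (INR k) * z ^ (pred k))).
  + apply (der_mult (fun w => w) (fun w => w ^ k)); [apply der_id|exact IH].
  + rewrite S_INR, RtoC_plus. destruct k as [|k]; simpl; ring.
Qed.

Lemma ccont_pow f k z : ccont f z -> ccont (fun w => f w ^ k) z.
Proof.
intros H. induction k as [|k IH]; simpl; [apply ccont_const|now apply ccont_mult].
Qed.

Lemma circ_neq_0 r t : (0 < r)%R -> circ r t <> 0.
Proof. intros H. apply Cmod_pos_neq. rewrite Cmod_circ, Rabs_right; lra. Qed.

(** Since [dt = dz / (i z)], this is the integral of a multiple of [z^(-(N+2))], which has a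
    primitive off 0; exponent 0 would give [2 * PI] instead. *)
Lemma Cint_inv_pow (r : R) (N : nat) : (0 < r)%R ->
  Cint (fun t => (/ circ r t) ^ S N) = 0.
Proof.
intros Hr.
assert (HI : forall c : C, c <> 0 ->
  RInt (fun t => Re (c * (/ circ r t) ^ S N)) 0 (2 * PI) = 0%R).
{ intros c Hc. set (k := - c * / RtoC (INR (S N))).
  assert (HN : RtoC (INR (S N)) <> 0).
  { intros E. apply RtoC_inj in E. revert E. apply not_0_INR. discriminate. }
  assert (Hr0 : RtoC r <> 0).
  { intros E. apply RtoC_inj in E. lra. }
  apply is_RInt_unique.
  refine (is_RInt_ext _ _ _ _ _ _ (RInt_circ_der
    (fun w => RtoC r * k * (/ w) ^ S N)
    (fun w => RtoC r * k * ((RtoC (INR (S N)) * (/ w) ^ N) * - (/ w * / w))) r _ _)).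
  - intros t _. f_equal.
    assert (Ec : RtoC r * cis t = circ r t) by (symmetry; apply circ_cis).
    transitivity (k * (RtoC (INR (S N)) * (/ circ r t) ^ N *
       - (/ circ r t * / circ r t)) * (RtoC r * cis t)); [ring|].
    rewrite Ec. unfold k. simpl Cpow. field. repeat split; auto. now apply circ_neq_0.
  - lra.
  - intros t. split.
    + apply der_scal. apply (der_comp (fun v => v ^ S N) (fun w => / w)).
      * apply der_Cinv. now apply circ_neq_0.
      * exact (der_pow (S N) (/ circ r t)).
    + assert (Hi : ccont (fun w => / w) (circ r t)).
      { apply ccont_inv; [apply ccont_id|now apply circ_neq_0]. }
      apply ccont_mult; [apply ccont_const|]. apply ccont_mult.
      * apply ccont_mult; [apply ccont_const|]. now apply ccont_pow.
      * apply ccont_opp. now apply ccont_mult. }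
apply C_ext.
- change (RInt (fun t => Re ((/ circ r t) ^ S N)) 0 (2 * PI) = 0%R).
  etransitivity; [|apply (HI 1 C1_nz)]. apply RInt_ext. intros t _. now rewrite Cmult_1_l.
- change (RInt (fun t => Im ((/ circ r t) ^ S N)) 0 (2 * PI) = 0%R).
  etransitivity; [|apply (HI (- Ci))].
  + apply RInt_ext. intros t _. apply Im_Re.
  + intros E. apply Ci_nz. replace Ci with (- - Ci) by ring. rewrite E. ring.
Qed.

Lemma Cconv_eps (a : nat -> C) (l : C) :
  (forall e, (0 < e)%R -> exists N, forall n, (N <= n)%nat ->
    (Cmod (sum_n (G := C_NormedModule) a n - l) < e)%R) -> Cconv a l.
Proof.
intros H P HP. apply locally_near in HP. destruct HP as [e [He HP]].
destruct (H e He) as [N HN]. exists N. intros n Hn. apply HP. now apply HN.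
Qed.

(** The punctured point is allowed because the integrand in Cauchy's formula,
    [w (f w - f z) / (w - z)], vanishes at the centre. *)
Lemma power_series_of_der (f f1 : C -> C) (R0 : R) : (0 < R0)%R -> ccont f 0 ->
  (forall w : C, (Cmod w < R0)%R -> w <> 0 -> der f w (f1 w) /\ ccont f1 w) ->
  exists a r, (0 < r)%R /\ geom_bounded a r /\
    forall z, (Cmod z < r)%R -> f z = CPSeries a z.
Proof.
intros HR0 Hf0 Hf. generalize PI_RGT_0; intros HPI.
assert (HPI2 : RtoC (2 * PI) <> 0).
{ intros E. apply RtoC_inj in E. lra. }
destruct (Hf0 1%R ltac:(lra)) as [d [Hd Hbd]].
(* The circle is small enough for continuity at 0 to bound [f] by [Cmod (f 0) + 1] on the closed
   disc. *)
set (r := (Rmin R0 d / 2)%R).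
assert (Hr : (0 < r)%R).
{ unfold r. generalize (Rmin_pos _ _ HR0 Hd). lra. }
assert (HrR : (r < R0)%R) by (unfold r in *; generalize (Rmin_l R0 d); lra).
assert (Hrd : (r < d)%R) by (unfold r in *; generalize (Rmin_r R0 d); lra).
set (M := (Cmod (f 0) + 1)%R).
assert (HM : forall w, (Cmod w <= r)%R -> (Cmod (f w) <= M)%R).
{ intros w Hw. replace (f w) with ((f w - f 0) + f 0) by ring.
  eapply Rle_trans; [apply Cmod_triangle|]. unfold M.
  assert (Cmod (f w - f 0) < 1)%R.
  { apply Hbd. replace (w - 0) with w by ring. lra. }
  lra. }
assert (HM0 : (0 <= M)%R) by (unfold M; generalize (Cmod_ge_0 (f 0)); lra).
assert (Hfc : forall w, (Cmod w < R0)%R -> ccont f w).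
{ intros w Hw. destruct (Ceq_dec w 0) as [->|n]; [exact Hf0|].
  eapply der_ccont. now apply Hf. }
assert (Hmod : forall t, Cmod (circ r t) = r).
{ intros t. rewrite Cmod_circ, Rabs_right; lra. }
assert (Hc0 : forall t, circ r t <> 0) by (intros t; now apply circ_neq_0).
assert (Hic : forall t, ccont (fun w => / w) (circ r t)).
{ intros t. apply ccont_inv; [apply ccont_id|apply Hc0]. }
assert (Hfr : forall t, ccont f (circ r t)).
{ intros t. apply Hfc. rewrite Hmod. exact HrR. }
(* Cauchy's coefficient integrals, written in the angle [t]. *)
set (a := fun k => / RtoC (2 * PI) * Cint (fun t => f (circ r t) * (/ circ r t) ^ k)).
assert (Pk : forall k, pcont (fun t => f (circ r t) * (/ circ r t) ^ k)).
{ intros k. apply (pcont_circ (fun w => f w * (/ w) ^ k)). intros t.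
  apply ccont_mult; [apply Hfr|]. apply ccont_pow, Hic. }
assert (Ha : geom_bounded a r).
{ exists (2 * M)%R. intros k. unfold a.
  rewrite Cmod_mult, Cmod_inv by exact HPI2. rewrite Cmod_R, Rabs_right by lra.
  assert (Hrk : (0 < r ^ k)%R) by (apply pow_lt; lra).
  assert (B : (Cmod (Cint (fun t => (f (circ r t) * (/ circ r t) ^ k)%C)) <=
    4 * PI * (M * / r ^ k))%R).
  { apply Cint_bound; [apply Pk|]. intros t.
    rewrite Cmod_mult, Cmod_pow, Cmod_inv by apply Hc0. rewrite Hmod, pow_inv.
    apply Rmult_le_compat_r; [left; now apply Rinv_0_lt_compat|].
    apply HM. rewrite Hmod. lra. }
  apply Rle_trans with (/ (2 * PI) * (4 * PI * (M * / r ^ k)) * r ^ k)%R.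
  - apply Rmult_le_compat_r; [lra|]. apply Rmult_le_compat_l; [|exact B].
    left. apply Rinv_0_lt_compat. lra.
  - right. field. lra. }
exists a, (r / 4)%R. split; [lra|]. split; [apply geom_bounded_le with r; [lra|exact Ha]|].
assert (Main : forall z : C, z <> 0 -> (Cmod z < r)%R -> f z = CPSeries a z).
{ intros z Hz Hzr.
  (* The difference quotient at [z], made continuous by the value [f1 z]. The extra factor [w] gives
     [F 0 = 0], the value from which the integrals over growing circles start. *)
  set (Q := fun w => if Ceq_dec w z then f1 z else (f w - f z) / (w - z)).
  set (F := fun w => w * Q w).
  assert (HzR : (Cmod z < R0)%R) by lra.
  assert (HQz : ccont Q z).
  { destruct (Hf z HzR Hz) as [D _]. intros e He.
    assert (Qz : Q z = f1 z).
    { unfold Q. destruct (Ceq_dec z z) as [_|n]; [reflexivity|now elim n]. }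
    generalize (D (e/2)%R ltac:(lra)). apply near_imp. intros w Hw. rewrite Qz. unfold Q.
    destruct (Ceq_dec w z) as [E|n].
    - replace (f1 z - f1 z) with (RtoC 0) by ring. now rewrite Cmod_0.
    - assert (Hn : w - z <> 0) by now apply Cminus_eq_contra.
      assert (Hp : (0 < Cmod (w - z))%R) by now apply Cmod_gt_0.
      replace ((f w - f z) / (w - z) - f1 z) with ((f w - f z - f1 z * (w - z)) / (w - z))
        by (field; exact Hn).
      rewrite Cmod_div by exact Hn.
      apply Rle_lt_trans with (e / 2 * Cmod (w - z) / Cmod (w - z))%R.
      { apply Rmult_le_compat_r; [left; now apply Rinv_0_lt_compat|exact Hw]. }
      replace (e / 2 * Cmod (w - z) / Cmod (w - z))%R with (e/2)%R by (field; lra). lra. }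
  assert (Hne : forall w, w <> z -> near w (fun v => (f v - f z) * / (v - z) = Q v)).
  { intros w Hw.
    assert (Hn : near w (fun v => v - z <> 0)).
    { apply (ccont_neq0 (fun v => v - z)).
      - apply ccont_minus; [apply ccont_id|apply ccont_const].
      - now apply Cminus_eq_contra. }
    revert Hn. apply near_imp. intros v Hv. unfold Q.
    destruct (Ceq_dec v z) as [E|n]; [|reflexivity].
    elim Hv. rewrite E. ring. }
  assert (HQc : forall w, w <> z -> (Cmod w < R0)%R -> ccont Q w).
  { intros w Hw HwR. apply ccont_ext_loc with (fun v => (f v - f z) * / (v - z)).
    - now apply Hne.
    - apply ccont_mult.
      + apply ccont_minus; [now apply Hfc|apply ccont_const].
      + apply ccont_inv; [|now apply Cminus_eq_contra].
        apply ccont_minus; [apply ccont_id|apply ccont_const]. }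
  assert (HFc : forall w, (Cmod w < R0)%R -> ccont F w).
  { intros w Hw. apply ccont_mult; [apply ccont_id|].
    destruct (Ceq_dec w z) as [->|n]; [exact HQz|now apply HQc]. }
  (* Cauchy's formula in disguise: away from 0 and [z] the function [F] has a continuous derivative,
     and it is continuous at these two points. *)
  assert (I0 : Cint (fun t => F (circ r t)) = 0).
  { apply (Cint_circ_zero F (fun w => 1 * Q w + w *
       ((f1 w + 0) * / (w - z) + (f w + - f z) * (- (/ (w - z) * / (w - z)) * (1 + 0)))) z R0).
    - unfold F. ring.
    - exact HFc.
    - intros w Hw H0 Hwz. destruct (Hf w Hw H0) as [D1 D2].
      assert (Hn : w - z <> 0) by now apply Cminus_eq_contra.
      assert (Cn : ccont (fun v => / (v - z)) w).
      { apply ccont_inv; [|exact Hn]. apply ccont_minus; [apply ccont_id|apply ccont_const]. }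
      split.
      + unfold F. apply (der_mult (fun v => v) Q); [apply der_id|].
        eapply der_ext_loc; [apply Hne; exact Hwz|].
        apply (der_mult (fun v => f v + - f z) (fun v => / (v - z))).
        * apply der_plus; [exact D1|apply der_const].
        * apply (der_inv (fun v => v + - z)); [|exact Hn].
          apply der_plus; [apply der_id|apply der_const].
      + apply ccont_plus.
        * apply ccont_mult; [apply ccont_const|now apply HQc].
        * apply ccont_mult; [apply ccont_id|]. apply ccont_plus.
          -- apply ccont_mult; [|exact Cn]. apply ccont_plus; [exact D2|apply ccont_const].
          -- apply ccont_mult.
             ++ apply ccont_plus; [now apply Hfc|apply ccont_const].
             ++ apply ccont_mult; [|apply ccont_const].
                apply ccont_opp. now apply ccont_mult.
    - lra. }
  set (G := fun N t => z ^ N * ((/ circ r t) ^ N * F (circ r t))).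
  assert (PG : forall N, pcont (fun t => (/ circ r t) ^ N * F (circ r t))).
  { intros N. apply (pcont_circ (fun w => (/ w) ^ N * F w)). intros t.
    apply ccont_mult; [apply ccont_pow, Hic|]. apply HFc. rewrite Hmod. lra. }
  assert (PP : forall N, pcont (fun t => (/ circ r t) ^ N)).
  { intros N. apply (pcont_circ (fun w => (/ w) ^ N)). intros t. apply ccont_pow, Hic. }
  assert (Hcz : forall t, circ r t <> z).
  { intros t E. rewrite <- E, Hmod in Hzr. lra. }
  set (I := fun N => Cint (fun t => (/ circ r t) ^ N * F (circ r t))).
  (* From [w / (w - z) = 1 + (z / w) * (w / (w - z))]: one step of the geometric expansion of
     Cauchy's kernel. Finitely many such steps leave an explicit remainder, so sum and integral are
     never exchanged. *)
  assert (Step : forall N, I N = RtoC (2 * PI) * a N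
     - f z * Cint (fun t => (/ circ r t) ^ N) + z * I (S N)).
  { intros N. unfold I. rewrite <- (Cint_scal z _ (PG (S N))).
    replace (RtoC (2 * PI) * a N) with (Cint (fun t => f (circ r t) * (/ circ r t) ^ N))
      by (unfold a; field; exact HPI2).
    unfold Cminus. replace (- (f z * Cint (fun t => (/ circ r t) ^ N)))
      with ((- f z) * Cint (fun t => (/ circ r t) ^ N)) by ring.
    assert (SC : forall c g, pcont g -> pcont (fun t => c * g t)).
    { intros c g Hg t. destruct (Hg t) as [G1 G2]. split.
      - apply continuity_pt_ext with (fun s => Re c * Re (g s) - Im c * Im (g s))%R.
        + intros s. now rewrite re_mult.
        + apply continuity_pt_minus; apply continuity_pt_scal; assumption.
      - apply continuity_pt_ext with (fun s => Re c * Im (g s) + Im c * Re (g s))%R.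
        + intros s. now rewrite im_mult.
        + apply continuity_pt_plus; apply continuity_pt_scal; assumption. }
    assert (PL : forall g h, pcont g -> pcont h -> pcont (fun t => g t + h t)).
    { intros g h Hg Hh t. destruct (Hg t) as [G1 G2], (Hh t) as [H1 H2]. split.
      - apply continuity_pt_ext with (fun s => Re (g s) + Re (h s))%R.
        + intros s. now rewrite re_plus.
        + now apply continuity_pt_plus.
      - apply continuity_pt_ext with (fun s => Im (g s) + Im (h s))%R.
        + intros s. now rewrite im_plus.
        + now apply continuity_pt_plus. }
    rewrite <- (Cint_scal (- f z) _ (PP N)).
    rewrite <- (Cint_plus _ _ (Pk N) (SC (- f z) _ (PP N))).
    rewrite <- (Cint_plus _ _ (PL _ _ (Pk N) (SC (- f z) _ (PP N))) (SC z _ (PG (S N)))).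
    f_equal. apply functional_extensionality. intros t. unfold F, Q.
    destruct (Ceq_dec (circ r t) z) as [E|_]; [now elim (Hcz t)|].
    simpl Cpow. field. split; [apply Cminus_eq_contra, Hcz|apply Hc0]. }
  assert (Sum : forall N, sum_n (G := C_NormedModule) (fun k => a k * z ^ k) N =
     f z - / RtoC (2 * PI) * (z ^ S N * I (S N))).
  { induction N as [|N IH].
    - rewrite sum_O. generalize (Step 0%nat).
      replace (Cint (fun t => (/ circ r t) ^ 0)) with (RtoC (2 * PI))
        by (simpl; rewrite Cint_const; ring).
      unfold I at 1. replace (Cint (fun t => (/ circ r t) ^ 0 * F (circ r t))) with (RtoC 0).
      2:{ symmetry. etransitivity; [|exact I0]. f_equal.
        apply functional_extensionality. intros t. simpl. ring. }
      intros E. change (a 0%nat * 1 = f z - / RtoC (2 * PI) * (z * 1 * I 1%nat)).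
      assert (E' : RtoC (2 * PI) * a 0%nat = f z * RtoC (2 * PI) - z * I 1%nat).
      { transitivity (RtoC (2 * PI) * a 0%nat - f z * RtoC (2 * PI) + z * I 1%nat
          + (f z * RtoC (2 * PI) - z * I 1%nat)); [ring|]. rewrite <- E. ring. }
      replace (a 0%nat * 1) with (/ RtoC (2 * PI) * (RtoC (2 * PI) * a 0%nat))
        by (field; exact HPI2).
      rewrite E'. field. exact HPI2.
    - rewrite sum_Sn, IH. generalize (Step (S N)). rewrite (Cint_inv_pow r N Hr). intros ->.
      change (f z - / RtoC (2 * PI) * (z ^ S N * (RtoC (2 * PI) * a (S N) - f z * 0 + z * I (S (S N))))
        + a (S N) * z ^ S N = f z - / RtoC (2 * PI) * (z ^ S (S N) * I (S (S N)))).
      simpl Cpow. field. exact HPI2. }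
  symmetry. apply CSeries_unique. apply Cconv_eps. intros e He.
  set (q := (Cmod z / r)%R). generalize (Cmod_ge_0 z); intros Hz0.
  assert (Hq : (Rabs q < 1)%R).
  { unfold q. rewrite Rabs_right.
    - apply Rmult_lt_reg_r with r; [lra|]. field_simplify; lra.
    - apply Rle_ge, Rmult_le_pos; [lra|]. left. now apply Rinv_0_lt_compat. }
  (* The remainder is at most [K * q ^ S n]: [4 * PI] from [Cint_bound] times [2 * M] for the
     increment of [f], over [2 * PI]. *)
  set (K := (4 * M * r / (r - Cmod z))%R).
  assert (HK : (0 <= K)%R).
  { unfold K. apply Rmult_le_pos; [apply Rmult_le_pos; lra|].
    left. apply Rinv_0_lt_compat. lra. }
  assert (HeK : (0 < e / (K + 1))%R) by (apply Rdiv_lt_0_compat; lra).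
  destruct (pow_lt_1_zero q Hq _ HeK) as [N HN]. exists N. intros n Hn.
  rewrite Sum.
  replace (f z - / RtoC (2 * PI) * (z ^ S n * I (S n)) - f z) with
    (- (/ RtoC (2 * PI) * (z ^ S n * I (S n)))) by ring.
  rewrite Cmod_opp, !Cmod_mult, Cmod_inv, Cmod_R, Cmod_pow by exact HPI2.
  rewrite (Rabs_right (2 * PI)) by lra.
  assert (Hrk : (0 < r ^ S n)%R) by (apply pow_lt; lra).
  assert (BI : (Cmod (I (S n)) <= 4 * PI * (/ r ^ S n * (r * (2 * M / (r - Cmod z)))))%R).
  { apply Cint_bound; [apply PG|]. intros t. unfold F.
    rewrite !Cmod_mult, Cmod_pow, Cmod_inv by apply Hc0. rewrite Hmod, pow_inv.
    apply Rmult_le_compat_l; [left; now apply Rinv_0_lt_compat|].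
    apply Rmult_le_compat_l; [lra|]. unfold Q.
    destruct (Ceq_dec (circ r t) z) as [E|_]; [now elim (Hcz t)|].
    rewrite Cmod_div by (apply Cminus_eq_contra, Hcz).
    assert (B1 : (Cmod (f (circ r t) - f z) <= 2 * M)%R).
    { unfold Cminus. eapply Rle_trans; [apply Cmod_triangle|]. rewrite Cmod_opp.
      assert (Cmod (f (circ r t)) <= M)%R by (apply HM; rewrite Hmod; lra).
      assert (Cmod (f z) <= M)%R by (apply HM; lra). lra. }
    assert (B2 : (r - Cmod z <= Cmod (circ r t - z))%R).
    { generalize (Cmod_rtriangle (circ r t) z). rewrite Hmod. lra. }
    apply Rmult_le_compat; [apply Cmod_ge_0| |exact B1|].
    - left. apply Rinv_0_lt_compat. lra.
    - apply Rinv_le_contravar; lra. }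
  apply Rle_lt_trans with (K * q ^ S n)%R.
  - apply Rle_trans with (/ (2 * PI) * (Cmod z ^ S n *
      (4 * PI * (/ r ^ S n * (r * (2 * M / (r - Cmod z)))))))%R.
    + apply Rmult_le_compat_l; [left; apply Rinv_0_lt_compat; lra|].
      apply Rmult_le_compat_l; [apply pow_le; lra|exact BI].
    + right. unfold K, q, Rdiv. rewrite Rpow_mult_distr, pow_inv. field. lra.
  - assert (Hqn : (Rabs (q ^ S n) < e / (K + 1))%R) by (apply HN; lia).
    apply Rle_lt_trans with (K * Rabs (q ^ S n))%R.
    + apply Rmult_le_compat_l; [exact HK|apply Rle_abs].
    + apply Rle_lt_trans with (K * (e / (K + 1)))%R.
      * apply Rmult_le_compat_l; lra.
      * apply Rmult_lt_reg_r with (K + 1)%R; [lra|]. field_simplify; [nra|lra]. }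
(* The point [z = 0] follows from continuity of both sides. *)
intros z Hz. destruct (Ceq_dec z 0) as [->|n]; [|apply Main; [exact n|lra]].
apply Ceq_minus.
assert (Hcc : ccont (fun w => f w - CPSeries a w) 0).
{ apply ccont_minus; [exact Hf0|]. eapply der_ccont, der_CPSeries; [exact Ha|].
  rewrite Cmod_0. lra. }
apply Cmod_eq_0.
destruct (Rle_lt_or_eq_dec 0 _ (Cmod_ge_0 (f 0 - CPSeries a 0))) as [Hp|E]; [|now symmetry].
exfalso. destruct (near_and _ _ _ (near_ball 0 r Hr) (Hcc _ Hp)) as [d' [Hd' HH]].
destruct (HH (RtoC (d' / 2))) as [H1 H2].
{ replace (RtoC (d'/2) - 0) with (RtoC (d'/2)) by ring. rewrite Cmod_R, Rabs_right; lra. }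
replace (RtoC (d'/2) - 0) with (RtoC (d'/2)) in H1 by ring.
rewrite (Main (RtoC (d'/2))) in H2; [|intros E; apply RtoC_inj in E; lra|exact H1].
match type of H2 with (Cmod ?u < _)%R => replace u with (- (f 0 - CPSeries a 0)) in H2 by ring end.
rewrite Cmod_opp in H2. lra.
Qed.

(** * The subdominant solution of the recurrence *)

(** [trec u v m j] is the value at [j] of the solution of
    [x j = (1 + u j) * x (j+1) + v j * x (j+2)] started from
    [x (j+m) = 1], [x (j+m+1) = 0]. *)
Fixpoint trec (u v : nat -> C) (m j : nat) : C :=
  match m with
  | O => 1
  | S m1 => match m1 with
            | O => 1 + u j
            | S m2 => (1 + u j) * trec u v m1 (S j) + v j * trec u v m2 (S (S j))
            end
  end.

Definition dtrec (u v : nat -> C) (m j : nat) : C := trec u v (S m) j - trec u v m j.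

(** The limit of [trec u v m j] as [m] grows, telescoped from [trec u v 0 j = 1]. *)
Definition subdom (u v : nat -> C) (j : nat) : C := 1 + CSeries (fun m => dtrec u v m j).

Lemma dtrec_0 u v j : dtrec u v 0 j = u j.
Proof. unfold dtrec. simpl. ring. Qed.

Lemma dtrec_1 u v j : dtrec u v 1 j = (1 + u j) * u (S j) + v j.
Proof. unfold dtrec. simpl. ring. Qed.

Lemma dtrec_SS u v m j : dtrec u v (S (S m)) j =
  (1 + u j) * dtrec u v (S m) (S j) + v j * dtrec u v m (S (S j)).
Proof.
unfold dtrec.
change (trec u v (S (S (S m))) j) with
  ((1 + u j) * trec u v (S (S m)) (S j) + v j * trec u v (S m) (S (S j))).
change (trec u v (S (S m)) j) with
  ((1 + u j) * trec u v (S m) (S j) + v j * trec u v m (S (S j))).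
ring.
Qed.

(* [phi] absorbs the product of the factors [1 + 2 gam], and [theta] dominates [gam]
   while having a telescoping sum. *)
Definition gam (K : R) (j : nat) : R := (K / (INR j + 1) ^ 2)%R.
Definition phi (K : R) (j : nat) : R := exp (4 * K / (INR j + 1)).
Definition theta (K : R) (k : nat) : R := (16 * K * (/ (INR k + 1) - / (INR k + 2)))%R.

Lemma gam_nonneg K j : (0 <= K)%R -> (0 <= gam K j)%R.
Proof.
intros H. generalize (pos_INR j). intros Hj. unfold gam. apply Rmult_le_pos; [exact H|].
left. apply Rinv_0_lt_compat, pow_lt. lra.
Qed.

Lemma theta_eq K k : theta K k = (16 * K / ((INR k + 1) * (INR k + 2)))%R.
Proof. generalize (pos_INR k). intros Hk. unfold theta. field. lra. Qed.

Lemma Rdiv_le_cross (a b c d : R) : (0 < b)%R -> (0 < d)%R -> (a * d <= c * b)%R ->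
  (a / b <= c / d)%R.
Proof.
intros Hb Hd H. apply Rmult_le_reg_r with b; [exact Hb|].
apply Rmult_le_reg_r with d; [exact Hd|].
replace (a / b * b * d)%R with (a * d)%R by (field; lra).
replace (c / d * b * d)%R with (c * b)%R by (field; lra). exact H.
Qed.

Lemma theta_nonneg K k : (0 <= K)%R -> (0 <= theta K k)%R.
Proof.
intros H. rewrite theta_eq. generalize (pos_INR k). intros Hk.
apply Rmult_le_pos; [lra|]. left. apply Rinv_0_lt_compat. nra.
Qed.

Lemma exp_le (x y : R) : (x <= y)%R -> (exp x <= exp y)%R.
Proof. intros [H| ->]; [left; now apply exp_increasing|lra]. Qed.

Lemma phi_ge_1 K j : (0 <= K)%R -> (1 <= phi K j)%R.
Proof.
intros H. unfold phi. generalize (pos_INR j). intros Hj.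
assert (0 <= 4 * K / (INR j + 1))%R.
{ apply Rmult_le_pos; [lra|]. left. apply Rinv_0_lt_compat. lra. }
apply exp_le in H0. now rewrite exp_0 in H0.
Qed.

Lemma phi_le_0 K j : (0 <= K)%R -> (phi K j <= exp (4 * K))%R.
Proof.
intros H. unfold phi. apply exp_le. generalize (pos_INR j). intros Hj.
apply Rmult_le_reg_r with (INR j + 1)%R; [lra|].
replace (4 * K / (INR j + 1) * (INR j + 1))%R with (4 * K)%R by (field; lra). nra.
Qed.

(** [1 + 2 gam <= exp (2 gam)], and [2 K / (j+1)^2 <= 4 K (1/(j+1) - 1/(j+2))] because
    [j + 2 <= 2 (j + 1)]; this is the origin of the 4 in [phi]. *)
Lemma phi_step K j : (0 <= K)%R -> ((1 + 2 * gam K j) * phi K (S j) <= phi K j)%R.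
Proof.
intros H. generalize (pos_INR j). intros Hj.
apply Rle_trans with (exp (2 * gam K j) * phi K (S j))%R.
- apply Rmult_le_compat_r; [left; apply exp_pos|].
  destruct (Req_dec (2 * gam K j) 0) as [->|n].
  + rewrite exp_0. lra.
  + left. now apply exp_ineq1.
- unfold phi. rewrite <- exp_plus. apply exp_le. rewrite S_INR. unfold gam.
  apply Rplus_le_reg_r with (- (4 * K / (INR j + 1 + 1)))%R.
  replace (4 * K / (INR j + 1) + - (4 * K / (INR j + 1 + 1)))%R with
    (4 * K / ((INR j + 1) * (INR j + 2)))%R by (field; lra).
  replace (2 * (K / (INR j + 1) ^ 2) + 4 * K / (INR j + 1 + 1) + - (4 * K / (INR j + 1 + 1)))%R
    with (2 * K / (INR j + 1) ^ 2)%R by (field; lra).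
  apply Rdiv_le_cross; [nra|nra|].
  assert (0 <= K * (INR j * (INR j + 1)))%R by (apply Rmult_le_pos; nra). nra.
Qed.

Lemma phi_decr K j : (0 <= K)%R -> (phi K (S j) <= phi K j)%R.
Proof.
intros H. eapply Rle_trans; [|now apply phi_step].
generalize (gam_nonneg K j H) (phi_ge_1 K (S j) H). intros. nra.
Qed.

Lemma theta_0 K j : (0 <= K)%R -> (gam K j <= theta K j)%R.
Proof.
intros H. rewrite theta_eq. unfold gam. generalize (pos_INR j). intros Hj.
apply Rdiv_le_cross; [nra|nra|].
assert (0 <= K * ((INR j + 1) * (15 * INR j + 14)))%R by (apply Rmult_le_pos; nra). nra.
Qed.

(** Serves the case [m = 1] of [c11_dtrec]. The two terms are at most 2 and 6 times
    [K / ((j+2) (j+3))], the second with equality at [j = 0]; the 16 in [theta] accommodates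
    both. *)
Lemma theta_1 K j : (0 <= K)%R -> (gam K (S j) + gam K j <= theta K (S j))%R.
Proof.
intros H. rewrite theta_eq. unfold gam. rewrite S_INR. generalize (pos_INR j). intros Hj.
assert (A : (K / (INR j + 1 + 1) ^ 2 <= 2 * K / ((INR j + 1 + 1) * (INR j + 1 + 2)))%R).
{ apply Rdiv_le_cross; [nra|nra|].
  assert (0 <= K * ((INR j + 2) * (INR j + 1)))%R by (apply Rmult_le_pos; nra). nra. }
assert (B : (K / (INR j + 1) ^ 2 <= 6 * K / ((INR j + 1 + 1) * (INR j + 1 + 2)))%R).
{ apply Rdiv_le_cross; [nra|nra|].
  assert (0 <= K * (5 * INR j ^ 2 + 7 * INR j))%R by (apply Rmult_le_pos; nra). nra. }
assert (E : (2 * K / ((INR j + 1 + 1) * (INR j + 1 + 2)) + 6 * K / ((INR j + 1 + 1) * (INR j + 1 + 2))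
  = 8 * K / ((INR j + 1 + 1) * (INR j + 1 + 2)))%R) by (field; lra).
assert (D : (8 * K / ((INR j + 1 + 1) * (INR j + 1 + 2)) <= 16 * K / ((INR j + 1 + 1) * (INR j + 1 + 2)))%R).
{ apply Rmult_le_compat_r; [left; apply Rinv_0_lt_compat; nra|lra]. }
lra.
Qed.

Lemma is_series_theta K j :
  is_series (fun m => theta K (j + m)) (16 * K / (INR j + 1))%R.
Proof.
change (is_lim_seq (sum_n (fun m => theta K (j + m))) (Finite (16 * K / (INR j + 1)))).
apply (is_lim_seq_ext (fun n => 16 * K / (INR j + 1) - 16 * K * / INR (S (S (j + n))))%R).
- intros n. induction n as [|n IH].
  + rewrite sum_O. unfold theta. rewrite Nat.add_0_r, !S_INR.
    generalize (pos_INR j). intros. field. lra.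
  + rewrite sum_Sn, <- IH. change plus with Rplus. unfold theta.
    replace (j + S n)%nat with (S (j + n)) by lia. rewrite !S_INR.
    generalize (pos_INR (j + n)) (pos_INR j). intros. field. lra.
- replace (Finite (16 * K / (INR j + 1))) with (Finite (16 * K / (INR j + 1) - 16 * K * 0)%R)
    by (f_equal; ring).
  apply is_lim_seq_minus'; [apply is_lim_seq_const|].
  apply (is_lim_seq_scal_l _ (16 * K)%R 0%R).
  apply (is_lim_seq_ext (fun n => / INR (n + (j + 2)))%R).
  + intros n. do 2 f_equal. lia.
  + apply (is_lim_seq_incr_n (fun n => / INR n)%R).
    replace (Finite 0) with (Rbar_inv p_infty) by reflexivity.
    apply is_lim_seq_inv; [apply is_lim_seq_INR|discriminate].
Qed.

Lemma is_series_phi_theta K j :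
  is_series (fun m => phi K j * theta K (j + m))%R (phi K j * (16 * K / (INR j + 1)))%R.
Proof. apply (is_series_scal (V := R_NormedModule)). apply is_series_theta. Qed.

Section Dependence.

Context {T : NormedModule C_AbsRing} (e : R) (B : T -> Prop) (u v : nat -> T -> C) (K : R).
Context (He : (0 < e)%R) (HK : (0 <= K)%R).
Context (Hu : forall j, c11 e B (u j) (gam K j)).
Context (Hv : forall j, c11 e B (v j) (gam K j)).

(** Two-step induction on [m]. In [dtrec_SS] the sums [S j + S m] and [S (S j) + m] coincide, so
    [theta] is a common factor, and [phi_step] absorbs [1 + gam] together with the further [gam] of
    the [v] term. *)
Lemma c11_dtrec m j :
  c11 e B (fun q => dtrec (fun i => u i q) (fun i => v i q) m j) (phi K j * theta K (j + m)).
Proof.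
assert (He0 : (0 <= e)%R) by lra.
assert (H1u : forall j, c11 e B (fun q => 1 + u j q) (1 + gam K j)).
{ intros i. apply c11_plus; [|apply Hu]. apply c11_le with (Cmod 1); [rewrite Cmod_1; lra|].
  apply c11_const. }
revert j.
assert (P : forall m, (forall j, c11 e B (fun q => dtrec (fun i => u i q) (fun i => v i q) m j)
    (phi K j * theta K (j + m))) /\
  (forall j, c11 e B (fun q => dtrec (fun i => u i q) (fun i => v i q) (S m) j)
    (phi K j * theta K (j + S m)))).
{ clear m. induction m as [|m [IH1 IH2]].
  - split; intros j.
    + apply c11_ext with (u j); [intros q _; now rewrite dtrec_0|].
      apply c11_le with (gam K j); [|apply Hu]. rewrite Nat.add_0_r.
      generalize (phi_ge_1 K j HK) (theta_0 K j HK) (theta_nonneg K j HK). intros. nra.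
    + apply c11_ext with (fun q => (1 + u j q) * u (S j) q + v j q);
        [intros q _; now rewrite dtrec_1|].
      apply c11_le with ((1 + gam K j) * gam K (S j) + gam K j)%R.
      * replace (j + 1)%nat with (S j) by lia.
        assert (H1 : (1 + gam K j <= phi K j)%R).
        { generalize (phi_step K j HK) (gam_nonneg K j HK) (phi_ge_1 K (S j) HK). intros. nra. }
        generalize (theta_1 K j HK) (gam_nonneg K j HK) (gam_nonneg K (S j) HK)
          (phi_ge_1 K j HK). intros. nra.
      * apply c11_plus; [|apply Hv]. apply c11_mult; auto.
  - split; [exact IH2|]. intros j.
    apply c11_ext with (fun q => (1 + u j q) * dtrec (fun i => u i q) (fun i => v i q) (S m) (S j)
       + v j q * dtrec (fun i => u i q) (fun i => v i q) m (S (S j)));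
      [intros q _; now rewrite dtrec_SS|].
    apply c11_le with ((1 + gam K j) * (phi K (S j) * theta K (S j + S m)) +
      gam K j * (phi K (S (S j)) * theta K (S (S j) + m)))%R.
    + replace (S j + S m)%nat with (j + S (S m))%nat by lia.
      replace (S (S j) + m)%nat with (j + S (S m))%nat by lia.
      generalize (theta_nonneg K (j + S (S m)) HK). set (th := theta K (j + S (S m))). intros Ht.
      generalize (phi_step K j HK) (phi_decr K (S j) HK) (gam_nonneg K j HK)
        (phi_ge_1 K (S (S j)) HK). intros Q1 Q2 Q3 Q4.
      apply Rle_trans with (((1 + 2 * gam K j) * phi K (S j)) * th)%R.
      * assert (gam K j * (phi K (S (S j)) * th) <= gam K j * (phi K (S j) * th))%R.
        { apply Rmult_le_compat_l; [exact Q3|]. now apply Rmult_le_compat_r. }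
        lra.
      * now apply Rmult_le_compat_r.
    + apply c11_plus; apply c11_mult; auto. }
apply P.
Qed.

Definition subdom_bound : R := (1 + exp (4 * K) * (16 * K))%R.

Lemma c11_subdom j :
  c11 e B (fun q => subdom (fun i => u i q) (fun i => v i q) j) subdom_bound.
Proof.
apply c11_le with (1 + phi K j * (16 * K / (INR j + 1)))%R.
- unfold subdom_bound. apply Rplus_le_compat_l.
  generalize (pos_INR j) (phi_le_0 K j HK) (phi_ge_1 K j HK). intros Hj H1 H2.
  apply Rmult_le_compat; [lra| |lra|].
  + apply Rmult_le_pos; [lra|]. left. apply Rinv_0_lt_compat. lra.
  + apply Rmult_le_reg_r with (INR j + 1)%R; [lra|].
    replace (16 * K / (INR j + 1) * (INR j + 1))%R with (16 * K)%R by (field; lra). nra.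
- unfold subdom. apply c11_plus.
  + apply c11_le with (Cmod 1); [rewrite Cmod_1; lra|]. apply c11_const.
  + rewrite <- (is_series_unique _ _ (is_series_phi_theta K j)).
    apply (c11_series e B (fun m q => dtrec (fun i => u i q) (fun i => v i q) m j)).
    * exact He.
    * intros m. apply c11_dtrec.
    * eexists. apply is_series_phi_theta.
Qed.

End Dependence.

Section Scalar.

Context (u v : nat -> C) (K : R).
Context (HK : (0 <= K)%R).
Context (Hu : forall j, (Cmod (u j) <= gam K j)%R).
Context (Hv : forall j, (Cmod (v j) <= gam K j)%R).

(** A scalar is a constant function whose norm is its modulus, so the estimate with parameters
    contains the pointwise one. *)
Lemma Cmod_dtrec m j : (Cmod (dtrec u v m j) <= phi K j * theta K (j + m))%R.
Proof.
refine (c11_sup (V := C_NormedModule) 1 (fun _ => True) (fun _ => dtrec u v m j) _ (RtoC 0)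
  _ _ I); [lra|].
apply (c11_dtrec 1 (fun _ => True) (fun j _ => u j) (fun j _ => v j)).
- lra.
- exact HK.
- intros i. eapply c11_le; [apply Hu|apply c11_const].
- intros i. eapply c11_le; [apply Hv|apply c11_const].
Qed.

Lemma Cconv_dtrec j : Cconv (fun m => dtrec u v m j) (subdom u v j - 1).
Proof.
unfold subdom.
replace (1 + CSeries (fun m => dtrec u v m j) - 1) with (CSeries (fun m => dtrec u v m j)) by ring.
apply Cconv_CSeries with (fun m => phi K j * theta K (j + m))%R.
- intros m. apply Cmod_dtrec.
- eexists. apply is_series_phi_theta.
Qed.

(** Summation of [dtrec_SS] over [m]. It covers the terms from the third on; the first two, [u j]
    and [(1 + u j) * u (S j) + v j], supply the constants split off when [subdom] is written as 1
    plus a series. *)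
Lemma subdom_rec j : subdom u v j = (1 + u j) * subdom u v (S j) + v j * subdom u v (S (S j)).
Proof.
assert (H : Cconv (fun m => dtrec u v m j)
  ((1 + u j) * (subdom u v (S j) - 1 - u (S j)) + v j * (subdom u v (S (S j)) - 1)
   + ((1 + u j) * u (S j) + v j) + u j)).
{ apply Cconv_decr_1. apply Cconv_decr_1. rewrite dtrec_0, dtrec_1.
  match goal with |- Cconv _ ?w => replace w with
    ((1 + u j) * (subdom u v (S j) - 1 - u (S j)) + v j * (subdom u v (S (S j)) - 1)) by ring end.
  apply (Cconv_ext (fun m => (1 + u j) * dtrec u v (S m) (S j) + v j * dtrec u v m (S (S j)))).
  - intros m. now rewrite dtrec_SS.
  - apply Cconv_plus; apply Cconv_scal; [|apply Cconv_dtrec].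
    rewrite <- (dtrec_0 u v (S j)).
    exact (Cconv_incr_1 (fun m => dtrec u v m (S j)) _ (Cconv_dtrec (S j))). }
assert (E := Cconv_unique _ _ _ (Cconv_dtrec j) H).
replace (subdom u v j) with (subdom u v j - 1 + 1) by ring. rewrite E. ring.
Qed.

Lemma subdom_near_1 j : (Cmod (subdom u v j - 1) <= exp (4 * K) * (16 * K) / (INR j + 1))%R.
Proof.
eapply Rle_trans.
- apply (Cconv_bound _ _ _ (Cconv_dtrec j) (fun m => Cmod_dtrec m j)).
  eexists. apply is_series_phi_theta.
- rewrite (is_series_unique _ _ (is_series_phi_theta K j)).
  generalize (pos_INR j) (phi_le_0 K j HK). intros Hj H1.
  replace (exp (4 * K) * (16 * K) / (INR j + 1))%R with
    (exp (4 * K) * (16 * K / (INR j + 1)))%R by (field; lra).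
  apply Rmult_le_compat_r; [|exact H1].
  apply Rmult_le_pos; [|left; apply Rinv_0_lt_compat]; lra.
Qed.

(** Single values may vanish, but the sequence tends to 1; an index [n] with [n + 1 > L] is large
    enough. *)
Lemma subdom_neq_0 : exists j, subdom u v j <> 0.
Proof.
set (L := (exp (4 * K) * (16 * K))%R).
assert (HL : (0 <= L)%R).
{ apply Rmult_le_pos; [left; apply exp_pos|lra]. }
destruct (nfloor_ex L HL) as [n Hn]. exists n. intros E.
generalize (subdom_near_1 n). fold L. rewrite E.
replace (0 - 1) with (- (1)) by ring. rewrite Cmod_m1. intros H.
generalize (pos_INR n). intros Hp.
assert (H2 : (INR n + 1 <= L)%R); [|lra].
apply (Rmult_le_compat_r (INR n + 1)%R) in H; [|lra].
replace (L / (INR n + 1) * (INR n + 1))%R with L in H by (field; lra). lra.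
Qed.

End Scalar.

(** * Weighted solutions: growth and uniqueness *)

Fixpoint cprod (k : nat -> C) (j : nat) : C :=
  match j with O => 1 | S i => k i * cprod k i end.

Lemma cprod_neq_0 (k : nat -> C) j : (forall i, k i <> 0) -> cprod k j <> 0.
Proof. intros H. induction j as [|j IH]; simpl; [exact C1_nz|apply Cmult_neq_0; auto]. Qed.

Definition rcoef (k u v : nat -> C) (j : nat) : C := cprod k j * subdom u v j.

Lemma c11_rcoef {T : NormedModule C_AbsRing} (e : R) (B : T -> Prop) (k u v : nat -> T -> C) (K : R) j :
  (0 < e)%R -> (0 <= K)%R -> (forall j, c11 e B (k j) (K / (INR j + 1))) ->
  (forall j, c11 e B (u j) (gam K j)) -> (forall j, c11 e B (v j) (gam K j)) ->
  c11 e B (fun q => rcoef (fun i => k i q) (fun i => u i q) (fun i => v i q) j)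
    (K ^ j / INR (fact j) * subdom_bound K).
Proof.
intros He HK Hk Hu Hv. unfold rcoef. apply c11_mult; [lra| |now apply c11_subdom].
induction j as [|j IH].
- simpl. apply c11_le with (Cmod 1); [rewrite Cmod_1; lra|]. apply c11_const.
- simpl cprod. apply c11_le with (K / (INR j + 1) * (K ^ j / INR (fact j)))%R.
  + right. rewrite fact_simpl, mult_INR, S_INR. simpl pow.
    generalize (pos_INR j) (INR_fact_neq_0 j). intros. field. split; [assumption|lra].
  + apply c11_mult; auto. lra.
Qed.

(** The product of the weights is at most [K^j / j!], so up to [subdom_bound K] the quantity to
    bound is a term of the exponential series at [K * r], whatever [r] is: this makes the solution
    entire. *)
Lemma rcoef_geom_bounded k u v K r : (0 <= K)%R -> (forall j, (Cmod (k j) <= K / (INR j + 1))%R) ->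
  (forall j, (Cmod (u j) <= gam K j)%R) -> (forall j, (Cmod (v j) <= gam K j)%R) ->
  (0 <= r)%R -> geom_bounded (rcoef k u v) r.
Proof.
intros HK Hk Hu Hv Hr.
assert (HS : (0 <= subdom_bound K)%R).
{ unfold subdom_bound. assert (0 <= exp (4 * K) * (16 * K))%R; [|lra].
  apply Rmult_le_pos; [left; apply exp_pos|lra]. }
assert (HX : is_series (fun n => (K * r) ^ n * / INR (fact n))%R (exp (K * r))).
{ generalize (is_exp_Reals (K * r)). intros H. apply is_pseries_R in H.
  revert H. apply is_series_ext. intros n. apply Rmult_comm. }
exists (exp (K * r) * subdom_bound K)%R. intros j.
assert (H1 : (Cmod (rcoef k u v j) <= K ^ j / INR (fact j) * subdom_bound K)%R).
{ refine (c11_sup (V := C_NormedModule) 1 (fun _ => True) (fun _ => rcoef k u v j) _ (RtoC 0)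
    _ _ I); [lra|].
  apply (c11_rcoef 1 (fun _ => True) (fun j _ => k j) (fun j _ => u j) (fun j _ => v j));
    [lra|exact HK| | |]; intros i; (eapply c11_le; [|apply c11_const]); auto. }
eapply Rle_trans; [apply Rmult_le_compat_r; [now apply pow_le|exact H1]|].
replace (K ^ j / INR (fact j) * subdom_bound K * r ^ j)%R with
  ((K * r) ^ j * / INR (fact j) * subdom_bound K)%R.
2:{ rewrite Rpow_mult_distr. unfold Rdiv. ring. }
apply Rmult_le_compat_r; [exact HS|].
assert (HKr : (0 <= K * r)%R) by now apply Rmult_le_pos.
assert (HP : forall n, (0 <= (K * r) ^ n * / INR (fact n))%R).
{ intros n. apply Rmult_le_pos; [now apply pow_le|]. left. apply Rinv_0_lt_compat, INR_fact_lt_0. }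
assert (Hs : forall N, (sum_n (fun n => (K * r) ^ n * / INR (fact n)) N <= exp (K * r))%R).
{ intros N. apply (is_lim_seq_incr_compare _ _ HX). intros n. rewrite sum_Sn.
  change plus with Rplus. generalize (HP (S n)). lra. }
eapply Rle_trans; [|apply (Hs j)]. destruct j as [|j].
- rewrite sum_O. lra.
- rewrite sum_Sn. change plus with Rplus.
  assert (0 <= sum_n (fun n => (K * r) ^ n * / INR (fact n)) j)%R; [|lra].
  clear - HP. induction j as [|j IH].
  + rewrite sum_O. apply HP.
  + rewrite sum_Sn. change plus with Rplus. generalize (HP (S j)). lra.
Qed.

(* The first two hypotheses say that the change of unknown a = cprod k * x turns
   the recurrence of [subdom] into the three-term recurrence of the conclusion. *)
Lemma rcoef_rec k u v (al be q : nat -> C) K : (0 <= K)%R ->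
  (forall j, q j * k j = al j * (1 + u j)) ->
  (forall j, be j * (k (S j) * k j) = al j * v j) ->
  (forall j, (Cmod (u j) <= gam K j)%R) -> (forall j, (Cmod (v j) <= gam K j)%R) ->
  forall j, q j * rcoef k u v (S j) + be j * rcoef k u v (S (S j)) = al j * rcoef k u v j.
Proof.
intros HK H1 H2 Hu Hv j. unfold rcoef. rewrite (subdom_rec u v K HK Hu Hv j). simpl cprod.
transitivity (cprod k j * ((q j * k j) * subdom u v (S j) +
  (be j * (k (S j) * k j)) * subdom u v (S (S j)))); [ring|].
rewrite H1, H2. ring.
Qed.

Lemma rec_zero (al be q a : nat -> C) : (forall j, be j <> 0) ->
  (forall j, q j * a (S j) + be j * a (S (S j)) = al j * a j) ->
  a 0%nat = 0 -> a 1%nat = 0 -> forall j, a j = 0.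
Proof.
intros Hb H H0 H1.
assert (P : forall j, a j = 0 /\ a (S j) = 0).
{ induction j as [|j [I1 I2]]; [now split|split; [exact I2|]].
  generalize (H j). rewrite I1, I2. intros E.
  replace (a (S (S j))) with (/ be j * (q j * 0 + be j * a (S (S j)))) by (field; auto).
  rewrite E. ring. }
intros j. apply P.
Qed.

Lemma pow_half_small (L e : R) : (0 <= L)%R -> (0 < e)%R -> exists n, (L * (/ 2) ^ n < e)%R.
Proof.
intros HL He. assert (H : (0 < e / (L + 1))%R) by (apply Rdiv_lt_0_compat; lra).
assert (Hh : (Rabs (/ 2) < 1)%R) by (rewrite Rabs_right; lra).
destruct (pow_lt_1_zero (/ 2)%R Hh _ H) as [N HN].
exists N. specialize (HN N (le_n N)). rewrite Rabs_right in HN.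
2:{ apply Rle_ge, pow_le. lra. }
apply Rle_lt_trans with (L * (e / (L + 1)))%R.
- apply Rmult_le_compat_l; lra.
- apply Rmult_lt_reg_r with (L + 1)%R; [lra|]. field_simplify; [nra|lra].
Qed.

(** The Casoratian of [A] and [a] decays superexponentially, while its recurrence
    lets it decrease at most geometrically: it vanishes. *)
Lemma casoratian_zero (al be q A a : nat -> C) (K r : R) : (0 < r)%R ->
  (forall j, al j <> 0) -> (forall j, (Cmod (be j) <= K * Cmod (al j))%R) ->
  (forall j, q j * A (S j) + be j * A (S (S j)) = al j * A j) ->
  (forall j, q j * a (S j) + be j * a (S (S j)) = al j * a j) ->
  (forall s, (0 <= s)%R -> geom_bounded A s) -> geom_bounded a r ->
  A 0%nat * a 1%nat = A 1%nat * a 0%nat.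
Proof.
intros Hr Hal Hbe HA Ha GA Ga.
set (W := fun j => A j * a (S j) - A (S j) * a j).
assert (HW : forall j, al j * W j = - (be j * W (S j))).
{ intros j. unfold W. transitivity ((al j * A j) * a (S j) - A (S j) * (al j * a j)); [ring|].
  rewrite <- HA, <- Ha. ring. }
(* The maximum with 1 makes the growth factor positive whatever the sign of [K]. *)
set (k := Rmax 1 K).
assert (Hk1 : (1 <= k)%R) by apply Rmax_l.
assert (HWk : forall j, (Cmod (W j) <= k * Cmod (W (S j)))%R).
{ intros j. assert (Hp : (0 < Cmod (al j))%R) by (apply Cmod_gt_0, Hal).
  apply Rmult_le_reg_l with (Cmod (al j)); [exact Hp|].
  rewrite <- Cmod_mult, HW, Cmod_opp, Cmod_mult.
  replace (Cmod (al j) * (k * Cmod (W (S j))))%R with ((k * Cmod (al j)) * Cmod (W (S j)))%R by ring.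
  apply Rmult_le_compat_r; [apply Cmod_ge_0|]. eapply Rle_trans; [apply Hbe|].
  apply Rmult_le_compat_r; [lra|apply Rmax_r]. }
assert (HWn : forall j, (Cmod (W 0%nat) <= k ^ j * Cmod (W j))%R).
{ induction j as [|j IH]; [simpl; lra|]. eapply Rle_trans; [exact IH|].
  simpl pow. replace (k * k ^ j * Cmod (W (S j)))%R with (k ^ j * (k * Cmod (W (S j))))%R by ring.
  apply Rmult_le_compat_l; [apply pow_le; lra|apply HWk]. }
assert (Hs : (0 < 2 * k / r)%R) by (apply Rdiv_lt_0_compat; lra).
(* The radius [2 * k / r] for [A] is chosen against the growth [k^n] and the bound [r^(-n)] for [a]:
   exactly [2^(-n)] is left over. *)
destruct (GA (2 * k / r)%R (Rlt_le _ _ Hs)) as [M HM]. destruct Ga as [N HN].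
assert (HM0 : (0 <= M)%R).
{ eapply Rle_trans; [|apply (HM 0%nat)]. simpl. generalize (Cmod_ge_0 (A 0%nat)). lra. }
assert (HN0 : (0 <= N)%R).
{ eapply Rle_trans; [|apply (HN 0%nat)]. simpl. generalize (Cmod_ge_0 (a 0%nat)). lra. }
assert (Z : Cmod (W 0%nat) = 0%R).
{ destruct (Rle_lt_or_eq_dec 0 _ (Cmod_ge_0 (W 0%nat))) as [Hp|E]; [exfalso|now symmetry].
  set (L := (M * N / r + M * N * r / (2 * k))%R).
  assert (HL : (0 <= L)%R).
  { unfold L. apply Rplus_le_le_0_compat.
    - repeat apply Rmult_le_pos; auto. left. now apply Rinv_0_lt_compat.
    - repeat apply Rmult_le_pos; auto; [lra|]. left. apply Rinv_0_lt_compat. lra. }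
  destruct (pow_half_small L _ HL Hp) as [n Hn].
  generalize (HWn n).
  assert (B : (k ^ n * Cmod (W n) <= L * (/ 2) ^ n)%R); [|lra].
  assert (Hrn : (0 < r ^ n)%R) by now apply pow_lt.
  assert (Hkn : (0 < k ^ n)%R) by (apply pow_lt; lra).
  assert (H2n : (0 < 2 ^ n)%R) by (apply pow_lt; lra).
  assert (XA : forall j, (Cmod (A j) <= M * / (2 * k / r) ^ j)%R).
  { intros j. assert (Hp' : (0 < (2 * k / r) ^ j)%R) by now apply pow_lt.
    apply Rmult_le_reg_r with ((2 * k / r) ^ j)%R; [exact Hp'|].
    rewrite Rmult_assoc, Rinv_l, Rmult_1_r by lra. apply HM. }
  assert (Xa : forall j, (Cmod (a j) <= N * / r ^ j)%R).
  { intros j. assert (Hp' : (0 < r ^ j)%R) by now apply pow_lt.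
    apply Rmult_le_reg_r with (r ^ j)%R; [exact Hp'|].
    rewrite Rmult_assoc, Rinv_l, Rmult_1_r by lra. apply HN. }
  assert (B1 : (Cmod (W n) <= M * / (2 * k / r) ^ n * (N * / r ^ S n) +
     M * / (2 * k / r) ^ S n * (N * / r ^ n))%R).
  { unfold W, Cminus. eapply Rle_trans; [apply Cmod_triangle|].
    rewrite Cmod_opp, !Cmod_mult.
    apply Rplus_le_compat; apply Rmult_le_compat; auto using Cmod_ge_0. }
  apply Rle_trans with (k ^ n * (M * / (2 * k / r) ^ n * (N * / r ^ S n) +
     M * / (2 * k / r) ^ S n * (N * / r ^ n)))%R.
  - apply Rmult_le_compat_l; [lra|exact B1].
  - right. unfold L. simpl pow. unfold Rdiv. rewrite !Rpow_mult_distr, !pow_inv.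
    field. repeat split; try lra. }
apply Cmod_eq_0 in Z. unfold W in Z.
replace (A 0%nat * a 1%nat) with (A 0%nat * a 1%nat - A 1%nat * a 0%nat + A 1%nat * a 0%nat) by ring.
rewrite Z. ring.
Qed.

(** The initial pairs are proportional because the pair of [A] is not [(0, 0)]: otherwise [A] would
    vanish identically. [A 0] alone may be 0, whence the two quotients. *)
Lemma rec_proportional (al be q A a : nat -> C) : (forall j, be j <> 0) ->
  (forall j, q j * A (S j) + be j * A (S (S j)) = al j * A j) ->
  (forall j, q j * a (S j) + be j * a (S (S j)) = al j * a j) ->
  (exists j, A j <> 0) -> A 0%nat * a 1%nat = A 1%nat * a 0%nat ->
  exists c, forall j, a j = c * A j.
Proof.
intros Hb HA Ha [m Hm] H.
assert (D : forall c, a 0%nat = c * A 0%nat -> a 1%nat = c * A 1%nat -> forall j, a j = c * A j).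
{ intros c H0 H1 j.
  assert (E : a j - c * A j = 0).
  { apply (rec_zero al be q (fun j => a j - c * A j) Hb).
    - intros i. transitivity ((q i * a (S i) + be i * a (S (S i))) -
        c * (q i * A (S i) + be i * A (S (S i)))); [ring|]. rewrite HA, Ha. ring.
    - rewrite H0. ring.
    - rewrite H1. ring. }
  replace (a j) with (a j - c * A j + c * A j) by ring. rewrite E. ring. }
destruct (Ceq_dec (A 0%nat) 0) as [E0|n0].
- destruct (Ceq_dec (A 1%nat) 0) as [E1|n1].
  + elim Hm. now apply (rec_zero al be q A).
  + exists (a 1%nat / A 1%nat). apply D; [|field; exact n1].
    rewrite E0 in H.
    replace (a 0%nat) with (/ A 1%nat * (A 1%nat * a 0%nat)) by (field; exact n1).
    rewrite <- H, E0. ring.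
- exists (a 0%nat / A 0%nat). apply D; [field; exact n0|].
  replace (a 1%nat) with (/ A 0%nat * (A 0%nat * a 1%nat)) by (field; exact n0).
  rewrite H. field. exact n0.
Qed.

(** * Local uniform bounds in the parameters *)

(** For [i + 1 >= 2 |b|] the triangle inequality gives the constant [1/2]; the finitely many other
    terms are non-zero and contribute a minimum. *)
Lemma shifted_integers_lower_bound (b : C) :
  (forall i : nat, RtoC (INR (S i)) + b <> 0) ->
  exists c : R, (0 < c)%R /\ forall i : nat, (c * INR (S i) <= Cmod (RtoC (INR (S i)) + b))%R.
Proof.
intros H.
assert (F : forall N : nat, exists c : R, (0 < c)%R /\
  forall i, (i < N)%nat -> (c * INR (S i) <= Cmod (RtoC (INR (S i)) + b))%R).
{ induction N as [|N [c [Hc IH]]].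
  - exists 1%R. split; [lra|]. intros i Hi. lia.
  - assert (Hp : (0 < Cmod (RtoC (INR (S N)) + b))%R) by (apply Cmod_gt_0, H).
    assert (HS : (0 < INR (S N))%R) by (apply lt_0_INR; lia).
    set (m := (Cmod (RtoC (INR (S N)) + b) / INR (S N))%R).
    assert (Hm : (0 < m)%R) by now apply Rdiv_lt_0_compat.
    exists (Rmin c m). split; [now apply Rmin_pos|]. intros i Hi.
    destruct (Nat.eq_dec i N) as [->|n].
    + apply Rle_trans with (m * INR (S N))%R.
      * apply Rmult_le_compat_r; [lra|apply Rmin_r].
      * right. unfold m. field. lra.
    + apply Rle_trans with (c * INR (S i))%R.
      * apply Rmult_le_compat_r; [apply pos_INR|apply Rmin_l].
      * apply IH. lia. }
destruct (nfloor_ex (2 * Cmod b)) as [N [_ HN]].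
{ generalize (Cmod_ge_0 b). lra. }
destruct (F (S N)) as [c [Hc HF]]. exists (Rmin c (/ 2)). split.
{ apply Rmin_pos; lra. }
intros i. destruct (le_lt_dec (S N) i) as [Hi|Hi].
- apply Rle_trans with (/ 2 * INR (S i))%R.
  + apply Rmult_le_compat_r; [apply pos_INR|apply Rmin_r].
  + assert (HI : (INR N + 1 <= INR (S i))%R).
    { rewrite <- S_INR. apply le_INR. lia. }
    generalize (Cmod_rtriangle (RtoC (INR (S i))) (- b)).
    rewrite Cmod_opp, Cmod_R, Rabs_right by (apply Rle_ge, pos_INR).
    replace (RtoC (INR (S i)) - - b) with (RtoC (INR (S i)) + b) by ring. lra.
- apply Rle_trans with (c * INR (S i))%R.
  + apply Rmult_le_compat_r; [apply pos_INR|apply Rmin_l].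
  + apply HF. lia.
Qed.

(** Every denominator of the rescaled recurrence has this form, the argument being [+-b] or
    [+-(b + n)] moved by an integer. *)
Definition rinv (i : nat) (b : C) : C := / (RtoC (INR (S i)) + b).

Section LocalBounds.

Context {T : NormedModule C_AbsRing} (q0 : T).

Definition nball (d : R) (q : T) : Prop := (norm (minus q q0) < d)%R.

(** One radius [d] and one constant [K] serve all indices: this uniformity allows series to be
    summed on a fixed neighbourhood of [q0]. *)
Definition lbound (f : nat -> T -> C) (g : nat -> R) : Prop :=
  exists d K, (0 < d)%R /\ (0 <= K)%R /\ forall i, c11 1 (nball d) (f i) (K * g i).

Lemma nball_le d d' q : (d <= d')%R -> nball d q -> nball d' q.
Proof. unfold nball. lra. Qed.

Lemma locally_nball d : (0 < d)%R -> locally q0 (nball d).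
Proof.
intros Hd. apply locally_le_locally_norm. exists (mkposreal d Hd). intros y Hy. exact Hy.
Qed.

Lemma norm_nball d q : nball d q -> (norm q <= norm q0 + d)%R.
Proof.
unfold nball. intros H.
replace q with (plus (minus q q0) q0).
- eapply Rle_trans; [apply norm_triangle|]. lra.
- unfold minus. now rewrite <- plus_assoc, plus_opp_l, plus_zero_r.
Qed.

Lemma lbound_le f g g' : (forall i, (g i <= g' i)%R) -> lbound f g -> lbound f g'.
Proof.
intros H [d [K [Hd [HK HB]]]]. exists d, K. split; [exact Hd|split; [exact HK|]].
intros i. apply c11_le with (K * g i)%R; [|apply HB]. now apply Rmult_le_compat_l.
Qed.

Lemma lbound_ext f f' g : (forall i q, f i q = f' i q) -> lbound f g -> lbound f' g.
Proof.
intros H [d [K [Hd [HK HB]]]]. exists d, K. split; [exact Hd|split; [exact HK|]].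
intros i. apply c11_ext with (f i); auto.
Qed.

Lemma lbound_const (c : C) : lbound (fun _ _ => c) (fun _ => 1%R).
Proof.
exists 1%R, (Cmod c). split; [lra|split; [apply Cmod_ge_0|]]. intros i.
rewrite Rmult_1_r. apply c11_const.
Qed.

Lemma lbound_linear (l : T -> C) :
  is_linear (K := C_AbsRing) (U := T) (V := C_NormedModule) l ->
  lbound (fun _ => l) (fun _ => 1%R).
Proof.
intros Hl. destruct (jet_linear 1 (nball 1) l) as [A HA]; [lra|exact Hl| |].
- exists (norm q0 + 1)%R. intros x. apply norm_nball.
- exists 1%R, (Rmax 0 A). split; [lra|split; [apply Rmax_l|]]. intros _.
  rewrite Rmult_1_r. exists (fun _ h => l h). eapply jet_le; [apply Rmax_r|exact HA].
Qed.

Lemma lbound_plus f f' g : lbound f g -> lbound f' g ->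
  lbound (fun i q => f i q + f' i q) g.
Proof.
intros [d [K [Hd [HK HB]]]] [d' [K' [Hd' [HK' HB']]]].
exists (Rmin d d'), (K + K')%R. split; [now apply Rmin_pos|split; [lra|]]. intros i.
rewrite Rmult_plus_distr_r. apply c11_plus.
- apply c11_subset with (nball d); [|apply HB]. intros q. apply nball_le, Rmin_l.
- apply c11_subset with (nball d'); [|apply HB']. intros q. apply nball_le, Rmin_r.
Qed.

Lemma lbound_mult f f' g g' : lbound f g -> lbound f' g' ->
  lbound (fun i q => f i q * f' i q) (fun i => g i * g' i)%R.
Proof.
intros [d [K [Hd [HK HB]]]] [d' [K' [Hd' [HK' HB']]]].
exists (Rmin d d'), (K * K')%R. split; [now apply Rmin_pos|split; [now apply Rmult_le_pos|]].
intros i. replace (K * K' * (g i * g' i))%R with ((K * g i) * (K' * g' i))%R by ring.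
apply c11_mult; [lra| |].
- apply c11_subset with (nball d); [|apply HB]. intros q. apply nball_le, Rmin_l.
- apply c11_subset with (nball d'); [|apply HB']. intros q. apply nball_le, Rmin_r.
Qed.

Lemma lbound_scal_l (h : T -> C) f g : lbound (fun _ => h) (fun _ => 1%R) -> lbound f g ->
  lbound (fun i q => h q * f i q) g.
Proof.
intros H1 H2. apply lbound_le with (fun i => 1 * g i)%R; [intros; lra|].
now apply lbound_mult.
Qed.

(** With [s = i + 1 >= 1] the bounds for the inverse are [1/(m s)], [L/(m s)^2] and [L^2/(m s)^3],
    all of order [1/s]: differentiation in the parameters costs no decay. *)
Lemma lbound_rinv (c : C) (l : T -> C) :
  is_linear (K := C_AbsRing) (U := T) (V := C_NormedModule) l ->
  (forall i : nat, RtoC (INR (S i)) + (c + l q0) <> 0) ->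
  lbound (fun i q => rinv i (c + l q)) (fun i => / (INR i + 1))%R.
Proof.
intros Hl H. destruct (shifted_integers_lower_bound _ H) as [m0 [Hm0 Hm]].
destruct (linear_norm l Hl) as [L [HL HLn]].
(* Half of the lower bound survives: within distance [d = m / L] the linear part moves by at most
   [m], hence by at most [m * (i + 1)]. *)
set (m := (m0 / 2)%R).
assert (HmP : (0 < m)%R) by (unfold m; lra).
set (d := (m / L)%R).
assert (Hd : (0 < d)%R) by now apply Rdiv_lt_0_compat.
exists d, (/ m + L / m ^ 2 + L ^ 2 / m ^ 3)%R. split; [exact Hd|split].
{ repeat apply Rplus_le_le_0_compat; repeat apply Rmult_le_pos; try lra;
  left; apply Rinv_0_lt_compat; try apply pow_lt; lra. }
intros i.
assert (HS : (1 <= INR (S i))%R).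
{ rewrite S_INR. generalize (pos_INR i). lra. }
assert (HB : jet_bounds (nball d) (fun q => RtoC (INR (S i)) + (c + l q)) (fun _ h => l h)
  (Cmod (RtoC (INR (S i)) + c) + L * (norm q0 + d)) L 0).
{ split.
  { split; [|lra]. apply Rplus_le_le_0_compat; [apply Cmod_ge_0|].
    apply Rmult_le_pos; [lra|]. generalize (norm_ge_0 q0). lra. }
  intros x Hx. split; [exact Hl|split; [|split; [exact HLn|]]].
  - replace (RtoC (INR (S i)) + (c + l x)) with (RtoC (INR (S i)) + c + l x) by ring.
    eapply Rle_trans; [apply Cmod_triangle|]. apply Rplus_le_compat_l.
    eapply Rle_trans; [apply (HLn x)|]. apply Rmult_le_compat_l; [lra|]. now apply norm_nball.
  - intros y Hy.
    assert (E : RtoC (INR (S i)) + (c + l y) - (RtoC (INR (S i)) + (c + l x)) = l (minus y x)).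
    { transitivity (l y - l x); [ring|]. symmetry. apply (linear_minus l y x Hl). }
    rewrite E. split; [apply HLn|].
    replace (l (minus y x) - l (minus y x)) with (RtoC 0) by ring. rewrite Cmod_0. lra. }
assert (Hlow : forall q, nball d q ->
  (m * INR (S i) <= Cmod (RtoC (INR (S i)) + (c + l q)))%R).
{ intros q Hq.
  assert (E : l q = l q0 + l (minus q q0)).
  { transitivity (l q0 + (l q - l q0)); [ring|]. f_equal. symmetry.
    apply (linear_minus l q q0 Hl). }
  rewrite E.
  generalize (Cmod_rtriangle (RtoC (INR (S i)) + (c + l q0)) (- l (minus q q0))).
  rewrite Cmod_opp.
  replace (RtoC (INR (S i)) + (c + l q0) - - l (minus q q0)) with
    (RtoC (INR (S i)) + (c + (l q0 + l (minus q q0)))) by ring.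
  assert (HLm : (Cmod (l (minus q q0)) <= m)%R).
  { eapply Rle_trans; [apply (HLn (minus q q0))|]. unfold nball in Hq.
    apply Rle_trans with (L * d)%R; [apply Rmult_le_compat_l; lra|].
    right. unfold d. field. lra. }
  generalize (Hm i). unfold m in *. nra. }
assert (HmS : (0 < m * INR (S i))%R) by (apply Rmult_lt_0_compat; lra).
generalize (jet_bounds_inv _ _ _ _ _ _ _ HmS HB Hlow). intros HJ.
exists (fun x h => - (/ (RtoC (INR (S i)) + (c + l x)) * / (RtoC (INR (S i)) + (c + l x))) * l h).
eexists. eexists. eexists. split; [exact HJ|].
rewrite <- S_INR. set (s := INR (S i)) in *.
assert (I1 : (/ s <= 1)%R).
{ rewrite <- Rinv_1. apply Rinv_le_contravar; lra. }
assert (I0 : (0 < / s)%R) by (apply Rinv_0_lt_compat; lra).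
assert (J1 : (0 < L / m ^ 2)%R) by (apply Rdiv_lt_0_compat; [lra|now apply pow_lt]).
assert (J2 : (0 < L ^ 2 / m ^ 3)%R) by (apply Rdiv_lt_0_compat; apply pow_lt; lra).
replace (/ (m * s) + 1 * (L / (m * s) ^ 2) + 1 ^ 2 * (0 / (m * s) ^ 2 + L ^ 2 / (m * s) ^ 3))%R
  with (/ m * / s + (L / m ^ 2) * (/ s * / s) + (L ^ 2 / m ^ 3) * (/ s * / s * / s))%R
  by (field; lra).
assert (K1 : (/ s * / s <= / s)%R) by nra.
assert (K2 : (/ s * / s * / s <= / s)%R) by nra.
rewrite !Rmult_plus_distr_r. repeat apply Rplus_le_compat; [lra| |];
apply Rmult_le_compat_l; lra.
Qed.

End LocalBounds.

(** * Weights and coefficients as functions of the parameters *)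

Definition cn (p : params) : C := let '(n, lambda, mu, b) := p in n.
Definition cla (p : params) : C := let '(n, lambda, mu, b) := p in lambda.
Definition cb (p : params) : C := let '(n, lambda, mu, b) := p in b.

(* For [Plus] the recurrence is that of [a_(j+1)], since [a_0 = 0].  With
   [w_(j+1) = kap_j w_j] the unknown [x_j = a_j / w_j] satisfies
   [x_j = (1 + useq_j) x_(j+1) + vseq_j x_(j+2)]. *)
Definition kap (s : pm_sign) (p : params) (i : nat) : C :=
  match s with
  | Plus => pmu p * rinv i (1 + cb p)
  | Minus => pmu p * ((1 + -(1) * rinv i (0 + - cb p)) * rinv i (1 + - (cb p + cn p)))
  end.

(** The inverse of [rq s p i - cla p], the [lambda]-free part of the middle coefficient. *)
Definition rinv2 (s : pm_sign) (p : params) (i : nat) : C :=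
  match s with
  | Plus => rinv i (1 + cb p) * rinv i (0 + (cb p + cn p))
  | Minus => rinv i (0 + - cb p) * rinv i (1 + - (cb p + cn p))
  end.

(** As [kap] is [ral] over the [lambda]-free part of [rq], this is what [rq * kap / ral] exceeds 1
    by. *)
Definition useq (s : pm_sign) (p : params) (i : nat) : C := cla p * rinv2 s p i.

(** The quotient [rbe_i * kap_(i+1) * kap_i / ral_i] after cancellation; two linear factors remain
    in the denominator, whence the decay [1/i^2]. *)
Definition vseq (s : pm_sign) (p : params) (i : nat) : C :=
  pmu p * (pmu p * match s with
    | Plus => rinv2 Plus p i
    | Minus => rinv i (1 + - cb p) * rinv i (2 + - (cb p + cn p))
    end).

Lemma not_integer_shift (b : C) (k : Z) : not_integer b -> RtoC (IZR k) + b <> 0.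
Proof.
intros H E. apply (H (- k)%Z). rewrite opp_IZR, RtoC_opp.
transitivity (RtoC (IZR k) + b - RtoC (IZR k)); [ring|]. rewrite E. ring.
Qed.

Lemma not_integer_shift_S (b : C) (k : Z) (i : nat) : not_integer b ->
  RtoC (INR (S i)) + (RtoC (IZR k) + b) <> 0.
Proof.
intros H. rewrite Cplus_assoc, <- RtoC_plus, INR_IZR_INZ, <- plus_IZR.
now apply not_integer_shift.
Qed.

Lemma not_integer_opp (b : C) : not_integer b -> not_integer (- b).
Proof.
intros H k E. apply (H (- k)%Z). rewrite opp_IZR, RtoC_opp, <- E. ring.
Qed.

Lemma in_U_iff p : in_U p <-> pmu p <> 0 /\ not_integer (cb p) /\ not_integer (cb p + cn p).
Proof. destruct p as [[[n la] mu] b]. reflexivity. Qed.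

Section Linear.

Context {T : NormedModule C_AbsRing}.
Notation lin := (is_linear (K := C_AbsRing) (U := T) (V := C_NormedModule)).

Lemma lin_opp (l : T -> C) : lin l -> lin (fun q => - l q).
Proof. intros H. apply (is_linear_comp l opp H). apply is_linear_opp. Qed.

Lemma lin_plus (l m : T -> C) : lin l -> lin m -> lin (fun q => l q + m q).
Proof.
intros H1 H2. apply (is_linear_comp (fun q => (l q, m q)) (fun x => plus (fst x) (snd x))).
- now apply is_linear_prod.
- apply is_linear_plus.
Qed.

End Linear.

Local Notation params_NormedModule := (prod_NormedModule C_AbsRing
  (prod_NormedModule C_AbsRing (prod_NormedModule C_AbsRing C_NormedModule C_NormedModule)
     C_NormedModule) C_NormedModule) (only parsing).

Section Coordinates.

Context {T : NormedModule C_AbsRing} (P : T -> params).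
Context (HP : is_linear (K := C_AbsRing) (U := T) (V := params_NormedModule) P).

Notation lin := (is_linear (K := C_AbsRing) (U := T) (V := C_NormedModule)).

Lemma lin_cn : lin (fun q => cn (P q)).
Proof.
apply (is_linear_ext (fun q => fst (fst (fst (P q))))).
- intros q. destruct (P q) as [[[n la] mu] b]. reflexivity.
- apply (is_linear_comp (fun q => fst (fst (P q))) fst); [|apply is_linear_fst].
  apply (is_linear_comp (fun q => fst (P q)) fst); [|apply is_linear_fst].
  apply (is_linear_comp P fst HP). apply is_linear_fst.
Qed.

Lemma lin_cla : lin (fun q => cla (P q)).
Proof.
apply (is_linear_ext (fun q => snd (fst (fst (P q))))).
- intros q. destruct (P q) as [[[n la] mu] b]. reflexivity.
- apply (is_linear_comp (fun q => fst (fst (P q))) snd); [|apply is_linear_snd].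
  apply (is_linear_comp (fun q => fst (P q)) fst); [|apply is_linear_fst].
  apply (is_linear_comp P fst HP). apply is_linear_fst.
Qed.

Lemma lin_pmu : lin (fun q => pmu (P q)).
Proof.
apply (is_linear_ext (fun q => snd (fst (P q)))).
- intros q. destruct (P q) as [[[n la] mu] b]. reflexivity.
- apply (is_linear_comp (fun q => fst (P q)) snd); [|apply is_linear_snd].
  apply (is_linear_comp P fst HP). apply is_linear_fst.
Qed.

Lemma lin_cb : lin (fun q => cb (P q)).
Proof.
apply (is_linear_ext (fun q => snd (P q))).
- intros q. destruct (P q) as [[[n la] mu] b]. reflexivity.
- apply (is_linear_comp P snd HP). apply is_linear_snd.
Qed.

Context (q0 : T) (HU : in_U (P q0)).

Lemma lbound_rinv_cb (k : Z) :
  lbound q0 (fun i q => rinv i (IZR k + cb (P q))) (fun i => / (INR i + 1))%R.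
Proof.
apply in_U_iff in HU. apply lbound_rinv; [apply lin_cb|].
intros i. now apply not_integer_shift_S.
Qed.

Lemma lbound_rinv_opp_cb (k : Z) :
  lbound q0 (fun i q => rinv i (IZR k + - cb (P q))) (fun i => / (INR i + 1))%R.
Proof.
apply in_U_iff in HU. apply lbound_rinv; [apply lin_opp, lin_cb|].
intros i. now apply not_integer_shift_S, not_integer_opp.
Qed.

Lemma lbound_rinv_cbn (k : Z) :
  lbound q0 (fun i q => rinv i (IZR k + (cb (P q) + cn (P q)))) (fun i => / (INR i + 1))%R.
Proof.
apply in_U_iff in HU. apply lbound_rinv; [apply lin_plus; [apply lin_cb|apply lin_cn]|].
intros i. now apply not_integer_shift_S.
Qed.

Lemma lbound_rinv_opp_cbn (k : Z) :
  lbound q0 (fun i q => rinv i (IZR k + - (cb (P q) + cn (P q)))) (fun i => / (INR i + 1))%R.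
Proof.
apply in_U_iff in HU.
apply lbound_rinv; [apply lin_opp, lin_plus; [apply lin_cb|apply lin_cn]|].
intros i. now apply not_integer_shift_S, not_integer_opp.
Qed.

(** For [Minus] the quotient [(i - b) / (i + 1 - b)] is written as [1 - 1 / (i + 1 - b)], so that
    the bounds for [rinv] cover it. *)
Lemma lbound_kap s : lbound q0 (fun i q => kap s (P q) i) (fun i => / (INR i + 1))%R.
Proof.
destruct s; unfold kap; (apply lbound_scal_l; [apply lbound_linear, lin_pmu|]).
- exact (lbound_rinv_cb 1).
- apply lbound_le with (fun i => 1 * / (INR i + 1))%R; [intros; lra|].
  apply lbound_mult; [|exact (lbound_rinv_opp_cbn 1)].
  apply lbound_plus; [apply lbound_const|].
  apply lbound_le with (fun i => 1 * / (INR i + 1))%R.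
  + intros i. rewrite Rmult_1_l, <- Rinv_1. generalize (pos_INR i). intros.
    apply Rinv_le_contravar; lra.
  + apply lbound_mult; [apply lbound_const|exact (lbound_rinv_opp_cb 0)].
Qed.

Lemma lbound_rinv2 s : lbound q0 (fun i q => rinv2 s (P q) i) (fun i => / (INR i + 1) ^ 2)%R.
Proof.
apply lbound_le with (fun i => / (INR i + 1) * / (INR i + 1))%R.
{ intros i. right. generalize (pos_INR i). intros. field. lra. }
destruct s; unfold rinv2; apply lbound_mult.
- exact (lbound_rinv_cb 1).
- exact (lbound_rinv_cbn 0).
- exact (lbound_rinv_opp_cb 0).
- exact (lbound_rinv_opp_cbn 1).
Qed.

Lemma lbound_useq s : lbound q0 (fun i q => useq s (P q) i) (fun i => / (INR i + 1) ^ 2)%R.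
Proof.
unfold useq. apply lbound_scal_l; [apply lbound_linear, lin_cla|apply lbound_rinv2].
Qed.

Lemma lbound_vseq s : lbound q0 (fun i q => vseq s (P q) i) (fun i => / (INR i + 1) ^ 2)%R.
Proof.
unfold vseq. apply lbound_scal_l; [apply lbound_linear, lin_pmu|].
apply lbound_scal_l; [apply lbound_linear, lin_pmu|].
destruct s; [apply lbound_rinv2|].
apply lbound_le with (fun i => / (INR i + 1) * / (INR i + 1))%R.
{ intros i. right. generalize (pos_INR i). intros. field. lra. }
apply lbound_mult; [exact (lbound_rinv_opp_cb 1)|exact (lbound_rinv_opp_cbn 2)].
Qed.

(** The linear map [P] is the identity when only the parameters vary, and the first projection when
    the variable [z] is joined to them. *)
Lemma recurrence_bounds s : exists d K, (0 < d)%R /\ (0 <= K)%R /\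
  (forall i, c11 1 (nball q0 d) (fun q => kap s (P q) i) (K / (INR i + 1))) /\
  (forall i, c11 1 (nball q0 d) (fun q => useq s (P q) i) (gam K i)) /\
  (forall i, c11 1 (nball q0 d) (fun q => vseq s (P q) i) (gam K i)).
Proof.
destruct (lbound_kap s) as [d1 [K1 [Hd1 [HK1 H1]]]].
destruct (lbound_useq s) as [d2 [K2 [Hd2 [HK2 H2]]]].
destruct (lbound_vseq s) as [d3 [K3 [Hd3 [HK3 H3]]]].
exists (Rmin d1 (Rmin d2 d3)), (K1 + K2 + K3)%R.
split; [repeat apply Rmin_pos; assumption|split; [lra|]].
assert (S1 : (Rmin d1 (Rmin d2 d3) <= d1)%R) by apply Rmin_l.
assert (S2 : (Rmin d1 (Rmin d2 d3) <= d2)%R) by (eapply Rle_trans; [apply Rmin_r|apply Rmin_l]).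
assert (S3 : (Rmin d1 (Rmin d2 d3) <= d3)%R) by (eapply Rle_trans; [apply Rmin_r|apply Rmin_r]).
split; [|split]; intros i; generalize (pos_INR i); intros Hi;
  (assert (0 < / (INR i + 1))%R by (apply Rinv_0_lt_compat; lra));
  (assert (0 < / (INR i + 1) ^ 2)%R by (apply Rinv_0_lt_compat, pow_lt; lra)).
- eapply c11_subset; [intros q; apply nball_le, S1|]. eapply c11_le; [|apply H1].
  unfold Rdiv. apply Rmult_le_compat_r; lra.
- eapply c11_subset; [intros q; apply nball_le, S2|]. eapply c11_le; [|apply H2].
  unfold gam, Rdiv. apply Rmult_le_compat_r; lra.
- eapply c11_subset; [intros q; apply nball_le, S3|]. eapply c11_le; [|apply H3].
  unfold gam, Rdiv. apply Rmult_le_compat_r; lra.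
Qed.

End Coordinates.

Lemma recurrence_bounds_at s p : in_U p -> exists K, (0 <= K)%R /\
  (forall i, (Cmod (kap s p i) <= K / (INR i + 1))%R) /\
  (forall i, (Cmod (useq s p i) <= gam K i)%R) /\
  (forall i, (Cmod (vseq s p i) <= gam K i)%R).
Proof.
intros HU.
destruct (recurrence_bounds (T := params_NormedModule) (fun q => q)
  (is_linear_id (K := C_AbsRing) (V := params_NormedModule)) p HU s)
  as [d [K [Hd [HK [H1 [H2 H3]]]]]].
assert (Hp : nball (T := params_NormedModule) p d p).
{ exact (locally_singleton _ _ (locally_nball (T := params_NormedModule) p d Hd)). }
exists K. split; [exact HK|]. repeat split; intros i.
- refine (c11_sup 1 _ _ _ _ _ (H1 i) Hp). lra.
- refine (c11_sup 1 _ _ _ _ _ (H2 i) Hp). lra.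
- refine (c11_sup 1 _ _ _ _ _ (H3 i) Hp). lra.
Qed.

(** [alpha_i], [beta_i], [q_i] of the overview, indexed so that the first relation free of [d0],
    [d1] has [i = 0]. In [ral] and [rbe], [INR (S i)] is followed by an integer plus [+-b] or
    [+-(b + n)], the form from which non-vanishing is read off. *)
Definition ral (s : pm_sign) (p : params) (i : nat) : C :=
  pmu p * (RtoC (INR (S i)) + match s with Plus => 0 + (cb p + cn p) | Minus => -(1) + - cb p end).
Definition rbe (s : pm_sign) (p : params) (i : nat) : C :=
  pmu p * (RtoC (INR (S i)) + match s with Plus => 2 + cb p | Minus => 1 + - (cb p + cn p) end).
Definition rq (s : pm_sign) (p : params) (i : nat) : C :=
  match s with
  | Plus => (RtoC (INR (S i)) + (1 + cb p)) * (RtoC (INR (S i)) + (cb p + cn p)) + cla p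
  | Minus => (RtoC (INR (S i)) - cb p) * (RtoC (INR (S i)) + (1 - (cb p + cn p))) + cla p
  end.

Definition rsol (s : pm_sign) (p : params) : nat -> C := rcoef (kap s p) (useq s p) (vseq s p).

Lemma ral_neq_0 s p i : in_U p -> ral s p i <> 0.
Proof.
intros HU. apply in_U_iff in HU. destruct HU as [H1 [H2 H3]].
unfold ral. destruct s; (apply Cmult_neq_0; [exact H1|]).
- exact (not_integer_shift_S _ 0 i H3).
- replace (-(1)) with (RtoC (IZR (-1))) by (rewrite <- RtoC_opp; reflexivity).
  exact (not_integer_shift_S _ (-1) i (not_integer_opp _ H2)).
Qed.

Lemma rbe_neq_0 s p i : in_U p -> rbe s p i <> 0.
Proof.
intros HU. apply in_U_iff in HU. destruct HU as [H1 [H2 H3]].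
unfold rbe. destruct s; (apply Cmult_neq_0; [exact H1|]).
- exact (not_integer_shift_S _ 2 i H2).
- exact (not_integer_shift_S _ 1 i (not_integer_opp _ H3)).
Qed.

(** Both are [mu] times a monic linear function of [i], and that of [ral] stays above a multiple of
    [i + 1]. This limits the rate at which the Casoratian can decrease. *)
Lemma rbe_le_ral s p : in_U p -> exists K, forall i, (Cmod (rbe s p i) <= K * Cmod (ral s p i))%R.
Proof.
intros HU.
assert (H : exists c, (0 < c)%R /\ forall i, (c * INR (S i) <=
  Cmod (RtoC (INR (S i)) + match s with Plus => 0 + (cb p + cn p) | Minus => -(1) + - cb p end))%R).
{ apply shifted_integers_lower_bound. intros i E. apply (ral_neq_0 s p i HU).
  unfold ral. rewrite E. ring. }
destruct H as [c [Hc H]].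
set (d := match s with Plus => 2 + cb p | Minus => 1 + - (cb p + cn p) end).
exists ((1 + Cmod d) / c)%R. intros i. unfold ral, rbe. fold d. rewrite !Cmod_mult.
generalize (Cmod_ge_0 (pmu p)) (Cmod_ge_0 d). intros Hmu Hd.
assert (HS : (1 <= INR (S i))%R).
{ rewrite S_INR. generalize (pos_INR i). lra. }
set (t := Cmod (RtoC (INR (S i)) + match s with Plus => 0 + (cb p + cn p) | Minus => -(1) + - cb p end)).
replace ((1 + Cmod d) / c * (Cmod (pmu p) * t))%R with
  (Cmod (pmu p) * ((1 + Cmod d) / c * t))%R by ring.
apply Rmult_le_compat_l; [exact Hmu|].
apply Rle_trans with ((1 + Cmod d) * INR (S i))%R.
- eapply Rle_trans; [apply Cmod_triangle|]. rewrite Cmod_R, Rabs_right by lra. nra.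
- apply Rle_trans with ((1 + Cmod d) / c * (c * INR (S i)))%R.
  + right. field. lra.
  + apply Rmult_le_compat_l; [|apply H].
    apply Rmult_le_pos; [lra|]. left. now apply Rinv_0_lt_compat.
Qed.

Lemma rsol_rec s p : in_U p ->
  forall j, rq s p j * rsol s p (S j) + rbe s p j * rsol s p (S (S j)) = ral s p j * rsol s p j.
Proof.
intros HU. destruct (recurrence_bounds_at s p HU) as [K [HK [H1 [H2 H3]]]].
apply in_U_iff in HU. destruct HU as [U1 [U2 U3]].
refine (rcoef_rec (kap s p) (useq s p) (vseq s p) (ral s p) (rbe s p) (rq s p) K HK _ _ H2 H3).
- intros j.
  generalize (not_integer_shift_S _ 1 j U2) (not_integer_shift_S _ 0 j U3)
   (not_integer_shift_S _ 0 j (not_integer_opp _ U2))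
   (not_integer_shift_S _ 1 j (not_integer_opp _ U3)). intros N1 N2 N3 N4.
  rewrite Cplus_0_l in N2, N3.
  unfold rq, kap, ral, useq, rinv2, rinv. destruct s; field; repeat split; auto.
- intros j.
  generalize (not_integer_shift_S _ 1 j U2) (not_integer_shift_S _ 1 (S j) U2)
   (not_integer_shift_S _ 0 j U3)
   (not_integer_shift_S _ 0 j (not_integer_opp _ U2))
   (not_integer_shift_S _ 1 j (not_integer_opp _ U3))
   (not_integer_shift_S _ 0 (S j) (not_integer_opp _ U2))
   (not_integer_shift_S _ 1 j (not_integer_opp _ U2))
   (not_integer_shift_S _ 2 j (not_integer_opp _ U3))
   (not_integer_shift_S _ 1 (S j) (not_integer_opp _ U3)). intros N1 N2 N3 N4 N5 N6 N7 N8 N9.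
  rewrite Cplus_0_l in N3, N4, N6.
  unfold kap, rbe, ral, vseq, rinv2, rinv.
  rewrite (S_INR (S j)), RtoC_plus in *.
  destruct s; field; repeat split; auto.
Qed.

(** * The differential equation and its coefficients *)

(** Coefficients of [x] times the series. *)
Definition shift (a : nat -> C) (k : nat) : C := match k with O => 0 | S j => a j end.

Definition cps (a : nat -> C) (x l : C) : Prop := Cconv (fun k => a k * x ^ k) l.

Lemma cps_shift a x l : cps a x l -> cps (shift a) x (x * l).
Proof.
intros H. unfold cps. apply Cconv_decr_1. simpl.
replace (x * l - 0 * 1) with (x * l) by ring.
apply (Cconv_ext (fun k => x * (a k * x ^ k))); [intros k; ring|]. now apply Cconv_scal.
Qed.

Lemma cps_plus a b x l m : cps a x l -> cps b x m -> cps (fun k => a k + b k) x (l + m).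
Proof.
intros H1 H2. unfold cps.
apply (Cconv_ext (fun k => a k * x ^ k + b k * x ^ k)); [intros k; ring|].
now apply Cconv_plus.
Qed.

Lemma cps_scal c a x l : cps a x l -> cps (fun k => c * a k) x (c * l).
Proof.
intros H. unfold cps.
apply (Cconv_ext (fun k => c * (a k * x ^ k))); [intros k; ring|]. now apply Cconv_scal.
Qed.

Definition unit_seq (k : nat) : C := match k with O => 1 | S _ => 0 end.

Lemma cps_unit x : cps unit_seq x 1.
Proof.
unfold cps. apply Cconv_decr_1. simpl. replace (1 - 1 * 1) with (RtoC 0) by ring.
apply (Cconv_ext (fun _ => 0)); [intros k; ring|apply Cconv_0].
Qed.

Lemma geom_bounded_shift a r : (0 <= r)%R -> geom_bounded a r -> geom_bounded (shift a) r.
Proof.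
intros Hr [M HM]. exists (Rmax 0 (M * r)). intros [|k]; simpl.
- rewrite Cmod_0, Rmult_0_l. apply Rmax_l.
- eapply Rle_trans; [|apply Rmax_r].
  replace (Cmod (a k) * (r * r ^ k))%R with ((Cmod (a k) * r ^ k) * r)%R by ring.
  now apply Rmult_le_compat_r.
Qed.

Lemma geom_bounded_plus a b r : (0 <= r)%R -> geom_bounded a r -> geom_bounded b r ->
  geom_bounded (fun k => a k + b k) r.
Proof.
intros Hr [M HM] [N HN]. exists (M + N)%R. intros k.
apply Rle_trans with ((Cmod (a k) + Cmod (b k)) * r ^ k)%R.
- apply Rmult_le_compat_r; [now apply pow_le|apply Cmod_triangle].
- generalize (HM k) (HN k). lra.
Qed.

Lemma geom_bounded_scal c a r : geom_bounded a r -> geom_bounded (fun k => c * a k) r.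
Proof.
intros [M HM]. exists (Cmod c * M)%R. intros k. rewrite Cmod_mult, Rmult_assoc.
apply Rmult_le_compat_l; [apply Cmod_ge_0|apply HM].
Qed.

Lemma geom_bounded_unit r : geom_bounded unit_seq r.
Proof.
exists 1%R. intros [|k]; simpl.
- rewrite Cmod_1. lra.
- rewrite Cmod_0. lra.
Qed.

(** In the variable [x] the term [d1 * z] has degree [+1] or [-1], as the two names record; after
    multiplication by [x] it lands in degree 2 or 0. *)
Definition tm1 (s : pm_sign) (d1 : C) : C := match s with Plus => 0 | Minus => d1 end.
Definition tp1 (s : pm_sign) (d1 : C) : C := match s with Plus => d1 | Minus => 0 end.

(** Coefficients of [x] times the residual of the equation for [sum a_k x^k]. *)
Definition ode (s : pm_sign) (p : params) (d0 d1 : C) (a : nat -> C) (k : nat) : C :=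
  shift (shift (shift (CPS_derive (CPS_derive a)))) k
  + (pA s p * shift (shift (CPS_derive a)) k
  + (pmu p * shift (CPS_derive a) k
  + (- pmu p * shift (shift (shift (CPS_derive a))) k
  + (pB p * shift a k
  + (pmu p * pC s p * a k
  + (- (pmu p * pD s p) * shift (shift a) k
  + (- tm1 s d1 * unit_seq k
  + (- d0 * shift unit_seq k
  + - tp1 s d1 * shift (shift unit_seq) k)))))))).

Definition residual s p d0 d1 (x f f1 f2 : C) : C :=
  x * (x ^ 2 * f2 + (pA s p * x + pmu p * (1 - x ^ 2)) * f1
       + (pB p + pmu p * pC s p * / x - pmu p * pD s p * x) * f - (d0 + d1 * pow_pm s x)).

Lemma ode_cps s p d0 d1 a r (x : C) : geom_bounded a r -> (Cmod x < r / 8)%R -> x <> 0 ->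
  cps (ode s p d0 d1 a) x (residual s p d0 d1 x (CPSeries a x) (CPSeries (CPS_derive a) x)
    (CPSeries (CPS_derive (CPS_derive a)) x)).
Proof.
intros Ha Hx Hx0. generalize (Cmod_ge_0 x). intros Hp.
assert (C0 : cps a x (CPSeries a x)) by (apply CPSeries_conv with r; [exact Ha|lra]).
assert (C1 : cps (CPS_derive a) x (CPSeries (CPS_derive a) x)).
{ apply CPSeries_conv with (r / 2)%R; [apply geom_bounded_derive; [lra|exact Ha]|lra]. }
assert (C2 : cps (CPS_derive (CPS_derive a)) x (CPSeries (CPS_derive (CPS_derive a)) x)).
{ apply CPSeries_conv with (r / 2 / 2)%R; [|lra].
  apply geom_bounded_derive; [lra|]. apply geom_bounded_derive; [lra|exact Ha]. }
set (f := CPSeries a x) in *. set (f1 := CPSeries (CPS_derive a) x) in *.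
set (f2 := CPSeries (CPS_derive (CPS_derive a)) x) in *.
replace (residual s p d0 d1 x f f1 f2) with
  (x * (x * (x * f2)) + (pA s p * (x * (x * f1)) + (pmu p * (x * f1)
   + (- pmu p * (x * (x * (x * f1))) + (pB p * (x * f) + (pmu p * pC s p * f
   + (- (pmu p * pD s p) * (x * (x * f)) + (- tm1 s d1 * 1 + (- d0 * (x * 1)
   + - tp1 s d1 * (x * (x * 1))))))))))).
- assert (S := fun a l => cps_shift a x l). assert (K := fun c a l => cps_scal c a x l).
  assert (P := fun a b l m => cps_plus a b x l m). assert (U := cps_unit x).
  exact (P _ _ _ _ (S _ _ (S _ _ (S _ _ C2))) (P _ _ _ _ (K _ _ _ (S _ _ (S _ _ C1)))
    (P _ _ _ _ (K _ _ _ (S _ _ C1)) (P _ _ _ _ (K _ _ _ (S _ _ (S _ _ (S _ _ C1))))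
    (P _ _ _ _ (K _ _ _ (S _ _ C0)) (P _ _ _ _ (K _ _ _ C0)
    (P _ _ _ _ (K _ _ _ (S _ _ (S _ _ C0))) (P _ _ _ _ (K _ _ _ U)
    (P _ _ _ _ (K _ _ _ (S _ _ U)) (K _ _ _ (S _ _ (S _ _ U)))))))))))).
- unfold residual, tm1, tp1. destruct s; simpl; field; exact Hx0.
Qed.

Lemma geom_bounded_ode s p d0 d1 a r : (0 < r)%R -> geom_bounded a r ->
  geom_bounded (ode s p d0 d1 a) (r / 4).
Proof.
intros Hr Ha.
assert (A1 : geom_bounded a (r / 4)) by (apply geom_bounded_le with r; [lra|exact Ha]).
assert (A2 : geom_bounded (CPS_derive a) (r / 2)) by now apply geom_bounded_derive.
assert (A3 : geom_bounded (CPS_derive a) (r / 4)).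
{ apply geom_bounded_le with (r / 2)%R; [lra|exact A2]. }
assert (A4 : geom_bounded (CPS_derive (CPS_derive a)) (r / 4)).
{ replace (r / 4)%R with (r / 2 / 2)%R by field. apply geom_bounded_derive; [lra|exact A2]. }
assert (Hr4 : (0 <= r / 4)%R) by lra.
assert (S := fun a => geom_bounded_shift a _ Hr4).
assert (K := fun c a => geom_bounded_scal c a (r / 4)).
assert (P := fun a b => geom_bounded_plus a b _ Hr4). assert (U := geom_bounded_unit (r / 4)).
exact (P _ _ (S _ (S _ (S _ A4))) (P _ _ (K _ _ (S _ (S _ A3))) (P _ _ (K _ _ (S _ A3))
  (P _ _ (K _ _ (S _ (S _ (S _ A3)))) (P _ _ (K _ _ (S _ A1)) (P _ _ (K _ _ A1)
  (P _ _ (K _ _ (S _ (S _ A1))) (P _ _ (K _ _ U) (P _ _ (K _ _ (S _ U))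
  (K _ _ (S _ (S _ U)))))))))))).
Qed.

Lemma conj_residual s p d0 d1 a r (x : C) : geom_bounded a r -> (Cmod x < r / 8)%R -> x <> 0 ->
  (is_conj_L p (fun w => CPSeries a (pow_pm s w)) (pow_pm s x) (d0 + d1 * pow_pm s x) <->
   CPSeries (ode s p d0 d1 a) x = 0).
Proof.
intros Ha Hx Hx0.
rewrite (is_conj_L_pow_pm s p _ x _ _ _ Hx0 (der2_CPSeries a r x Ha Hx)).
assert (E : CPSeries (ode s p d0 d1 a) x = _)
  by exact (CSeries_unique _ _ (ode_cps s p d0 d1 a r x Ha Hx Hx0)).
rewrite E. unfold residual. split.
- intros <-. ring.
- intros H. symmetry. apply Ceq_minus.
  match type of H with ?u = _ => transitivity (/ x * u); [field; exact Hx0|rewrite H; ring] end.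
Qed.

Lemma locally'_near (P : C -> Prop) :
  locally' (RtoC 0) P <-> near 0 (fun x => x <> 0 -> P x).
Proof. unfold locally', within. apply locally_near. Qed.

Lemma is_solution_CPSeries s p a r d0 d1 : (0 < r)%R -> geom_bounded a r ->
  (forall k, ode s p d0 d1 a k = 0) -> (s = Plus -> a 0%nat = 0) -> (exists k, a k <> 0) ->
  is_solution s p (CPSeries a) d0 d1.
Proof.
intros Hr Ha Ho H0 [m Hm]. split; [|split; [|split]].
- apply locally_near. exists (r / 4)%R. split; [lra|]. intros z Hz.
  replace (z - 0) with z in Hz by ring.
  apply ex_Cderive_der. eexists. now apply der_CPSeries with r.
- intros H. apply locally_near in H. apply Hm.
  apply (CPSeries_eq_0 a r Hr Ha). revert H. apply near_imp. auto.
- intros E. rewrite CPSeries_0. auto.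
- apply locally'_near. exists (r / 8)%R. split; [lra|]. intros x Hx Hx0. cbv zeta.
  replace (x - 0) with x in Hx by ring.
  apply (conj_residual s p d0 d1 a r x Ha Hx Hx0).
  apply CSeries_unique. apply (Cconv_ext (fun _ => 0)); [|apply Cconv_0].
  intros k. rewrite Ho. ring.
Qed.

(** Off 0 the equation gives the continuous derivative required by [power_series_of_der]; at 0
    differentiability supplies continuity. The residual is then a power series vanishing on a
    punctured neighbourhood. *)
Lemma is_solution_series s p f d0 d1 : is_solution s p f d0 d1 ->
  exists a r, (0 < r)%R /\ geom_bounded a r /\ near 0 (fun z => f z = CPSeries a z) /\
    (forall k, ode s p d0 d1 a k = 0) /\ (s = Plus -> a 0%nat = 0) /\ (exists k, a k <> 0).
Proof.
intros [H1 [H2 [H3 H4]]]. apply locally_near in H1. apply locally'_near in H4.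
assert (D2 : near 0 (fun x => x <> 0 -> exists f1 f2, der2 f x f1 f2)).
{ revert H4. apply near_imp. intros x H Hx. specialize (H Hx). cbv zeta in H.
  assert (Hz : pow_pm s x <> 0) by now apply pow_pm_neq_0.
  destruct (is_conj_L_der2 _ _ _ _ Hz H) as [g1 [g2 Hg]].
  destruct (der2_pow_pm s (fun w => f (pow_pm s w)) x g1 g2 Hx Hg) as [c [d Hcd]].
  exists c, d. eapply der2_ext_loc; [|exact Hcd].
  generalize (ccont_neq0 _ x (ccont_id x) Hx). apply near_imp.
  intros w Hw. cbv beta. now rewrite pow_pm_invol. }
(* [epsilon] turns the derivative into a total function, correct wherever the derivative exists. *)
set (f1 := fun z => epsilon (inhabits (RtoC 0)) (fun l => der f z l)).
assert (Hf1 : forall z l, der f z l -> f1 z = l).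
{ intros z l Hl. apply (der_unique f z); [|exact Hl]. unfold f1.
  apply epsilon_spec. now exists l. }
destruct D2 as [R0 [HR0 HD]].
destruct (power_series_of_der f f1 R0 HR0) as [a [r [Hr [Ha Hfa]]]].
- apply near_at in H1. apply ex_Cderive_der in H1. destruct H1 as [l Hl].
  now apply der_ccont with l.
- intros w Hw Hw0. destruct (HD w) as [l [m [g [Hg [Eg Hm]]]]].
  + now replace (w - 0) with w by ring.
  + exact Hw0.
  + split.
    * generalize (near_at _ _ Hg). cbv beta. intros D. now rewrite (Hf1 _ _ D).
    * apply ccont_ext_loc with g; [|now apply der_ccont with m].
      revert Hg. apply near_imp. intros v Hv. symmetry. now apply Hf1.
- exists a, r. split; [exact Hr|]. split; [exact Ha|].
  assert (Hfn : near 0 (fun z => f z = CPSeries a z)).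
  { exists r. split; [exact Hr|]. intros z Hz. apply Hfa. now replace (z - 0) with z in Hz by ring. }
  split; [exact Hfn|]. split; [|split].
  + apply (CPSeries_eq_0 _ (r / 4)); [lra|now apply geom_bounded_ode|].
    assert (Hr8 : (0 < r / 8)%R) by lra.
    generalize (near_and _ _ _ H4 (near_and _ _ _ (near_ball 0 _ Hr8) (near_near _ _ Hfn))).
    apply near_imp. intros x [K1 [K2 K3]] Hx0. specialize (K1 Hx0). cbv zeta in K1.
    replace (x - 0) with x in K2 by ring.
    apply (conj_residual s p d0 d1 a r x Ha K2 Hx0).
    assert (DJ := der2_CPSeries a r x Ha K2).
    rewrite (is_conj_L_pow_pm s p _ x _ _ _ Hx0 DJ).
    assert (DF : der2 f x (CPSeries (CPS_derive a) x) (CPSeries (CPS_derive (CPS_derive a)) x)).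
    { eapply der2_ext_loc; [|exact DJ]. revert K3. apply near_imp. intros; now symmetry. }
    rewrite (is_conj_L_pow_pm s p _ x _ _ _ Hx0 DF) in K1.
    rewrite (near_at _ _ K3) in K1. exact K1.
  + intros E. rewrite <- CPSeries_0. rewrite <- (near_at _ _ Hfn). now apply H3.
  + apply NNPP. intros Hn. apply H2. apply locally_near. revert Hfn. apply near_imp.
    intros z ->. apply CSeries_unique. apply (Cconv_ext (fun _ => 0)); [|apply Cconv_0].
    intros k. assert (E : a k = 0).
    { apply NNPP. intros N. apply Hn. now exists k. }
    rewrite E. ring.
Qed.

(** [d0] is read off degree 1, [d1] off degree 2 for [Plus] and degree 0 for [Minus]. For [Plus],
    degree 0 says [mu * b * a 0 = 0], in accordance with [f_+(0) = 0]. *)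
Definition D0f (s : pm_sign) (p : params) (a : nat -> C) : C :=
  pB p * a 0%nat + pmu p * (1 + pC s p) * a 1%nat.

Definition D1f (s : pm_sign) (p : params) (a : nat -> C) : C :=
  match s with
  | Plus => (pA s p + pB p) * a 1%nat + pmu p * (2 + pC s p) * a 2%nat
            - pmu p * pD s p * a 0%nat
  | Minus => pmu p * pC s p * a 0%nat
  end.

(** The relations free of [d0], [d1] begin in degree 3 with [a 1] for [Plus], in degree 2 with [a 0]
    for [Minus]; the truncation lets both start at index 0. *)
Definition trunc (s : pm_sign) (a : nat -> C) (j : nat) : C :=
  match s with Plus => a (S j) | Minus => a j end.

Lemma ode_rec_Plus p d0 d1 a j : ode Plus p d0 d1 a (S (S (S j))) =
  rq Plus p j * a (S (S j)) + rbe Plus p j * a (S (S (S j))) - ral Plus p j * a (S j).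
Proof.
destruct p as [[[n la] mu] b]. unfold ode, rq, rbe, ral, CPS_derive, tm1, tp1.
cbn [shift unit_seq pA pB pC pD pmu cn cla cb].
rewrite !S_INR, !RtoC_plus. ring.
Qed.

Lemma ode_rec_Minus p d0 d1 a j : ode Minus p d0 d1 a (S (S j)) =
  rq Minus p j * a (S j) + rbe Minus p j * a (S (S j)) - ral Minus p j * a j.
Proof.
destruct p as [[[n la] mu] b]. unfold ode, rq, rbe, ral, CPS_derive, tm1, tp1.
(* Degree 2 lies below the triple shifts, so [j = 0] reduces differently from the other cases. *)
destruct j as [|j]; cbn [shift unit_seq pA pB pC pD pmu cn cla cb];
rewrite !S_INR, !RtoC_plus; simpl INR; ring.
Qed.

Lemma ode_low s p d0 d1 a : ode s p d0 d1 a 0%nat = pmu p * pC s p * a 0%nat - tm1 s d1 /\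
  ode s p d0 d1 a 1%nat = D0f s p a - d0 /\
  (s = Plus -> ode s p d0 d1 a 2%nat = D1f s p a - d1).
Proof.
unfold ode, CPS_derive. cbn [shift unit_seq INR]. split; [|split].
- ring.
- unfold D0f. ring.
- intros ->. unfold D1f, tp1. rewrite RtoC_plus. ring.
Qed.

Lemma ode_iff s p d0 d1 (a : nat -> C) : (s = Plus -> a 0%nat = 0) ->
  ((forall k, ode s p d0 d1 a k = 0) <->
   (d0 = D0f s p a /\ d1 = D1f s p a /\
    forall j, rq s p j * trunc s a (S j) + rbe s p j * trunc s a (S (S j)) = ral s p j * trunc s a j)).
Proof.
intros H0. destruct (ode_low s p d0 d1 a) as [L0 [L1 L2]]. split.
- intros H. rewrite H in L0, L1. split; [|split].
  + apply Ceq_minus. replace (d0 - D0f s p a) with (- (D0f s p a - d0)) by ring.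
    rewrite <- L1. ring.
  + destruct s.
    * specialize (L2 eq_refl). rewrite H in L2. apply Ceq_minus.
      replace (d1 - D1f Plus p a) with (- (D1f Plus p a - d1)) by ring. rewrite <- L2. ring.
    * unfold D1f. apply Ceq_minus. simpl tm1 in L0.
      match type of L0 with _ = ?u => replace (d1 - pmu p * pC Minus p * a 0%nat) with (- u) by ring end.
      rewrite <- L0. ring.
  + intros j. apply Ceq_minus. destruct s; simpl trunc.
    * rewrite <- (H (S (S (S j)))), ode_rec_Plus. ring.
    * rewrite <- (H (S (S j))), ode_rec_Minus. ring.
- intros [E0 [E1 Hr]] k. destruct s.
  + destruct k as [|[|[|k]]].
    * rewrite L0, (H0 eq_refl). simpl. ring.
    * rewrite L1, E0. ring.
    * rewrite (L2 eq_refl), E1. ring.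
    * rewrite ode_rec_Plus. simpl trunc in Hr. rewrite Hr. ring.
  + destruct k as [|[|k]].
    * rewrite L0. simpl tm1. rewrite E1. unfold D1f. ring.
    * rewrite L1, E0. ring.
    * rewrite ode_rec_Minus. simpl trunc in Hr. rewrite Hr. ring.
Qed.

(** * The entire solution and its uniqueness *)

Definition coefs (s : pm_sign) (p : params) : nat -> C :=
  match s with Plus => shift (rsol Plus p) | Minus => rsol Minus p end.

Lemma trunc_coefs s p j : trunc s (coefs s p) j = rsol s p j.
Proof. destruct s; reflexivity. Qed.

Lemma rsol_geom_bounded s p r : in_U p -> (0 <= r)%R -> geom_bounded (rsol s p) r.
Proof.
intros HU Hr. destruct (recurrence_bounds_at s p HU) as [K [HK [H1 [H2 H3]]]].
now apply rcoef_geom_bounded with K.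
Qed.

Lemma coefs_geom_bounded s p r : in_U p -> (0 <= r)%R -> geom_bounded (coefs s p) r.
Proof.
intros HU Hr. destruct s; simpl; [apply geom_bounded_shift; [exact Hr|]|];
now apply rsol_geom_bounded.
Qed.

Lemma kap_neq_0 s p i : in_U p -> kap s p i <> 0.
Proof.
intros HU. apply in_U_iff in HU. destruct HU as [U1 [U2 U3]].
assert (NI : forall z : C, z <> 0 -> / z <> 0).
{ intros z Hz E. apply C1_nz. rewrite <- (Cinv_r z Hz), E. ring. }
unfold kap, rinv. destruct s.
- apply Cmult_neq_0; [exact U1|]. apply NI. exact (not_integer_shift_S _ 1 i U2).
- apply Cmult_neq_0; [exact U1|]. apply Cmult_neq_0.
  + assert (N := not_integer_shift_S _ 0 i (not_integer_opp _ U2)).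
    replace (1 + - (1) * / (RtoC (INR (S i)) + (0 + - cb p))) with
      ((RtoC (INR (S i)) + (-(1) + - cb p)) * / (RtoC (INR (S i)) + (0 + - cb p)))
      by (field; rewrite Cplus_0_l in N; exact N).
    apply Cmult_neq_0; [|apply NI; exact N].
    replace (-(1)) with (RtoC (IZR (-1))) by (rewrite <- RtoC_opp; reflexivity).
    exact (not_integer_shift_S _ (-1) i (not_integer_opp _ U2)).
  + apply NI. exact (not_integer_shift_S _ 1 i (not_integer_opp _ U3)).
Qed.

Lemma rsol_neq_0 s p : in_U p -> exists j, rsol s p j <> 0.
Proof.
intros HU. destruct (recurrence_bounds_at s p HU) as [K [HK [H1 [H2 H3]]]].
destruct (subdom_neq_0 (useq s p) (vseq s p) K HK H2 H3) as [j Hj]. exists j.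
unfold rsol, rcoef. apply Cmult_neq_0; [|exact Hj]. apply cprod_neq_0.
intros i. now apply kap_neq_0.
Qed.

Definition solF (s : pm_sign) (p : params) : C -> C := CPSeries (coefs s p).
Definition solD0 (s : pm_sign) (p : params) : C := D0f s p (coefs s p).
Definition solD1 (s : pm_sign) (p : params) : C := D1f s p (coefs s p).

Lemma coefs_Plus_0 s p : s = Plus -> coefs s p 0%nat = 0.
Proof. intros ->. reflexivity. Qed.

Lemma is_solution_solF s p : in_U p -> is_solution s p (solF s p) (solD0 s p) (solD1 s p).
Proof.
intros HU. apply is_solution_CPSeries with 1%R; [lra|apply coefs_geom_bounded; [exact HU|lra]| | |].
- refine (proj2 (ode_iff s p _ _ _ (coefs_Plus_0 s p)) _). split; [reflexivity|split; [reflexivity|]].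
  intros j. rewrite !trunc_coefs. now apply rsol_rec.
- apply coefs_Plus_0.
- destruct (rsol_neq_0 s p HU) as [j Hj]. destruct s; [now exists (S j)|now exists j].
Qed.

(** The constants [d0], [d1] are linear in the coefficients, so the factor found for the
    coefficients serves the whole triple. Comparison with [solF] yields uniqueness and the entire
    extension at once. *)
Lemma is_solution_proportional s p f d0 d1 : in_U p -> is_solution s p f d0 d1 ->
  exists c : C, c <> 0 /\ near 0 (fun z => f z = c * solF s p z) /\
    d0 = c * solD0 s p /\ d1 = c * solD1 s p.
Proof.
intros HU H.
destruct (is_solution_series _ _ _ _ _ H) as [a [r [Hr [Ha [Hf [Ho [H0 [m Hm]]]]]]]].
destruct (proj1 (ode_iff s p d0 d1 a H0) Ho) as [E0 [E1 Hrec]].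
assert (Ga : geom_bounded (trunc s a) r).
{ destruct s; simpl; [now apply geom_bounded_tail|exact Ha]. }
destruct (rbe_le_ral s p HU) as [K HK].
assert (Hc : exists c, forall j, trunc s a j = c * rsol s p j).
{ apply (rec_proportional (ral s p) (rbe s p) (rq s p)).
  - intros j. now apply rbe_neq_0.
  - now apply rsol_rec.
  - exact Hrec.
  - now apply rsol_neq_0.
  - apply (casoratian_zero (ral s p) (rbe s p) (rq s p) _ _ K r Hr); auto.
    + intros j. now apply ral_neq_0.
    + now apply rsol_rec.
    + intros t Ht. now apply rsol_geom_bounded. }
destruct Hc as [c Hc].
assert (Hca : forall k, a k = c * coefs s p k).
{ intros k. destruct s; simpl in *; [|apply Hc].
  destruct k as [|k]; simpl; [rewrite (H0 eq_refl); ring|apply Hc]. }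
exists c. split; [|split; [|split]].
- intros E. apply Hm. rewrite Hca, E. ring.
- generalize (near_and _ _ _ Hf (near_ball 0 1 ltac:(lra))). apply near_imp.
  intros z [-> Hz]. replace (z - 0) with z in Hz by ring. apply CSeries_unique.
  apply (Cconv_ext (fun k => c * (coefs s p k * z ^ k))); [intros k; rewrite Hca; ring|].
  apply Cconv_scal. apply CPSeries_conv with 1%R; [|exact Hz].
  apply coefs_geom_bounded; [exact HU|lra].
- rewrite E0. unfold solD0, D0f. rewrite !Hca. ring.
- rewrite E1. unfold solD1, D1f. rewrite !Hca. destruct s; ring.
Qed.

Lemma der_solF s p z : in_U p -> exists l, der (solF s p) z l.
Proof.
intros HU. eexists. apply der_CPSeries with (4 * (Cmod z + 1))%R; [|lra].
apply coefs_geom_bounded; [exact HU|]. generalize (Cmod_ge_0 z). lra.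
Qed.

(** * Holomorphic dependence on the parameters *)

Lemma ex_series_exp_shifted (K Z c : R) : ex_series (fun k => K ^ k / INR (fact k) * c * Z ^ k)%R.
Proof.
apply (ex_series_ext (fun k => c * ((K * Z) ^ k * / INR (fact k)))%R).
- intros k. rewrite Rpow_mult_distr. change (c * (K ^ k * Z ^ k * / INR (fact k)) =
    K ^ k / INR (fact k) * c * Z ^ k)%R. unfold Rdiv. ring.
- apply (ex_series_scal (V := R_NormedModule) c). exists (exp (K * Z)).
  generalize (is_exp_Reals (K * Z)). intros H. apply is_pseries_R in H.
  revert H. apply is_series_ext. intros n. apply Rmult_comm.
Qed.

Lemma c11_pow {T : NormedModule C_AbsRing} e (B : T -> Prop) f A k : (0 <= e)%R ->
  c11 e B f A -> c11 e B (fun q => f q ^ k) (A ^ k).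
Proof.
intros He H. induction k as [|k IH]; simpl.
- eapply c11_le; [|apply c11_const]. rewrite Cmod_1. lra.
- now apply c11_mult.
Qed.

(** The variable [z] is one more linear coordinate, of norm at most [Z] near [q0]. Each term of the
    power series is then a product in the algebra [c11], of norm at most a constant times
    [K^k Z^k / k!] up to the index shift for [Plus], and joint holomorphy needs no separate
    treatment of [z]. *)
Lemma holomorphic_solF s :
  holomorphic_on (V := prod_NormedModule C_AbsRing params_NormedModule C_NormedModule)
    (fun q : params * C => in_U (fst q)) (fun q : params * C => solF s (fst q) (snd q)).
Proof.
set (T := prod_NormedModule C_AbsRing params_NormedModule C_NormedModule).
intros q0 HU.
assert (HP : is_linear (K := C_AbsRing) (U := T) (V := params_NormedModule) fst)
  by apply is_linear_fst.
destruct (recurrence_bounds (T := T) fst HP q0 HU s) as [d [K [Hd [HK [H1 [H2 H3]]]]]].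
assert (HZ : exists Z, jet (V := T) 1 (nball q0 d) snd (fun _ h => snd h) Z).
{ apply (jet_linear (V := T) 1 (nball q0 d) snd); [lra|apply is_linear_snd|].
  exists (norm q0 + d)%R. intros x. apply (norm_nball (T := T)). }
destruct HZ as [Z HZ].
assert (CZ : c11 (V := T) 1 (nball q0 d) snd Z) by (eexists; exact HZ).
assert (CR : forall k, c11 (V := T) 1 (nball q0 d) (fun q => rsol s (fst q) k)
   (K ^ k / INR (fact k) * subdom_bound K)).
{ intros k. apply (c11_rcoef (T := T) 1 (nball q0 d) (fun i q => kap s (fst q) i)
    (fun i q => useq s (fst q) i) (fun i q => vseq s (fst q) i)); auto. lra. }
assert (HJ : exists A, c11 (V := T) 1 (nball q0 d) (fun q => solF s (fst q) (snd q)) A).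
{ destruct s.
  (* For [Plus] the coefficient of degree [S j] is the recurrence solution at [j], so the factorial
     lags one behind the power of [Z]. *)
  - set (A := fun k => match k with O => 0%R
      | S j => (K ^ j / INR (fact j) * subdom_bound K * Z ^ (S j))%R end).
    exists (Series A).
    apply (c11_series (V := T) 1 (nball q0 d) (fun k q => coefs Plus (fst q) k * snd q ^ k)).
    + lra.
    + intros [|j]; simpl coefs.
      * apply c11_ext with (fun _ => 0); [intros q _; simpl; ring|].
        eapply c11_le; [|apply c11_const]. rewrite Cmod_0. simpl. lra.
      * apply c11_mult; [lra|apply CR|]. apply c11_pow; [lra|exact CZ].
    + apply ex_series_incr_1. simpl A.
      apply (ex_series_ext (fun k => K ^ k / INR (fact k) * (subdom_bound K * Z) * Z ^ k)%R).
      * intros k. change (K ^ k / INR (fact k) * (subdom_bound K * Z) * Z ^ k =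
          K ^ k / INR (fact k) * subdom_bound K * (Z * Z ^ k))%R. ring.
      * apply ex_series_exp_shifted.
  - exists (Series (fun k => K ^ k / INR (fact k) * subdom_bound K * Z ^ k)%R).
    apply (c11_series (V := T) 1 (nball q0 d) (fun k q => coefs Minus (fst q) k * snd q ^ k)).
    + lra.
    + intros k. apply c11_mult; [lra|apply CR|]. apply c11_pow; [lra|exact CZ].
    + apply ex_series_exp_shifted. }
destruct HJ as [A [D HJ]]. eapply jet_filterdiff; [exact HJ|].
now apply (locally_nball (T := T)).
Qed.

Section HolomorphicConstants.

Context (p0 : params) (HU : in_U p0).

(** A constant family with bound 1: just some local [c11] bound near [p0], phrased so that the
    closure lemmas for [lbound] apply. *)
Notation lb f := (lbound (T := params_NormedModule) p0 (fun _ => f) (fun _ => 1%R)).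

Lemma lb_plus f g : lb f -> lb g -> lb (fun q => f q + g q).
Proof. apply lbound_plus. Qed.

Lemma lb_mult f g : lb f -> lb g -> lb (fun q => f q * g q).
Proof. apply lbound_scal_l. Qed.

Lemma lb_opp f : lb f -> lb (fun q => - f q).
Proof.
intros H. apply (lbound_ext _ (fun _ q => -(1) * f q)); [intros; ring|].
apply lb_mult; [apply lbound_const|exact H].
Qed.

Lemma lb_coords : lb cn /\ lb cla /\ lb pmu /\ lb cb.
Proof.
assert (HP := is_linear_id (K := C_AbsRing) (V := params_NormedModule)).
repeat split; apply lbound_linear.
- exact (lin_cn (T := params_NormedModule) (fun q => q) HP).
- exact (lin_cla (T := params_NormedModule) (fun q => q) HP).
- exact (lin_pmu (T := params_NormedModule) (fun q => q) HP).
- exact (lin_cb (T := params_NormedModule) (fun q => q) HP).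
Qed.

Lemma lb_pABCD s : lb (pA s) /\ lb pB /\ lb (pC s) /\ lb (pD s).
Proof.
destruct lb_coords as [H1 [H2 [H3 H4]]].
assert (E : forall f g : params -> C, (forall q, f q = g q) -> lb f -> lb g).
{ intros f g H. apply lbound_ext. auto. }
repeat split.
- destruct s.
  + apply (E (fun q => 2 * cb q + cn q)); [intros [[[n la] mu] b]; reflexivity|].
    apply lb_plus; [apply lb_mult; [apply lbound_const|]|]; assumption.
  + apply (E (fun q => 2 + (- (2 * cb q) + - cn q)));
      [intros [[[n la] mu] b]; simpl; ring|].
    apply lb_plus; [apply lbound_const|]. apply lb_plus; apply lb_opp; [|assumption].
    apply lb_mult; [apply lbound_const|assumption].
- apply (E (fun q => cb q * (cb q + (-(1) + cn q)) + cla q));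
    [intros [[[n la] mu] b]; simpl; ring|].
  apply lb_plus; [apply lb_mult; [assumption|]|assumption].
  apply lb_plus; [assumption|]. apply lb_plus; [apply lbound_const|assumption].
- destruct s.
  + apply (E cb); [intros [[[n la] mu] b]; reflexivity|assumption].
  + apply (E (fun q => - (cb q + cn q))); [intros [[[n la] mu] b]; reflexivity|].
    apply lb_opp, lb_plus; assumption.
- destruct s.
  + apply (E (fun q => cb q + cn q)); [intros [[[n la] mu] b]; reflexivity|].
    apply lb_plus; assumption.
  + apply (E (fun q => - cb q)); [intros [[[n la] mu] b]; reflexivity|].
    apply lb_opp; assumption.
Qed.

Lemma lb_coefs s k : lb (fun q => coefs s q k).
Proof.
assert (R : forall j, lb (fun q => rsol s q j)).
{ intros j. destruct (recurrence_bounds (T := params_NormedModule) (fun q => q)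
    (is_linear_id (K := C_AbsRing) (V := params_NormedModule)) p0 HU s)
    as [d [K [Hd [HK [H1 [H2 H3]]]]]].
  assert (HR := c11_rcoef (T := params_NormedModule) 1 (nball p0 d) (fun i q => kap s q i)
    (fun i q => useq s q i) (fun i q => vseq s q i) K j ltac:(lra) HK H1 H2 H3).
  exists d. eexists. split; [exact Hd|split; [|intros _; rewrite Rmult_1_r; exact HR]].
  eapply c11_nonneg; [|exact HR]. lra. }
destruct s; simpl; [|apply R].
destruct k as [|k]; simpl; [apply lbound_const|apply R].
Qed.

Lemma lb_solD0 s : lb (solD0 s).
Proof.
destruct lb_coords as [H1 [H2 [H3 H4]]]. destruct (lb_pABCD s) as [HA [HB [HC HD]]].
unfold solD0, D0f. apply lb_plus; apply lb_mult; auto using lb_coefs.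
apply lb_mult; [assumption|]. apply lb_plus; [apply lbound_const|assumption].
Qed.

Lemma lb_solD1 s : lb (solD1 s).
Proof.
destruct lb_coords as [H1 [H2 [H3 H4]]]. destruct (lb_pABCD s) as [HA [HB [HC HD]]].
unfold solD1, D1f. destruct s.
- apply lb_plus; [apply lb_plus; apply lb_mult|apply lb_opp; apply lb_mult]; auto using lb_coefs.
  + apply lb_plus; assumption.
  + apply lb_mult; [assumption|]. apply lb_plus; [apply lbound_const|assumption].
  + apply lb_mult; assumption.
- apply lb_mult; [apply lb_mult; assumption|apply lb_coefs].
Qed.

Lemma ex_filterdiff_lb f : lb f ->
  ex_filterdiff (K := C_AbsRing) (U := params_NormedModule) (V := C_NormedModule) f (locally p0).
Proof.
intros [d [K [Hd [_ H]]]]. destruct (H 0%nat) as [D HD].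
exact (jet_filterdiff (V := params_NormedModule) 1 _ f D _ p0 HD
  (locally_nball (T := params_NormedModule) p0 d Hd)).
Qed.

End HolomorphicConstants.

(** * Reality for real parameters *)

Definition Creal (c : C) : Prop := Im c = 0%R.

Lemma Creal_RtoC x : Creal (RtoC x).
Proof. reflexivity. Qed.

Lemma Creal_plus a b : Creal a -> Creal b -> Creal (a + b).
Proof. unfold Creal. intros Ha Hb. rewrite im_plus, Ha, Hb. ring. Qed.

Lemma Creal_opp a : Creal a -> Creal (- a).
Proof. unfold Creal. intros Ha. rewrite im_opp, Ha. ring. Qed.

Lemma Creal_mult a b : Creal a -> Creal b -> Creal (a * b).
Proof. unfold Creal. intros Ha Hb. rewrite im_mult, Ha, Hb. ring. Qed.

Lemma Creal_inv a : Creal a -> Creal (/ a).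
Proof. unfold Creal. destruct a as [x y]. simpl. unfold Im; simpl. intros ->. unfold Rdiv. ring. Qed.

Lemma Creal_pow a k : Creal a -> Creal (a ^ k).
Proof. intros H. induction k; simpl; [apply Creal_RtoC|now apply Creal_mult]. Qed.

Lemma Creal_CSeries a : (forall n, Creal (a n)) -> Creal (CSeries a).
Proof.
(* The zero term is written [0 * 0] so that [Series_scal_l] evaluates the sum. *)
intros H. unfold Creal, CSeries. simpl. rewrite (Series_ext _ (fun _ => 0 * 0)%R).
- rewrite Series_scal_l. ring.
- intros n. rewrite H. ring.
Qed.

Lemma Creal_trec u v m j : (forall i, Creal (u i)) -> (forall i, Creal (v i)) -> Creal (trec u v m j).
Proof.
intros Hu Hv. revert j.
assert (P : forall m, (forall j, Creal (trec u v m j)) /\ (forall j, Creal (trec u v (S m) j))).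
{ clear m. induction m as [|m [I1 I2]].
  - split; intros j; simpl; [apply Creal_RtoC|]. apply Creal_plus; [apply Creal_RtoC|apply Hu].
  - split; [exact I2|]. intros j.
    change (Creal ((1 + u j) * trec u v (S m) (S j) + v j * trec u v m (S (S j)))).
    apply Creal_plus; apply Creal_mult; auto. apply Creal_plus; [apply Creal_RtoC|apply Hu]. }
apply P.
Qed.

Lemma Creal_rcoef k u v j : (forall i, Creal (k i)) -> (forall i, Creal (u i)) ->
  (forall i, Creal (v i)) -> Creal (rcoef k u v j).
Proof.
intros Hk Hu Hv. apply Creal_mult.
- induction j; simpl; [apply Creal_RtoC|now apply Creal_mult].
- apply Creal_plus; [apply Creal_RtoC|]. apply Creal_CSeries. intros m.
  apply Creal_plus; [|apply Creal_opp]; now apply Creal_trec.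
Qed.

(** Weights, backward recursion and series involve field operations and sums with real constants
    only, so the normalisation by the limit 1 is already a real one. *)
Lemma Creal_solF s p x : Creal (cn p) -> Creal (cla p) -> Creal (pmu p) -> Creal (cb p) -> Creal x ->
  Creal (solF s p x).
Proof.
intros H1 H2 H3 H4 Hx.
assert (RI : forall i c, Creal c -> Creal (rinv i c)).
{ intros i c Hc. apply Creal_inv, Creal_plus; [apply Creal_RtoC|exact Hc]. }
assert (RR : forall j, Creal (rsol s p j)).
{ intros j. apply Creal_rcoef; intros i; unfold kap, useq, vseq, rinv2; destruct s;
  repeat first [assumption | apply Creal_RtoC | apply Creal_mult | apply RI
    | apply Creal_plus | apply Creal_opp]. }
apply Creal_CSeries. intros k. apply Creal_mult; [|now apply Creal_pow].
destruct s; simpl; [|apply RR]. destruct k; simpl; [apply Creal_RtoC|apply RR].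
Qed.

Theorem theorem1p1 :
  forall s : pm_sign,
    (forall p : params, in_U p ->
       (exists (f : C -> C) (d0 d1 : C), is_solution s p f d0 d1) /\
       (forall (f g : C -> C) (d0 d1 e0 e1 : C),
          is_solution s p f d0 d1 -> is_solution s p g e0 e1 ->
          exists c : C, c <> 0 /\
            locally (RtoC 0) (fun z => g z = c * f z) /\
            e0 = c * d0 /\ e1 = c * d1) /\
       (forall (f : C -> C) (d0 d1 : C), is_solution s p f d0 d1 ->
          exists F : C -> C,
            (forall z : C, ex_Cderive F z) /\
            locally (RtoC 0) (fun z => F z = f z))) /\
    (exists (F : params -> C -> C) (D0 D1 : params -> C),
       (forall p : params, in_U p -> is_solution s p (F p) (D0 p) (D1 p)) /\
       holomorphic_on (fun q : params * C => in_U (fst q))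
         (fun q : params * C => F (fst q) (snd q)) /\
       holomorphic_on (fun p : params => in_U p) D0 /\
       holomorphic_on (fun p : params => in_U p) D1 /\
       (forall n lambda mu b x : R,
          in_U (RtoC n, RtoC lambda, RtoC mu, RtoC b) ->
          Im (F (RtoC n, RtoC lambda, RtoC mu, RtoC b) (RtoC x)) = 0%R)).
Proof.
intros s. split.
- intros p HU. split; [|split].
  + exists (solF s p), (solD0 s p), (solD1 s p). now apply is_solution_solF.
  + intros f g d0 d1 e0 e1 Hf Hg.
    destruct (is_solution_proportional s p f d0 d1 HU Hf) as [c [Hc [Fc [-> ->]]]].
    destruct (is_solution_proportional s p g e0 e1 HU Hg) as [c' [Hc' [Gc [-> ->]]]].
    (* Both solutions are non-zero multiples of [solF], whence the quotient. *)
    exists (c' / c). split; [|split; [|split]].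
    * intros E. apply Hc'. replace c' with (c' / c * c) by (field; exact Hc). rewrite E. ring.
    * apply locally_near. generalize (near_and _ _ _ Fc Gc). apply near_imp.
      intros z [-> ->]. field. exact Hc.
    * field. exact Hc.
    * field. exact Hc.
  + intros f d0 d1 Hf.
    destruct (is_solution_proportional s p f d0 d1 HU Hf) as [c [_ [Fc _]]].
    exists (fun z => c * solF s p z). split.
    * intros z. apply ex_Cderive_der. destruct (der_solF s p z HU) as [l Hl].
      exists (c * l). now apply der_scal.
    * apply locally_near. revert Fc. apply near_imp. intros z Hz. now symmetry.
- exists (solF s), (solD0 s), (solD1 s). split; [|split; [|split; [|split]]].
  + intros p. apply is_solution_solF.
  + apply holomorphic_solF.
  + intros p HU. apply ex_filterdiff_lb. now apply lb_solD0.
  + intros p HU. apply ex_filterdiff_lb. now apply lb_solD1.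
  + intros n lambda mu b x _. apply Creal_solF; apply Creal_RtoC.
Qed.
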